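(* Let $\eta\ge0$. Assume that $U$ goes to infinity at infinity, that $|\nabla H|\ge h>0$ outside some large ball of $\mathbb R^{2d}$, and that $\theta(r)\le c\,e^{C_0r}$ for all $r$ sufficiently large, for some positive constants $c,C_0$. Assume there exists a (smooth) function $W$ with $W(x,y)\ge w>0$ for all $(x,y)$ and constants $\lambda,b>0$ such that $$L_\eta W(x,y)\le-\lambda H(x,y)W(x,y)+b\quad\text{for all }(x,y).$$ Then there exists $\rho>0$ such that for all smooth $g$ with $\int g^2d\mu=1$, $$\mathrm{Ent}_\mu(g^2)\le\rho\int\big(H^{-2\eta}|\nabla_xg|^2+|\nabla_yg|^2\big)d\mu .$$
   Context: $U:\mathbb R^d\to\mathbb R$ smooth, $U\ge1$, $\int e^{-U}dx<\infty$, $H(x,y)=U(x)+\frac12|y|^2$, $\mu=Z^{-1}e^{-H}dxdy$ on $\mathbb R^{2d}$. $\mathrm{Ent}_\mu(f)=\int f\ln f\,d\mu-\int fd\mu\ln\int fd\mu$. For $\eta\ge0$, $$L_\eta=H^{-2\eta}\Delta_x+\Delta_y-H^{-2\eta}\Big(2\eta\frac{\nabla_xH}{H}+\nabla_xH\Big)\cdot\nabla_x-\nabla_yH\cdot\nabla_y,$$ which is symmetric in $L^2(\mu)$ with $\int fL_\eta g\,d\mu=-\int(H^{-2\eta}\nabla_xf\cdot\nabla_xg+\nabla_yf\cdot\nabla_yg)d\mu$. $A_r=\{(x,y):H(x,y)\le r\}$ and $\theta(r)=\sup_{z\in\partial A_r}\max_{i,j=1,\dots,2d}\big|\frac{\partial^2H}{\partial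 z_i\partial z_j}(z)\big|$. *)

(* Defs.v *)
From HB Require Import structures.
From mathcomp Require Import all_boot all_order all_algebra.
From mathcomp Require Import all_classical all_reals all_analysis.
Set Implicit Arguments. Unset Strict Implicit. Unset Printing Implicit Defensive.
Import Order.TTheory GRing.Theory Num.Theory.
Import numFieldNormedType.Exports.
Local Open Scope classical_set_scope.
Local Open Scope ring_scope.

(* squared Euclidean norm (NB: the library norm on 'rV is the sup norm) *)
Definition sqnorm (R : realType) (n : nat) (v : 'rV[R]_n) : R :=
  \sum_(i < n) v 0 i ^+ 2.

Definition enorm (R : realType) (n : nat) (v : 'rV[R]_n) : R :=
  Num.sqrt (sqnorm v).

Definition basis_vec (R : realType) (n : nat) (i : 'I_n) : 'rV[R]_n :=
  delta_mx 0 i.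

Definition partial (R : realType) (n : nat) (i : 'I_n)
  (f : 'rV[R]_n -> R) : 'rV[R]_n -> R :=
  fun z => derive f z (basis_vec R i).

Fixpoint iter_partial (R : realType) (n : nat) (s : seq 'I_n)
  (f : 'rV[R]_n -> R) : 'rV[R]_n -> R :=
  match s with
  | [::] => f
  | i :: s' => partial i (iter_partial s' f)
  end.

Definition smooth (R : realType) (n : nat) (f : 'rV[R]_n -> R) : Prop :=
  forall (s : seq 'I_n) (z : 'rV[R]_n), differentiable (iter_partial s f) z.

Definition grad_norm (R : realType) (n : nat) (f : 'rV[R]_n -> R)
  (z : 'rV[R]_n) : R :=
  enorm (\row_(i < n) partial i f z).

(* Integral of a nonnegative extended-real function on R^n w.r.t. the
   n-dimensional Lebesgue measure, written as the iterated integral of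
   one-dimensional Lebesgue integrals (equal to the integral against the
   product Lebesgue measure by Tonelli, for measurable functions). *)
Fixpoint leb_nnint (R : realType) (n : nat) :
  ('rV[R]_n -> \bar R) -> \bar R :=
  match n return ('rV[R]_n -> \bar R) -> \bar R with
  | 0 => fun f => f 0
  | n'.+1 => fun f =>
      (\int[@lebesgue_measure R]_(t in [set: R])
         leb_nnint (fun v : 'rV[R]_n' =>
                      f (row_mx (const_mx t : 'rV[R]_1) v)))%E
  end.

Definition leb_int (R : realType) (n : nat) (f : 'rV[R]_n -> R) : \bar R :=
  (leb_nnint (fun z => (Num.max (f z) 0)%:E)
   - leb_nnint (fun z => (Num.max (- f z) 0)%:E))%E.

(* z = (x, y) with x = lsubmx z, y = rsubmx z *)
Definition Ham (R : realType) (d : nat) (U : 'rV[R]_d -> R)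
  (z : 'rV[R]_(d + d)) : R :=
  U (lsubmx z) + 2^-1 * sqnorm (rsubmx z).

Definition Zconst (R : realType) (d : nat) (U : 'rV[R]_d -> R) : R :=
  fine (leb_int (fun z : 'rV[R]_(d + d) => expR (- Ham U z))).

Definition mu_int (R : realType) (d : nat) (U : 'rV[R]_d -> R)
  (f : 'rV[R]_(d + d) -> R) : \bar R :=
  ((Zconst U)^-1%:E * leb_int (fun z => (f z * expR (- Ham U z))%R))%E.

Definition Ent (R : realType) (d : nat) (U : 'rV[R]_d -> R)
  (f : 'rV[R]_(d + d) -> R) : \bar R :=
  (mu_int U (fun z => (f z * ln (f z))%R)
   - mu_int U f * (ln (fine (mu_int U f)))%:E)%E.

Definition dx (R : realType) (d : nat) (i : 'I_d)
  (f : 'rV[R]_(d + d) -> R) := partial (lshift d i) f.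
Definition dy (R : realType) (d : nat) (i : 'I_d)
  (f : 'rV[R]_(d + d) -> R) := partial (rshift d i) f.

Definition L_op (R : realType) (d : nat) (U : 'rV[R]_d -> R) (eta : R)
  (f : 'rV[R]_(d + d) -> R) (z : 'rV[R]_(d + d)) : R :=
  let H := Ham U in
  let p := powR (H z) (- (2 * eta)) in
  p * (\sum_(i < d) dx i (dx i f) z)
  + \sum_(i < d) dy i (dy i f) z
  - p * (\sum_(i < d) (2 * eta * dx i H z / H z + dx i H z) * dx i f z)
  - \sum_(i < d) dy i H z * dy i f z.

Definition energy_density (R : realType) (d : nat) (U : 'rV[R]_d -> R)
  (eta : R) (g : 'rV[R]_(d + d) -> R) (z : 'rV[R]_(d + d)) : R :=
  powR (Ham U z) (- (2 * eta)) * (\sum_(i < d) dx i g z ^+ 2)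
  + \sum_(i < d) dy i g z ^+ 2.

Definition sublevel (R : realType) (d : nat) (U : 'rV[R]_d -> R) (r : R)
  : set 'rV[R]_(d + d) := [set z | Ham U z <= r].

Definition boundary (R : realType) (n : nat) (A : set 'rV[R]_n)
  : set 'rV[R]_n := closure A `\` interior A.

Definition theta (R : realType) (d : nat) (U : 'rV[R]_d -> R) (r : R)
  : \bar R :=
  ereal_sup [set e : \bar R | exists z i j,
     boundary (sublevel U r) z /\
     e = (`| partial i (partial j (Ham U)) z |)%:E].

(* Main.v *)
Require Import Defs.
From HB Require Import structures.
From mathcomp Require Import all_boot all_order all_algebra.
From mathcomp Require Import all_classical all_reals all_analysis.
From mathcomp Require Import measurable_realfun ring lra.
Import Order.TTheory GRing.Theory Num.Theory.
Import numFieldNormedType.Exports.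
Local Open Scope classical_set_scope.
Local Open Scope ring_scope.

Set Implicit Arguments. Unset Strict Implicit. Unset Printing Implicit Defensive.

(** Write [p = exp (- H)], [I f] for the Lebesgue integral of [f] on [R^n], [n = 2d],
    and [G h] for the energy density. Three inequalities are combined.

    Lyapunov: since [p L_eta W] is a divergence, integrating [- L_eta W / W * h^2]
    by parts (after a Euclidean cutoff) gives
    [I (H h^2 p) <= A I (G h p) + B I (h^2 p)].

    Local inequalities: averaging
    [f(z)^2 <= (f(z) - f(z+u))^2 + 2 |f(z)| |f(z+u)|] over a small cube of
    translations [u] gives the Nash inequality
    [I (f^2) <= n s^2 I (|grad f|^2) + 2 (2s)^-n (I |f|)^2], and the same increments
    give the Poincaré inequality on cubes. The latter and the Lyapunov inequality
    yield [I ((h - c)^2 p) <= C I (G h p)] for some constant [c].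

    Defective log-Sobolev: where [h^2 <= exp (K H)], the quantity [h^2 ln h^2] is at
    most [K H h^2]. The rest is covered by the layers
    [f_k = h^3 / (e^k + h^2) * ((1 + k/K - H)_+)^2], whose [L^1] norm is
    [O (e^(-k/2))] up to a factor [e^(C k / K)]. The bound on theta controls
    [|grad H|] by [e^(C H)], because [H >= 0] has second derivatives bounded by
    [c e^(C H)]; hence Nash with [s = e^(-k/(2(n+1)))] shows that [I (f_k^2)] decays
    geometrically as soon as [K] is large.

    Tightening: if [I ((g - c)^2 p)] is not small, the Poincaré inequality absorbs the
    defect; otherwise [c] is bounded away from [0], and the defective inequality is
    applied to [g - c], since
    [x^2 ln x^2 - x^2 + 1 <= 12 (u^2 + u^2 (ln u^2)_+)] for [u = x - 1]. *)

(** * Lebesgue measure on row vectors *)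

(** Every degeneracy is at most exponential in [H]: on [H <= T] the quantities [H^(2 eta)], [1/p]
    and [|grad H|] are bounded by exponentials of multiples of [T]. The Lyapunov inequality gains
    exactly one factor [H], which pays for the logarithm only where [ln h^2 <= K H]. This forces the
    cut in [H] to rise linearly with the level: at [h^2] of size [e^k] it sits near [k/K], where
    degeneracy costs [e^(C k/K)], and [K] stays free to make this smaller than the gain. The working
    class is C1, not smooth: cutoffs and layers are built from a squared positive part. Integrals
    live in the extended reals, and infinite energy is dismissed as trivial, so no density argument
    is needed. The constant [c] is a value of the function at a point of a cube, not its mean. In
    the tightening the terms that are not quadratic in [g - c] integrate to [(1 + ln c^2 - c^2) Z],
    which is nonpositive for every [c] away from [0], so [c] need not be computed. The integral of
    the statement is an iterated one; it is realised by a measure so that Tonelli, translations and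
    limit theorems apply. *)

Section borel_product.
Context (R : realType) (V : pseudoMetricType R) (W : topologicalType).
Context (d1 d2 : measure_display) (T1 : measurableType d1) (T2 : measurableType d2).
Variables (i : T1 -> V) (j : T2 -> W).
Hypothesis mi : forall O, open O -> measurable (i @^-1` O).
Hypothesis mj : forall O, open O -> measurable (j @^-1` O).
Variables (I : countType) (e : I -> V).
Hypothesis dense_e : forall x (eps : R), 0 < eps -> exists k, ball x eps (e k).

(* [O] is the union, over the countably many balls [B] centred at the [e k] with
   rational radius, of [B] times the interior of [{w | B x {w} <= O}]. *)
Lemma measurable_open_prod (O : set (V * W)) :
  open O -> measurable [set p : T1 * T2 | O (i p.1, j p.2)].
Proof.
move=> oO.
pose B (k : I) (m : nat) : set V := (ball (e k) (m.+1%:R^-1 + m.+1%:R^-1 : R))°.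
pose C k m : set W := [set w | forall x, B k m x -> O (x, w)]°.
have -> : [set p : T1 * T2 | O (i p.1, j p.2)] =
   \bigcup_(km : I * nat) ((i @^-1` B km.1 km.2) `*` (j @^-1` C km.1 km.2)).
  apply/seteqP; split => [[s t] /= Op|[s t] [[k m] _] [/= Bs]].
    have [[P Q] /= [Ps Qt] PQ] := open_nbhs_nbhs (conj oO Op).
    move: Ps; rewrite -nbhs_ballE => -[eps /= eps0 Ps].
    have [m /= me] : exists m, m.+1%:R^-1 + (m.+1%:R^-1 + m.+1%:R^-1) < eps.
      have : 0 < eps / 3 by rewrite divr_gt0.
      move=> e20; have [m _ /(_ m (leqnn m))/= mE] := near_infty_natSinv_lt (PosNum e20).
      exists m; have {}mE : m.+1%:R^-1 < eps / 3 := mE; move: (m.+1%:R^-1) mE => r; lra.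
    have [k ke] := @dense_e (i s) (m.+1%:R^-1) ltac:(by []).
    have m0 : 0 < (m.+1%:R^-1 : R) by [].
    have sB : B k m `<=` P.
      move=> x /interior_subset xb; apply: Ps; apply: le_ball (ltW me) _ _.
      exact: ball_triangle ke xb.
    exists (k, m) => //; split => /=.
      rewrite /B /interior -nbhs_ballE; exists m.+1%:R^-1 => //= y sy.
      by apply: ball_triangle sy; exact: ball_sym.
    rewrite /C /interior; apply: filterS Qt => w Qw x Bx.
    by apply: PQ; split => //=; exact: sB.
  by rewrite /C => /interior_subset; apply.
apply: countable_bigcupT_measurable => [|[k m]]; first exact: countableP.
by apply: measurableX; [apply: mi|apply: mj]; exact: open_interior.
Qed.

End borel_product.

Section sigma_finite_pack.
Context (d : measure_display) (T : measurableType d) (R : realType).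
Variables (nu : {measure set T -> \bar R}).

(** Taking the proof of sigma-finiteness as an argument lets the structure be attached to a measure
    built in the middle of a proof, as the induction defining [leb] requires. *)
Definition sigma_finite_copy of sigma_finite setT nu : set T -> \bar R := nu.

Variable sf : sigma_finite setT nu.

HB.instance Definition _ := Measure.copy (sigma_finite_copy sf) nu.
HB.instance Definition _ :=
  Measure_isSigmaFinite.Build _ _ _ (sigma_finite_copy sf) sf.

Lemma sigma_finite_measure_pack :
  exists mu : {sigma_finite_measure set T -> \bar R}, mu = nu :> (set T -> \bar R).
Proof. by exists (sigma_finite_copy sf). Qed.

End sigma_finite_pack.

Section borel_space.
Variable R : realType.

Definition borel_rV n := g_sigma_algebraType (@open ('rV[R]_n)).

Lemma measurable_open_rV n (O : set 'rV[R]_n) :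
  open O -> measurable (O : set (borel_rV n)).
Proof. by move=> oO; exact: sub_sigma_algebra. Qed.

Lemma measurable_continuous_rV n (f : 'rV[R]_n -> R) :
  continuous f -> measurable_fun [set: borel_rV n] f.
Proof.
move=> /continuousP cf; apply: (measurability _ (RGenOpens.measurableE R)).
move=> _ [_ [a [b ->] <-]]; rewrite setTI.
by apply: measurable_open_rV; apply: cf; exact: interval_open.
Qed.

Lemma measurable_to_borel_rV (d : measure_display) (T : measurableType d) n
    (f : T -> 'rV[R]_n) :
  (forall O, open O -> measurable (f @^-1` O)) ->
  measurable_fun setT (f : T -> borel_rV n).
Proof.
move=> mf; apply: (@measurability _ _ T (borel_rV n) setT f (@open 'rV[R]_n)); first by [].
by move=> _ [B oB <-]; rewrite setTI; exact: mf.
Qed.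

Lemma rat_ball_dense (x eps : R) : 0 < eps -> exists q : rat, ball x eps (ratr q).
Proof.
move=> e0; have [q] := @rat_in_itvoo R (x - eps) (x + eps) ltac:(lra).
rewrite in_itv/= => /andP[q1 q2]; exists q.
by rewrite /ball/= distrC ltr_distl q1 q2.
Qed.

Lemma ratmx_ball_dense n (x : 'rV[R]_n) (eps : R) : 0 < eps ->
  exists q : 'rV[rat]_n, ball x eps (map_mx ratr q).
Proof.
move=> e0; have /choice[q qP] : forall i : 'I_n, exists q : rat, ball (x 0 i) eps (ratr q).
  by move=> i; exact: rat_ball_dense.
exists (\row_i q i); split => // i j; rewrite !mxE ord1; exact: qP.
Qed.

Definition cons_rV n (p : R * 'rV[R]_n) : 'rV[R]_n.+1 :=
  row_mx (const_mx p.1 : 'rV[R]_1) p.2.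

Lemma cons_rV_ball n (p q : R * 'rV[R]_n) (eps : R) :
  ball p.1 eps q.1 -> ball p.2 eps q.2 -> ball (cons_rV p) eps (cons_rV q).
Proof.
move=> b1 [eps0 b2]; split => // i j; rewrite /cons_rV; case: (@split_ordP 1 n j) => k ->.
  by rewrite !(@row_mxEl _ 1 1 n) !mxE.
by rewrite !(@row_mxEr _ 1 1 n).
Qed.

Lemma continuous_cons_rV n : continuous (@cons_rV n).
Proof.
move=> p A /nbhs_ballP[eps /= e0 eA].
exists (ball p.1 eps, ball p.2 eps) => /=; first by split; exact: nbhsx_ballx.
by move=> q [/= q1 q2]; apply: eA; exact: cons_rV_ball.
Qed.

(** The domain carries the product of two sigma-algebras, not the Borel sigma-algebra of the product
    space; the density of rational points bridges the two. *)
Lemma measurable_cons_rV n :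
  measurable_fun [set: measurableTypeR R * borel_rV n]
    (@cons_rV n : _ -> borel_rV n.+1).
Proof.
apply: measurable_to_borel_rV => O oO.
have := @measurable_open_prod R R 'rV[R]_n _ _ (measurableTypeR R) (borel_rV n)
  id id (@open_measurable R) (@measurable_open_rV n) _ _ rat_ball_dense
  (@cons_rV n @^-1` O).
rewrite /=; apply.
by apply: open_comp => // p _; exact: continuous_cons_rV.
Qed.



Definition uncons_rV n (z : 'rV[R]_n.+1) : R * 'rV[R]_n :=
  (z 0 ord0, @rsubmx R 1 1 n z).

Lemma cons_rVK n : cancel (@cons_rV n) (@uncons_rV n).
Proof.
move=> [t v]; rewrite /cons_rV /uncons_rV; congr pair; last exact: row_mxKr.
have -> : ord0 = lshift n (0 : 'I_1) :> 'I_n.+1 by exact: val_inj.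
by rewrite (@row_mxEl _ 1 1 n) mxE.
Qed.

Lemma uncons_rVK n : cancel (@uncons_rV n) (@cons_rV n).
Proof.
move=> z; rewrite /cons_rV /uncons_rV/= -[RHS](@hsubmxK _ 1 1 n).
suff -> : (const_mx (z 0 ord0) : 'rV[R]_1) = @lsubmx R 1 1 n z by [].
by apply/rowP => i; rewrite !mxE ord1; congr (z 0 _); exact: val_inj.
Qed.

Lemma continuous_rsubmx m n : continuous (@rsubmx R 1 m n).
Proof.
move=> z A /nbhs_ballP[eps /= e0 eA]; apply/nbhs_ballP; exists eps => //= y [_ zy].
by apply: eA; split => // i j; rewrite !mxE; exact: zy.
Qed.

Lemma measurable_uncons_rV n :
  measurable_fun [set: borel_rV n.+1]
    (@uncons_rV n : _ -> measurableTypeR R * borel_rV n).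
Proof.
apply/measurable_fun_pairP; split.
  by apply: measurable_continuous_rV => z; exact: coord_continuous.
apply: measurable_to_borel_rV => O oO; apply: measurable_open_rV.
by apply: open_comp => // z _; exact: (@continuous_rsubmx 1 n).
Qed.

(** [leb_nnint] is only a functional. Pushing the product of one-dimensional Lebesgue measure and
    the previous measure along [cons_rV] reproduces its recursion by Tonelli, starting from the
    Dirac mass on the one-point space. *)
Lemma leb_measure_exists n :
  exists mu : {sigma_finite_measure set (borel_rV n) -> \bar R},
    forall f : borel_rV n -> \bar R, measurable_fun setT f ->
      (forall z, 0 <= f z)%E -> (\int[mu]_z f z = leb_nnint f)%E.
Proof.
elim: n => [|n [mu IH]].
  exists (\d_(0 : borel_rV 0)) => f mf f0 /=.
  by rewrite integral_dirac// diracT mul1e.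
pose m1 : {sigma_finite_measure set (measurableTypeR R) -> \bar R} := @lebesgue_measure R.
pose nuf : {measure set (borel_rV n.+1) -> \bar R} :=
  pushforward (m1 \x mu)%E
    (@cons_rV n : (measurableTypeR R * borel_rV n)%type -> borel_rV n.+1).
pose nu := nuf (@measurable_cons_rV n).
have sf : sigma_finite setT nu.
  have /sigma_finiteP[F [FT ndF Ffin]] := sigma_finiteT m1.
  have /sigma_finiteP[G [GT ndG Gfin]] := sigma_finiteT mu.
  (* Both families increase, so the index [maxn k1 k2] serves both coordinates. *)
  exists (fun k => @uncons_rV n @^-1` (F k `*` G k)).
    apply/esym; rewrite -subTset => z _.
    have [k1 _ Fk] : (\bigcup_k F k) (uncons_rV z).1 by rewrite -FT.
    have [k2 _ Gk] : (\bigcup_k G k) (uncons_rV z).2 by rewrite -GT.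
    exists (maxn k1 k2) => //; split.
      by move: Fk; exact/subsetPset/ndF/leq_maxl.
    by move: Gk; exact/subsetPset/ndG/leq_maxr.
  move=> k; have [mF Fk] := Ffin k; have [mG Gk] := Gfin k; split.
    by rewrite -[X in measurable X]setTI; apply: measurable_uncons_rV => //;
      exact: measurableX.
  rewrite [X in (X < _)%E](_ : _ = (m1 \x mu)%E (F k `*` G k)).
    by rewrite product_measure1E// lte_mul_pinfty// ge0_fin_numE.
  have E : @cons_rV n @^-1` (@uncons_rV n @^-1` (F k `*` G k)) = F k `*` G k.
    by apply/funext => p; exact: (congr1 (F k `*` G k) (cons_rVK p)).
  exact: (congr1 (m1 \x mu)%E E).
have [nusf nusfE] := sigma_finite_measure_pack sf.
exists nusf => f mf f0.
rewrite [LHS](_ : _ = \int[nu]_z f z)%E; last first.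
  by apply: eq_measure_integral => A _ _; exact: (congr1 (fun m => m A) nusfE).
rewrite /nu /nuf ge0_integral_pushforward//; last exact: measurable_cons_rV.
have mcons := @measurable_cons_rV n.
have mfc : measurable_fun [set: (measurableTypeR R * borel_rV n)%type] (f \o @cons_rV n).
  exact: (measurableT_comp mf mcons).
have f0c p : (0 <= (f \o @cons_rV n) p)%E by exact: f0.
rewrite preimage_setT (fubini_tonelli1 _ mfc f0c).
apply: eq_integral => t _; rewrite /fubini_F/= IH//.
apply: (measurableT_comp mf).
exact: (measurableT_comp mcons (@measurable_pair1 _ _ _ _ t)).
Qed.

Definition leb n : {sigma_finite_measure set (borel_rV n) -> \bar R} :=
  projT1 (cid (leb_measure_exists n)).

Lemma leb_nnintE n (f : 'rV[R]_n -> \bar R) :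
  measurable_fun [set: borel_rV n] f -> (forall z, 0 <= f z)%E ->
  (leb_nnint f = \int[leb n]_z f z)%E.
Proof. by move=> mf f0; rewrite /leb; case: cid => mu /= ->. Qed.

Lemma leb_intE n (f : 'rV[R]_n -> R) : measurable_fun [set: borel_rV n] f ->
  (leb_int f = \int[leb n]_z (f z)%:E)%E.
Proof.
move=> mf.
rewrite integralE /leb_int !leb_nnintE//; last 4 first.
- by apply/measurable_EFinP; apply: measurable_maxr => //; exact: measurableT_comp.
- by move=> z; rewrite lee_fin le_max lexx orbT.
- by apply/measurable_EFinP; apply: measurable_maxr.
- by move=> z; rewrite lee_fin le_max lexx orbT.
by congr (_ - _)%E; apply: eq_integral => z _;
  rewrite ?funeposE ?funenegE/= EFin_max.
Qed.

End borel_space.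

(** * Translation invariance and the volume of cubes *)

Section translation.
Variable R : realType.

Lemma lebesgue_measure_shift (a : R) (A : set R) : measurable A ->
  pushforward lebesgue_measure
    ((fun t => t + a) : measurableTypeR R -> measurableTypeR R) A = lebesgue_measure A.
Proof.
move=> mA.
have ma : measurable_fun setT ((fun t => t + a) : measurableTypeR R -> measurableTypeR R).
  exact: measurable_funD.
apply/esym/lebesgue_measure_unique => //= _ [[x y]] _ <-.
rewrite /pushforward (_ : _ @^-1` _ = `]x - a, y - a]%classic); last first.
  by apply/seteqP; split => t /=; rewrite !in_itv/= ltrBlDr lerBrDr.
by rewrite !lebesgue_measure_itv/= !lte_fin ltrD2r -!EFinB opprB addrA subrK.
Qed.

Lemma integral_shift (a : R) (f : R -> \bar R) : measurable_fun setT f ->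
  (forall t, 0 <= f t)%E ->
  (\int[lebesgue_measure]_t f (t + a)%R = \int[lebesgue_measure]_t f t)%E.
Proof.
move=> mf f0; apply/esym.
have ma : measurable_fun setT ((fun t => t + a) : measurableTypeR R -> measurableTypeR R).
  exact: measurable_funD.
transitivity (\int[pushforward lebesgue_measure
    ((fun t => t + a)%R : measurableTypeR R -> measurableTypeR R)]_t f t)%E.
  by apply: eq_measure_integral => A mA _; apply/esym/lebesgue_measure_shift.
by rewrite ge0_integral_pushforward.
Qed.

Notation leb := (@leb R).
Notation V := (borel_rV R).

Lemma measurable_continuous_rV_rV m n (f : 'rV[R]_m -> 'rV[R]_n) :
  continuous f -> measurable_fun [set: V m] (f : V m -> V n).
Proof.
move=> cf; apply: measurable_to_borel_rV => O oO; apply: measurable_open_rV.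
by apply: open_comp => // z _; exact: cf.
Qed.

Lemma measurable_shift_rV n (a : 'rV[R]_n) :
  measurable_fun [set: V n] ((fun z => z + a) : V n -> V n).
Proof.
have ca : continuous (fun z : 'rV[R]_n => z + a).
  by move=> z; apply: continuousD; [exact: cvg_id|exact: cst_continuous].
exact: (measurable_continuous_rV_rV ca).
Qed.

Lemma measurable_cons_fun n (f : V n.+1 -> \bar R) : measurable_fun setT f ->
  measurable_fun [set: (measurableTypeR R * V n)%type] (f \o @cons_rV R n).
Proof. move=> mf; exact: (measurableT_comp mf (@measurable_cons_rV R n)). Qed.

Lemma measurable_cons_fun1 n (f : V n.+1 -> \bar R) t : measurable_fun setT f ->
  measurable_fun [set: V n] (fun v => f (cons_rV (t, v))).
Proof.
move=> mf; apply: (measurableT_comp mf).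
exact: (measurableT_comp (@measurable_cons_rV R n) (@measurable_pair1 _ _ _ _ t)).
Qed.

Lemma integral_leb_cons n (f : V n.+1 -> \bar R) : measurable_fun setT f ->
  (forall z, 0 <= f z)%E ->
  (\int[leb n.+1]_z f z =
   \int[lebesgue_measure]_t \int[leb n]_v f (cons_rV (t, v)))%E.
Proof.
move=> mf f0; rewrite -leb_nnintE//=; apply: eq_integral => t _.
by rewrite -leb_nnintE//; exact: measurable_cons_fun1.
Qed.

Lemma integral_leb0 (f : V 0 -> \bar R) : measurable_fun setT f ->
  (forall z, 0 <= f z)%E -> (\int[leb 0]_z f z)%E = f (0 : 'rV[R]_0).
Proof. by move=> mf f0; rewrite -leb_nnintE. Qed.

Lemma cons_rVD n t (v : 'rV[R]_n) (a : 'rV[R]_n.+1) :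
  cons_rV (t, v) + a = cons_rV (t + (uncons_rV a).1, v + (uncons_rV a).2).
Proof.
rewrite -[a in LHS]uncons_rVK /cons_rV (@add_row_mx _ 1 1 n).
by congr (@row_mx _ 1 1 n _ _); apply/rowP => i; rewrite !mxE.
Qed.

Lemma integral_leb_shift n (a : 'rV[R]_n) (f : V n -> \bar R) :
  measurable_fun setT f -> (forall z, 0 <= f z)%E ->
  (\int[leb n]_z f (z + a)%R = \int[leb n]_z f z)%E.
Proof.
elim: n a f => [|n IH] a f mf f0.
  by apply: eq_integral => z _; congr f; apply/rowP => -[].
rewrite !integral_leb_cons//; last first.
  exact: measurableT_comp mf (measurable_shift_rV a).
pose F t := (\int[leb n]_v f (cons_rV (t, v)))%E.
transitivity (\int[lebesgue_measure]_t F (t + (uncons_rV a).1)%R)%E.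
  apply: eq_integral => t _.
  under eq_integral do rewrite cons_rVD.
  by rewrite (IH _ (fun v => f (cons_rV (t + (uncons_rV a).1, v))))//;
    exact: measurable_cons_fun1.
apply: integral_shift => [|t].
  exact: (@measurable_fun_fubini_tonelli_F _ _ _ _ _ (leb n) (f \o @cons_rV R n)
    (measurable_cons_fun mf) (fun p => f0 _)).
exact: integral_ge0.
Qed.

(** Closed balls of the sup norm for [0 <= a]. They factor along [cons_rV], which gives their exact
    volume by induction, and they are convex and compact. *)
Definition cube n (a : R) : set 'rV[R]_n := [set z | forall i, `|z 0 i| <= a].

Lemma closed_cube n a : closed (@cube n a).
Proof.
rewrite (_ : cube a = \bigcap_(i : 'I_n) ((fun z : 'rV[R]_n => `|z 0 i|) @^-1` [set t | t <= a])).
  apply: closed_bigI => i _; apply: closed_comp; last exact: closed_le.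
  move=> z _; apply: continuous_comp; first exact: coord_continuous.
  exact: norm_continuous.
by apply/seteqP; split => z zP i; [move=> _; exact: zP|exact: (zP i I)].
Qed.

Lemma measurable_cube n a : measurable (@cube n a : set (V n)).
Proof.
by rewrite -[X in measurable X]setCK; apply: measurableC; apply: measurable_open_rV;
  apply: closed_openC; exact: closed_cube.
Qed.

Lemma cube_cons n (a : R) t v :
  @cube n.+1 a (cons_rV (t, v)) <-> `|t| <= a /\ @cube n a v.
Proof.
split => [za|[ta va] i].
  split; [have := za (lshift n (0 : 'I_1))|move=> i; have := za (rshift 1 i)].
    by rewrite /cons_rV (@row_mxEl _ 1 1 n) mxE.
  by rewrite /cons_rV (@row_mxEr _ 1 1 n).
rewrite /cons_rV; case: (@split_ordP 1 n i) => k ->.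
  by rewrite (@row_mxEl _ 1 1 n) mxE.
by rewrite (@row_mxEr _ 1 1 n).
Qed.

Lemma leb_indic n (A : set (V n)) : measurable A ->
  (leb n A = \int[leb n]_z (\1_A z)%:E)%E.
Proof. by move=> mA; rewrite integral_indic// setIT. Qed.

Lemma leb_cube n (a : R) : 0 <= a -> leb n (@cube n a) = ((2 * a) ^+ n)%:E.
Proof.
move=> a0; elim: n => [|n IH].
  rewrite leb_indic; last exact: measurable_cube.
  rewrite integral_leb0 ?expr0//.
  - by rewrite indicE mem_set// => -[].
  - by apply/measurable_EFinP; apply: measurable_indic; exact: measurable_cube.
rewrite leb_indic; last exact: measurable_cube.
rewrite integral_leb_cons//; last first.
  by apply/measurable_EFinP; apply: measurable_indic; exact: measurable_cube.
transitivity (\int[lebesgue_measure]_t ((\1_(`[(- a), a]%classic) t)%:E * ((2 * a) ^+ n)%:E))%E.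
  apply: eq_integral => t _; rewrite -IH leb_indic; last exact: measurable_cube.
  rewrite -ge0_integralZl//; last first.
    by apply/measurable_EFinP; apply: measurable_indic; exact: measurable_cube.
  apply: eq_integral => v _; rewrite -EFinM !indicE -natrM mulnb; congr ((nat_of_bool _)%:R%:E).
  apply/idP/andP => [/set_mem/cube_cons[ta va]|[/set_mem/= ta /set_mem va]].
    by split; apply/mem_set => //=; rewrite in_itv/= -ler_norml.
  by apply/mem_set/cube_cons; split => //; move: ta; rewrite in_itv/= -ler_norml.
rewrite ge0_integralZr//; last first.
- by rewrite lee_fin exprn_ge0// mulr_ge0.
- by apply/measurable_EFinP; apply: measurable_indic.
rewrite integral_indic// setIT. rewrite /= lebesgue_measure_itv/= lte_fin.
case: ltP => [_|]; first by rewrite -EFinB -EFinM exprS opprK -mulr2n mulr_natl.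
(* The degenerate interval: both sides are zero. *)
move=> aa; have -> : a = 0 by lra.
by rewrite mulr0 mul0e expr0n.
Qed.
End translation.

(** * Increments and gradients *)

Section segment.
Variable R : realType.
Notation leb := (@leb R).
Notation V := (borel_rV R).

Lemma FTC2_derive (phi dphi : R -> R) (a b : R) : a < b ->
  (forall t : R, is_derive t 1 phi (dphi t)) -> continuous dphi ->
  (\int[lebesgue_measure]_(t in `[a, b]) (dphi t)%:E = (phi b - phi a)%:E)%E.
Proof.
move=> ab dphiE cdphi; rewrite EFinB; apply: continuous_FTC2 => //.
- exact: continuous_subspaceT.
- have cphi : continuous phi.
    by move=> t; apply/differentiable_continuous/derivable1_diffP; have [] := dphiE t.
  split; first by move=> t _; have [] := dphiE t.
  + exact/cvg_at_right_filter/cphi.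
  + exact/cvg_at_left_filter/cphi.
- by move=> t _; rewrite derive1E; have [] := dphiE t.
Qed.

(** With [c] the increment, [2 c dphi - c^2 <= dphi^2] holds pointwise, and the left side is the
    derivative of [psi], whose increment is [c^2]. This is Cauchy-Schwarz obtained from the
    fundamental theorem alone. *)
Lemma sqr_increment_le (phi dphi : R -> R) :
  (forall t : R, is_derive t 1 phi (dphi t)) -> continuous dphi ->
  (((phi 1 - phi 0) ^+ 2)%:E <=
   \int[lebesgue_measure]_(t in `[0%R, 1%R]) (dphi t ^+ 2)%:E)%E.
Proof.
move=> dphiE cdphi; pose c := phi 1 - phi 0.
pose psi t := 2 * c * phi t - c ^+ 2 * t.
pose dpsi t := 2 * c * dphi t - c ^+ 2.
have cdpsi : continuous dpsi.
  move=> t; apply: cvgB; last exact: cvg_cst.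
  by apply: cvgM; [exact: cvg_cst|exact: cdphi].
have cdphi2 : continuous (fun t => dphi t ^+ 2).
  by move=> t; apply: cvgM; exact: cdphi.
have dpsiE (t : R) : is_derive t 1 psi (dpsi t).
  rewrite /psi /dpsi; have dt := dphiE t.
  by apply: is_derive_eq; rewrite /GRing.scale/= mulr1.
have -> : c ^+ 2 = psi 1 - psi 0 by rewrite /psi /c; ring.
have icont (f : R -> R) : continuous f ->
    lebesgue_measure.-integrable `[0%R, 1%R]%classic (EFin \o f).
  move=> cf; apply: continuous_compact_integrable; first exact: segment_compact.
  exact: continuous_subspaceT.
rewrite -(FTC2_derive ltr01 dpsiE cdpsi); apply: le_integral => //.
- exact: icont.
- exact: icont.
- move=> t _; rewrite lee_fin /dpsi.
  by have := sqr_ge0 (dphi t - c); lra.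
Qed.

Lemma continuous_sum_ord (T : topologicalType) n (F : 'I_n -> T -> R) :
  (forall i, continuous (F i)) -> continuous (fun x => \sum_i F i x).
Proof.
elim: n F => [F _|n IH F cF].
  by under eq_fun do rewrite big_ord0; move=> x; exact: cst_continuous.
under eq_fun do rewrite big_ord_recl.
move=> x; apply: cvgD; first exact: cF.
by apply: (IH (fun i => F (lift ord0 i))) => i; exact: cF.
Qed.

Definition C1 n (f : 'rV[R]_n -> R) :=
  (forall z, differentiable f z) /\ forall i, continuous (partial i f).

Definition gradsq n (f : 'rV[R]_n -> R) z := \sum_i partial i f z ^+ 2.

Lemma gradsq_ge0 n (f : 'rV[R]_n -> R) z : 0 <= gradsq f z.
Proof. by apply: sumr_ge0 => i _; exact: sqr_ge0. Qed.

Lemma sqnorm_ge0 n (u : 'rV[R]_n) : 0 <= sqnorm u.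
Proof. by apply: sumr_ge0 => i _; exact: sqr_ge0. Qed.

Lemma C1_continuous n (f : 'rV[R]_n -> R) : C1 f -> continuous f.
Proof. by move=> [df _] z; exact: differentiable_continuous. Qed.

Lemma gradsq_continuous n (f : 'rV[R]_n -> R) : C1 f -> continuous (gradsq f).
Proof.
move=> [_ cf]; apply: continuous_sum_ord => i z.
exact: (cvgM (cf i z) (cf i z)).
Qed.

Lemma rV_basisE n (u : 'rV[R]_n) : u = \sum_i u 0 i *: basis_vec R i.
Proof. exact: row_sum_delta. Qed.

Lemma derive_partial n (f : 'rV[R]_n -> R) z u : differentiable f z ->
  'D_u f z = \sum_i u 0 i * partial i f z.
Proof.
move=> df; rewrite deriveE// {1}(rV_basisE u) linear_sum; apply: eq_bigr => i _.
by rewrite linearZ/= /partial deriveE.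
Qed.

Lemma cauchy_schwarz_sum n (a b : 'I_n -> R) :
  (\sum_i a i * b i) ^+ 2 <= (\sum_i a i ^+ 2) * (\sum_i b i ^+ 2).
Proof.
set A := \sum_i a i ^+ 2; set B := \sum_i b i ^+ 2; set C := \sum_i a i * b i.
have B0 : 0 <= B by apply: sumr_ge0 => i _; exact: sqr_ge0.
(* This sum equals [B (A B - C^2)]; dividing by [B] leaves the case [B = 0], where every [b i]
   vanishes. *)
have : 0 <= \sum_i (B * a i - C * b i) ^+ 2 by apply: sumr_ge0 => i _; exact: sqr_ge0.
rewrite [X in 0 <= X](_ : _ = B * (A * B - C ^+ 2)); last first.
  transitivity (B ^+ 2 * A - 2 * B * C * C + C ^+ 2 * B); last by ring.
  have -> : B ^+ 2 * A = \sum_i B ^+ 2 * a i ^+ 2 by rewrite mulr_sumr.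
  have -> : 2 * B * C * C = \sum_i 2 * B * C * (a i * b i) by rewrite -mulr_sumr.
  have -> : C ^+ 2 * B = \sum_i C ^+ 2 * b i ^+ 2 by rewrite -mulr_sumr.
  by rewrite -sumrB -big_split/=; apply: eq_bigr => i _; ring.
move: B0; rewrite le_eqVlt => /predU1P[B0 _|B0].
  rewrite -B0 mulr0 (_ : C = 0) ?expr0n//.
  rewrite /C big1// => i _.
  have /psumr_eq0P : \sum_i b i ^+ 2 = 0 by [].
  by move/(_ (fun j _ => sqr_ge0 _))/(_ i isT)/eqP; rewrite sqrf_eq0 => /eqP->; rewrite mulr0.
by rewrite pmulr_rge0// subr_ge0.
Qed.

Lemma is_derive_segment n (f : 'rV[R]_n -> R) z u (t : R) :
  differentiable f (z + t *: u) ->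
  is_derive t 1 (fun s : R => f (z + s *: u)) ('D_u f (z + t *: u)).
Proof.
move=> df; have dv : derivable f (z + t *: u) u by exact: diff_derivable.
have E : (fun h : R => h^-1 *: (f (z + (h *: 1 + t) *: u) - f (z + t *: u))) =
    (fun h => h^-1 *: ((f \o shift (z + t *: u)) (h *: u) - f (z + t *: u))).
  apply/funext => h; congr (_ *: (f _ - _)).
  have -> : h *: (1 : R) = h by rewrite /GRing.scale/= mulr1.
  by rewrite scalerDl addrCA.
by apply: DeriveDef; rewrite /derivable /derive /= ?[X in cvg (X @ _)]E ?E.
Qed.

Lemma continuous_segment n (z u : 'rV[R]_n) : continuous (fun t : R => z + t *: u).
Proof.
move=> t; apply: (@cvgD _ _ _ _ _ (cst z) (fun t : R => t *: u)); first exact: cvg_cst.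
exact: scalel_continuous.
Qed.

Lemma sqr_segment_le n (f : 'rV[R]_n -> R) z u : C1 f ->
  (((f (z + u) - f z) ^+ 2)%:E <=
   (sqnorm u)%:E * \int[lebesgue_measure]_(t in `[0%R, 1%R]) (gradsq f (z + t *: u)%R)%:E)%E.
Proof.
move=> C1f; have [df cf] := C1f.
pose phi t := f (z + t *: u).
pose dphi t := \sum_i u 0 i * partial i f (z + t *: u).
have dphiE (t : R) : is_derive t 1 phi (dphi t).
  by rewrite /dphi -derive_partial//; exact: is_derive_segment.
have cdphi : continuous dphi.
  apply: continuous_sum_ord => i t.
  apply: cvgM; first exact: cvg_cst.
  by apply: continuous_comp; [exact: continuous_segment|exact: cf].
have cg : continuous (fun t : R => gradsq f (z + t *: u)).
  by move=> t; apply: continuous_comp; [exact: continuous_segment|exact: gradsq_continuous].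
have -> : f (z + u) - f z = phi 1 - phi 0 by rewrite /phi scale1r scale0r addr0.
apply: le_trans (sqr_increment_le dphiE cdphi) _.
rewrite -ge0_integralZl//; last 3 first.
- by apply/measurable_EFinP; apply: measurable_funTS; exact: continuous_measurable_fun.
- by move=> t _; rewrite lee_fin gradsq_ge0.
- by rewrite lee_fin sqnorm_ge0.
apply: ge0_le_integral => //.
- by move=> t _; rewrite lee_fin sqr_ge0.
- apply/measurable_EFinP; apply: measurable_funTS; apply: continuous_measurable_fun => t.
  by apply: cvgM; exact: cdphi.
- apply/measurable_EFinP; apply: measurable_funTS; apply: continuous_measurable_fun => t.
  by apply: cvgM; [exact: cvg_cst|exact: cg].
- by move=> t _; rewrite -EFinM lee_fin; exact: cauchy_schwarz_sum.
Qed.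

End segment.

Section increments.
Variable R : realType.
Notation leb := (@leb R).
Notation V := (borel_rV R).

Lemma measurable_add_rV n : measurable_fun [set: (V n * V n)%type]
  ((fun p => p.1 + p.2) : _ -> V n).
Proof.
apply: measurable_to_borel_rV => O oO.
have := @measurable_open_prod R 'rV[R]_n 'rV[R]_n _ _ (V n) (V n)
  id id (@measurable_open_rV R n) (@measurable_open_rV R n) _ _ (@ratmx_ball_dense R n)
  ((fun p : 'rV[R]_n * 'rV[R]_n => p.1 + p.2) @^-1` O).
rewrite /=; apply.
apply: open_comp => // p _; exact: add_continuous.
Qed.

Lemma measurable_segment_rV n (u : 'rV[R]_n) :
  measurable_fun [set: (measurableTypeR R * V n)%type]
  ((fun p => p.2 + p.1 *: u) : _ -> V n).
Proof.
apply: measurable_to_borel_rV => O oO.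
have := @measurable_open_prod R R 'rV[R]_n _ _ (measurableTypeR R) (V n)
  id id (@open_measurable R) (@measurable_open_rV R n) _ _ (@rat_ball_dense R)
  ((fun p : R * 'rV[R]_n => p.2 + p.1 *: u) @^-1` O).
rewrite /=; apply.
apply: open_comp => // p _.
apply: (@cvgD _ _ _ _ _ snd (fun p : R * 'rV[R]_n => p.1 *: u)); first exact: cvg_snd.
by apply: cvgZr_tmp; exact: cvg_fst.
Qed.

Section inc.
Variables (n : nat) (Q : set 'rV[R]_n) (f : 'rV[R]_n -> R).
Hypothesis mQ : measurable (Q : set (V n)).
Hypothesis convQ : forall z u t, Q z -> Q (z + u) -> 0 <= t <= 1 -> Q (z + t *: u).
Hypothesis C1f : C1 f.

Let F (z : V n) : R := \1_Q z * gradsq f z.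

Let mF : measurable_fun setT F.
Proof.
apply: measurable_funM; first exact: measurable_indic.
by apply: measurable_continuous_rV; exact: gradsq_continuous.
Qed.

Let F0 z : 0 <= F z.
Proof. by rewrite /F mulr_ge0// ?gradsq_ge0. Qed.

(** Convexity keeps the segment from [z] to [z + u] inside [Q]. After Tonelli, each [t] contributes
    the same integral by translation invariance. Nash takes [Q] to be the whole space, Poincaré
    takes a cube. *)
Lemma integral_increment_le (u : 'rV[R]_n) :
  (\int[leb n]_z (\1_Q z * \1_Q (z + u) * (f (z + u) - f z) ^+ 2)%:E <=
   (sqnorm u)%:E * \int[leb n]_z (\1_Q z * gradsq f z)%:E)%E.
Proof.
(* The indicators extend the integrand by zero in [t] and in space, so that Tonelli applies on the
   whole product. *)
pose J (p : measurableTypeR R * V n) : \bar R :=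
  (\1_(`[0, 1]%classic) p.1 * F (p.2 + p.1 *: u))%:E.
have mJ : measurable_fun setT J.
  apply/measurable_EFinP; apply: measurable_funM.
    exact: (measurableT_comp (f := \1_(`[0, 1]%classic) : measurableTypeR R -> R)).
  exact: (measurableT_comp mF (measurable_segment_rV u)).
have J0 p : (0 <= J p)%E by rewrite lee_fin mulr_ge0.
have cf := C1_continuous C1f.
have JE z : (\int[lebesgue_measure]_(t in `[0%R, 1%R]) (F (z + t *: u)%R)%:E =
    \int[lebesgue_measure]_t J (t, z))%E.
  rewrite integral_mkcond; apply: eq_integral => t _; rewrite patchE /J/= indicE.
  by case: ifP => _; rewrite ?mul1r ?mul0r.
have mshift (h : V n -> R) v : measurable_fun setT h ->
    measurable_fun setT (fun z : V n => h (z + v)).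
  by move=> mh; exact: (measurableT_comp mh (measurable_shift_rV v)).
have mf : measurable_fun [set: V n] f by exact: measurable_continuous_rV.
have mG : measurable_fun [set: V n] (fun z => (\int[lebesgue_measure]_t J (t, z))%E).
  exact: (@measurable_fun_fubini_tonelli_G _ _ _ _ _ lebesgue_measure J mJ J0).
apply: (@le_trans _ _ (\int[leb n]_z ((sqnorm u)%:E * \int[lebesgue_measure]_t J (t, z)))%E).
  apply: ge0_le_integral => //.
  - by move=> z _; rewrite lee_fin mulr_ge0 ?sqr_ge0 ?mulr_ge0//.
  - apply/measurable_EFinP; apply: measurable_funM.
      by apply: measurable_funM; [exact: measurable_indic|apply: mshift; exact: measurable_indic].
    by apply: measurable_funX; apply: measurable_funB => //; exact: mshift.
  - exact: measurable_funeM.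
  - move=> z _; rewrite !indicE.
    have [/set_mem Qz|_] := boolP (z \in Q); last first.
      by rewrite !mul0r mule_ge0 ?lee_fin ?sqnorm_ge0// integral_ge0.
    have [/set_mem Qzu|_] := boolP (z + u \in Q); last first.
      by rewrite mulr0 mul0r mule_ge0 ?lee_fin ?sqnorm_ge0// integral_ge0.
    rewrite !mul1r; apply: le_trans (sqr_segment_le z u C1f) _.
    rewrite -JE lee_wpmul2l ?lee_fin ?sqnorm_ge0//.
    rewrite le_eqVlt; apply/predU1P; left; apply: eq_integral => t.
    rewrite inE/= in_itv/= => t01; rewrite /F indicE mem_set ?mul1r//.
    exact: convQ.
rewrite ge0_integralZl//; last 2 first.
- by move=> z _; exact: integral_ge0.
- by rewrite lee_fin sqnorm_ge0.
rewrite lee_wpmul2l ?lee_fin ?sqnorm_ge0//.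
have shiftE t : (\int[leb n]_z (F (z + t *: u)%R)%:E = \int[leb n]_z (F z)%:E)%E.
  rewrite (@integral_leb_shift R n (t *: u) (EFin \o F)) //.
  exact/measurable_EFinP.
rewrite -(@fubini_tonelli _ _ _ _ _ lebesgue_measure (leb n) J mJ J0).
rewrite le_eqVlt; apply/predU1P; left.
transitivity (\int[lebesgue_measure]_t ((\1_(`[0%R, 1%R]%classic) t)%:E *
    \int[leb n]_z (F z)%:E))%E.
  apply: eq_integral => t _; rewrite /J/=.
  under eq_integral do rewrite EFinM.
  have mFt : measurable_fun [set: V n] (fun z => (F (z + t *: u)%R)%:E).
    by apply/measurable_EFinP; exact: mshift.
  have Ft0 (z : V n) : setT z -> (0 <= (F (z + t *: u)%R)%:E)%E by rewrite lee_fin.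
  have it0 : (0 <= (\1_(`[0%R, 1%R]%classic) t)%:E :> \bar R)%E by rewrite lee_fin.
  rewrite (@ge0_integralZl _ _ _ (leb n) setT measurableT _ mFt _ Ft0 it0).
  by rewrite shiftE.
rewrite ge0_integralZr//; last 2 first.
- by apply/measurable_EFinP; exact: measurable_indic.
- by apply: integral_ge0 => z _; rewrite lee_fin.
by rewrite integral_indic// setIT /= lebesgue_measure_itv/= lte_fin ltr01 -EFinB subr0 mul1e.
Qed.

End inc.
End increments.

(** * The Nash and local Poincaré inequalities *)

Section real_integral.
Variable R : realType.
Notation leb := (@leb R).
Notation V := (borel_rV R).

Definition meas n (f : 'rV[R]_n -> R) := measurable_fun [set: V n] f.

Definition lebI n (f : 'rV[R]_n -> R) : \bar R := (\int[leb n]_z (f z)%:E)%E.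

Lemma cont_meas n (f : 'rV[R]_n -> R) : continuous f -> meas f.
Proof. exact: measurable_continuous_rV. Qed.

Lemma measD n (f g : 'rV[R]_n -> R) : meas f -> meas g -> meas (fun z => f z + g z).
Proof. exact: measurable_funD. Qed.

Lemma measM n (f g : 'rV[R]_n -> R) : meas f -> meas g -> meas (fun z => f z * g z).
Proof. exact: measurable_funM. Qed.

Lemma meas_cst n (c : R) : meas (fun _ : 'rV[R]_n => c).
Proof. exact: measurable_cst. Qed.

Lemma meas_indic n (Q : set 'rV[R]_n) : measurable (Q : set (V n)) -> meas \1_Q.
Proof. exact: measurable_indic. Qed.

Lemma meas_shift n (f : 'rV[R]_n -> R) a : meas f -> meas (fun z => f (z + a)).
Proof. by move=> mf; exact: (measurableT_comp mf (measurable_shift_rV a)). Qed.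

Section basic.
Variable n : nat.
Implicit Types f g : 'rV[R]_n -> R.

Lemma lebI_ge0 f : (forall z, 0 <= f z) -> (0 <= lebI f)%E.
Proof. by move=> f0; apply: integral_ge0 => z _; rewrite lee_fin. Qed.

Lemma eq_lebI f g : f =1 g -> lebI f = lebI g.
Proof. by move=> fg; apply: eq_integral => z _; rewrite fg. Qed.

Lemma le_lebI f g : meas f -> meas g -> (forall z, 0 <= f z) ->
  (forall z, f z <= g z) -> (lebI f <= lebI g)%E.
Proof.
move=> mf mg f0 fg; apply: ge0_le_integral => //.
- by move=> z _; rewrite lee_fin.
- exact/measurable_EFinP.
- exact/measurable_EFinP.
- by move=> z _; rewrite lee_fin.
Qed.

Lemma lebID f g : meas f -> meas g -> (forall z, 0 <= f z) ->
  (forall z, 0 <= g z) -> lebI (fun z => f z + g z) = (lebI f + lebI g)%E.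
Proof.
move=> mf mg f0 g0; rewrite /lebI.
have mf' : measurable_fun [set: V n] (fun z => (f z)%:E) by exact/measurable_EFinP.
have mg' : measurable_fun [set: V n] (fun z => (g z)%:E) by exact/measurable_EFinP.
have f0' (z : V n) : setT z -> (0 <= (f z)%:E)%E by rewrite lee_fin.
have g0' (z : V n) : setT z -> (0 <= (g z)%:E)%E by rewrite lee_fin.
exact: (@ge0_integralD _ _ _ (leb n) setT measurableT _ _ f0' mf' g0' mg').
Qed.

Lemma lebIZ k f : meas f -> (forall z, 0 <= f z) -> 0 <= k ->
  lebI (fun z => k * f z) = (k%:E * lebI f)%E.
Proof.
move=> mf f0 k0; rewrite /lebI.
have mf' : measurable_fun [set: V n] (fun z => (f z)%:E) by exact/measurable_EFinP.
have f0' (z : V n) : setT z -> (0 <= (f z)%:E)%E by rewrite lee_fin.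
have k0' : (0 <= k%:E)%E by rewrite lee_fin.
exact: (@ge0_integralZl _ _ _ (leb n) setT measurableT _ mf' _ f0' k0').
Qed.

Lemma lebI_shift f a : meas f -> (forall z, 0 <= f z) ->
  lebI (fun z => f (z + a)) = lebI f.
Proof.
move=> mf f0; rewrite /lebI.
by rewrite (@integral_leb_shift R n a (EFin \o f))//; exact/measurable_EFinP.
Qed.

Lemma lebI_cube a : 0 <= a -> lebI (\1_(@cube R n a)) = ((2 * a) ^+ n)%:E.
Proof.
by move=> a0; rewrite -leb_cube// leb_indic//; exact: measurable_cube.
Qed.

Definition meas2 (F : 'rV[R]_n -> 'rV[R]_n -> R) :=
  measurable_fun [set: (V n * V n)%type] (fun p => F p.1 p.2).

Lemma lebI_swap F : meas2 F -> (forall z u, 0 <= F z u) ->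
  (\int[leb n]_z lebI (F z) = \int[leb n]_u lebI (F ^~ u))%E.
Proof.
move=> mF F0; apply: (@fubini_tonelli _ _ _ _ _ (leb n) (leb n) (fun p => (F p.1 p.2)%:E)).
  exact/measurable_EFinP.
by move=> p; rewrite lee_fin.
Qed.

Lemma meas_lebI F : meas2 F -> (forall z u, 0 <= F z u) ->
  measurable_fun [set: V n] (fun z => lebI (F z)).
Proof.
move=> mF F0.
have mF' : measurable_fun [set: (V n * V n)%type] (fun p => (F p.1 p.2)%:E).
  exact/measurable_EFinP.
have F0' (p : V n * V n) : (0 <= (F p.1 p.2)%:E)%E by rewrite lee_fin.
by have := @measurable_fun_fubini_tonelli_F _ _ _ _ _ (leb n) _ mF' F0'.
Qed.

Lemma meas2_sec F z : meas2 F -> meas (F z).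
Proof.
move=> mF; have mp : measurable_fun [set: V n] ((fun u => (z, u)) : V n -> (V n * V n)%type).
  exact: measurable_pair1.
exact: (measurableT_comp mF mp).
Qed.

Lemma meas2_fst f : meas f -> meas2 (fun z _ => f z).
Proof. by move=> mf; exact: (measurableT_comp mf measurable_fst). Qed.

Lemma meas2_snd f : meas f -> meas2 (fun _ u => f u).
Proof. by move=> mf; exact: (measurableT_comp mf measurable_snd). Qed.

Lemma meas2_add f : meas f -> meas2 (fun z u => f (z + u)).
Proof. by move=> mf; exact: (measurableT_comp mf (@measurable_add_rV R n)). Qed.

Lemma meas2M F G : meas2 F -> meas2 G -> meas2 (fun z u => F z u * G z u).
Proof. by move=> mF mG; exact: measurable_funM. Qed.

Lemma meas2B F G : meas2 F -> meas2 G -> meas2 (fun z u => F z u - G z u).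
Proof. by move=> mF mG; exact: measurable_funB. Qed.

Lemma integral_leb_le (F G : 'rV[R]_n -> \bar R) :
  measurable_fun [set: V n] F -> measurable_fun [set: V n] G ->
  (forall z, 0 <= F z)%E -> (forall z, F z <= G z)%E ->
  (\int[leb n]_z F z <= \int[leb n]_z G z)%E.
Proof. by move=> mF mG F0 FG; apply: ge0_le_integral. Qed.

Lemma integral_leb_Zr (f : 'rV[R]_n -> R) (k : \bar R) : meas f -> (forall z, 0 <= f z) ->
  (0 <= k)%E -> (\int[leb n]_z ((f z)%:E * k) = lebI f * k)%E.
Proof.
move=> mf f0 k0; rewrite /lebI.
have mf' : measurable_fun [set: V n] (fun z => (f z)%:E) by exact/measurable_EFinP.
have f0' (z : V n) : setT z -> (0 <= (f z)%:E)%E by rewrite lee_fin.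
exact: (@ge0_integralZr _ _ _ (leb n) setT measurableT _ mf' _ f0' k0).
Qed.

End basic.

Lemma cube_sqnorm n (a : R) (u : 'rV[R]_n) : 0 <= a -> cube a u -> sqnorm u <= n%:R * a ^+ 2.
Proof.
move=> a0 ua; rewrite /sqnorm; apply: (@le_trans _ _ (\sum_(i < n) a ^+ 2)).
  apply: ler_sum => i _; rewrite -real_normK ?num_real// lerXn2r ?nnegrE//.
by rewrite sumr_const card_ord mulr_natl.
Qed.

(** The pointwise bound is averaged over the [u] in the cube of half-side [s]: its volume is [D],
    and [|u|^2 <= n s^2] there. The scale [s] is left free because each layer will use its own. *)
Lemma nash n (f : 'rV[R]_n -> R) (s : R) : 0 < s -> C1 f ->
  (lebI (fun z => f z ^+ 2)%R <= (n%:R * s ^+ 2)%:E * lebI (gradsq f)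
    + (2 / (2 * s) ^+ n)%:E * (lebI (fun z => `|f z|)%R * lebI (fun z => `|f z|)%R))%E.
Proof.
move=> s0 C1f; have s0' := ltW s0.
set D := (2 * s) ^+ n; have D0 : 0 < D by rewrite exprn_gt0// mulr_gt0.
have mf : meas f by apply: cont_meas; exact: C1_continuous.
have mg : meas (gradsq f) by apply: cont_meas; exact: gradsq_continuous.
have mQ : meas \1_(@cube R n s) by apply: meas_indic; exact: measurable_cube.
have mabs : meas (fun z => `|f z|) by exact: (measurableT_comp (@normr_measurable R setT)).
pose A (u z : 'rV[R]_n) := \1_(cube s) u * f z ^+ 2.
pose B (u z : 'rV[R]_n) := \1_(cube s) u * (f (z + u) - f z) ^+ 2.
(* [C] carries no indicator, unlike [A] and [B]: its double integral over all [u] and [z] then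
   factors into the square of the [L^1] norm. *)
pose C (u z : 'rV[R]_n) := `|f z| * `|f (z + u)|.
have mfz : meas2 (fun u z => f (z + u)).
  have E : (fun u z : 'rV[R]_n => f (z + u)) = (fun u z => f (u + z)).
    by apply/funext => u; apply/funext => z; rewrite addrC.
  by rewrite E; exact: meas2_add.
have mB : meas2 B.
  apply: meas2M; first exact: meas2_fst.
  by apply: meas2M; apply: meas2B => //; exact: meas2_snd.
have mC : meas2 C.
  apply: meas2M; first exact: meas2_snd.
  have E : (fun u z : 'rV[R]_n => `|f (z + u)|) = (fun u z => `|f (u + z)|).
    by apply/funext => u; apply/funext => z; rewrite addrC.
  by rewrite E; exact: (@meas2_add _ (fun z => `|f z|)).
have mA : meas2 A.
  by apply: meas2M; [exact: meas2_fst|apply: meas2_snd; exact: measM].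
have A0 u z : 0 <= A u z by rewrite mulr_ge0 ?sqr_ge0.
have B0 u z : 0 <= B u z by rewrite mulr_ge0 ?sqr_ge0.
have C0 u z : 0 <= C u z by rewrite mulr_ge0.
pose N1 := lebI (fun z => `|f z|)%R.
have N10 : (0 <= N1)%E by exact: lebI_ge0.
pose G := lebI (gradsq f).
have G0 : (0 <= G)%E by apply: lebI_ge0; exact: gradsq_ge0.
have AE : (\int[leb n]_u lebI (A u) = D%:E * lebI (fun z => f z ^+ 2)%R)%E.
  rewrite -lebI_cube// -integral_leb_Zr//; last by apply: lebI_ge0 => z; exact: sqr_ge0.
  apply: eq_integral => u _; rewrite /A lebIZ//; first exact: measM.
  by move=> z; exact: sqr_ge0.
have BE : (\int[leb n]_u lebI (B u) <= D%:E * ((n%:R * s ^+ 2)%:E * G))%E.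
  rewrite -lebI_cube// -integral_leb_Zr//; last by rewrite mule_ge0// lee_fin mulr_ge0// sqr_ge0.
  apply: integral_leb_le.
  - exact: meas_lebI.
  - by apply: emeasurable_funM => //; exact/measurable_EFinP.
  - by move=> u; apply: lebI_ge0.
  - move=> u; rewrite /B lebIZ//; last 2 first.
    + by apply: measM; apply: measurable_funB => //; exact: meas_shift.
    + by move=> z; exact: sqr_ge0.
    rewrite indicE; have [/set_mem Qu|_] := boolP (u \in _); last by rewrite !mul0e.
    rewrite !mul1e.
    apply: (@le_trans _ _ ((sqnorm u)%:E * G)%E); last first.
      by rewrite lee_wpmul2r// lee_fin; exact: cube_sqnorm.
    have := @integral_increment_le R n setT f measurableT (fun _ _ _ _ _ _ => I) C1f u.
    rewrite [X in (X <= _)%E -> _](@eq_lebI _ _ (fun z => (f (z + u) - f z) ^+ 2)%R); last first.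
      by move=> z; rewrite !indicT !mul1r.
    rewrite [X in (_ <= _ * X)%E -> _](@eq_lebI _ _ (gradsq f)) => // z.
    by rewrite !indicT !mul1r.
have CE : (\int[leb n]_u lebI (C u) = N1 * N1)%E.
  rewrite lebI_swap// -integral_leb_Zr//; apply: eq_integral => z _.
  rewrite /C lebIZ//; last exact: (meas2_sec z (meas2_add mabs)).
  congr (_ * _)%E; rewrite /N1 -(@lebI_shift _ (fun z => `|f z|) z)//.
  by apply: eq_lebI => u; rewrite addrC.
have : (\int[leb n]_u lebI (A u) <= \int[leb n]_u (lebI (B u) + 2%:E * lebI (C u)))%E.
  apply: integral_leb_le.
  - exact: meas_lebI.
  - by apply: emeasurable_funD; [exact: meas_lebI|apply: measurable_funeM; exact: meas_lebI].
  - by move=> u; apply: lebI_ge0.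
  - move=> u; rewrite -lebIZ//; last exact: meas2_sec.
    rewrite -lebID//; last 3 first.
    + exact: meas2_sec.
    + by apply: measM; [exact: meas_cst|exact: meas2_sec].
    + by move=> z; rewrite mulr_ge0.
    apply: le_lebI => //; first exact: meas2_sec.
      apply: measD; first exact: meas2_sec.
      by apply: measM; [exact: meas_cst|exact: meas2_sec].
    move=> z; rewrite /A /B /C indicE.
    have CC := C0 u z; rewrite /C in CC.
    case: (u \in _); last by rewrite !mul0r add0r mulr_ge0.
    rewrite !mul1r -normrM.
    have := ler_norm (f z * f (z + u)); have := sqr_ge0 (f (z + u)).
    move: (f z) (f (z + u)) => a b h1 h2.
    have : a ^+ 2 <= (b - a) ^+ 2 + 2 * (a * b) by have := sqr_ge0 b; nra.
    by move=> h3; apply: le_trans h3 _; rewrite lerD2l ler_pM2l.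
rewrite AE => AB.
have {}AB : (D%:E * lebI (fun z => (f z ^+ 2)%R) <=
    D%:E * ((n%:R * s ^+ 2)%:E * G) + 2%:E * (N1 * N1))%E.
  apply: le_trans AB _; rewrite ge0_integralD//; last 4 first.
  - by move=> u _; apply: lebI_ge0.
  - exact: meas_lebI.
  - by move=> u _; rewrite mule_ge0// lebI_ge0.
  - by apply: measurable_funeM; exact: meas_lebI.
  rewrite ge0_integralZl//; last 2 first.
  - exact: meas_lebI.
  - by move=> u _; exact: lebI_ge0.
  by rewrite CE leeD2r.
have Di : (0 <= D^-1%:E)%E by rewrite lee_fin invr_ge0 ltW.
have := lee_wpmul2l Di AB.
rewrite muleA -EFinM mulVf ?gt_eqF// mul1e => /le_trans; apply.
rewrite ge0_muleDr; last 2 first.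
- by rewrite !mule_ge0// lee_fin ?mulr_ge0 ?sqr_ge0// ltW.
- by rewrite mule_ge0// mule_ge0.
rewrite !(muleA D^-1%:E) -!EFinM mulVf ?gt_eqF// mul1e.
by rewrite [D^-1 * 2]mulrC.
Qed.

End real_integral.

Section poincare.
Variable R : realType.
Notation leb := (@leb R).
Notation V := (borel_rV R).

(** Otherwise [G - M] would be positive on [Q] with zero integral, hence zero almost everywhere on a
    set of positive measure. *)
Lemma exists_le_average (d : measure_display) (T : measurableType d)
    (mu : {measure set T -> \bar R}) (Q : set T) (G : T -> \bar R) (M : R) :
  measurable Q -> (0 < mu Q < +oo)%E -> 0 <= M ->
  measurable_fun setT G -> (forall x, 0 <= G x)%E ->
  (\int[mu]_(x in Q) G x <= M%:E * mu Q)%E ->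
  exists2 x, Q x & (G x <= M%:E)%E.
Proof.
move=> mQ /andP[Q0 Qoo] M0 mG G0 GM; apply/not_exists2P => GQ.
have {}GQ x : Q x -> (M%:E < G x)%E.
  by move=> Qx; have [//|/negP] := GQ x; rewrite -ltNge.
pose G' x := (G x - M%:E)%E.
have mG' : measurable_fun Q G'.
  by apply: emeasurable_funB; [exact: measurable_funTS|exact: measurable_cst].
have G'0 x : Q x -> (0 <= G' x)%E by move=> /GQ/ltW; rewrite sube_ge0.
have GE : (\int[mu]_(x in Q) G x = \int[mu]_(x in Q) G' x + M%:E * mu Q)%E.
  rewrite -integral_cst// -ge0_integralD//.
  by apply: eq_integral => x _; rewrite /G' subeK.
have Mfin : (M%:E * mu Q)%E \is a fin_num.
  by rewrite fin_numM// ge0_fin_numE.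
move: GM; rewrite GE => GM.
have G'int : (\int[mu]_(x in Q) G' x <= 0)%E.
  by move: GM; rewrite -leeBrDr// subee.
have {}G'int : (\int[mu]_(x in Q) `|G' x| = 0)%E.
  apply/eqP; rewrite eq_le; apply/andP; split; last exact: integral_ge0.
  apply: le_trans G'int; rewrite le_eqVlt; apply/predU1P; left.
  by apply: eq_integral => x /set_mem Qx; rewrite gee0_abs// G'0.
have /(ae_eq_integral_abs mu mQ mG') [N [mN N0 QN]] := G'int.
move: Q0; rewrite ltNge => /negP; apply.
rewrite -N0; apply: le_measure; rewrite ?inE//.
move=> x Qx; apply: QN => /= /(_ Qx) /eqP; rewrite /G'.
by rewrite gt_eqF// sube_gt0 GQ.
Qed.

Lemma cube_convex n (a : R) (z u : 'rV[R]_n) (t : R) :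
  cube a z -> cube a (z + u) -> 0 <= t <= 1 -> cube a (z + t *: u).
Proof.
move=> za zua /andP[t0 t1] i; have := za i; have := zua i; rewrite !mxE !ler_norml.
by move: (z 0 i) (u 0 i) => x y /andP[h1 h2] /andP[h3 h4]; apply/andP; split; nra.
Qed.

Lemma meas2_swap n (F : 'rV[R]_n -> 'rV[R]_n -> R) :
  meas2 F -> meas2 (fun u z => F z u).
Proof.
move=> mF; have ms : measurable_fun [set: (V n * V n)%type]
    ((fun p => (p.2, p.1)) : _ -> (V n * V n)%type) by exact: measurable_swap.
exact: (measurableT_comp mF ms).
Qed.

(** The constant is a value [f z']: the average over [z'] in the cube of the integral of
    [(f - f z')^2] is controlled, so some [z'] does at least as well. The factor [2^n] is the volume
    ratio of the cube of differences to the cube itself; the [+ 1] keeps the constant positive when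
    [n = 0], as the case of infinite energy requires. *)
Lemma poincare_cube n (a : R) (f : 'rV[R]_n -> R) : 0 < a -> C1 f ->
  exists c, (lebI (fun z => \1_(cube a) z * (f z - c) ^+ 2)%R <=
    (2 ^+ n * (n%:R * (2 * a) ^+ 2) + 1)%:E *
      lebI (fun z => \1_(cube a) z * gradsq f z)%R)%E.
Proof.
move=> a0 C1f; set Q := @cube R n a.
have mf : meas f by apply: cont_meas; exact: C1_continuous.
have mg : meas (gradsq f) by apply: cont_meas; exact: gradsq_continuous.
have mQ : meas \1_Q by apply: meas_indic; exact: measurable_cube.
have mQg : meas (fun z => \1_Q z * gradsq f z) by exact: measM.
set E := lebI (fun z => \1_Q z * gradsq f z)%R.
have E0 : (0 <= E)%E by apply: lebI_ge0 => z; rewrite mulr_ge0 ?gradsq_ge0.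
set K := 2 ^+ n * (n%:R * (2 * a) ^+ 2).
have K0 : 0 <= K by rewrite /K mulr_ge0 ?exprn_ge0// mulr_ge0 ?sqr_ge0.
have [Eoo|Efin] := eqVneq E +oo%E.
  exists 0; rewrite Eoo gt0_muley ?leey// lte_fin; lra.
have {}Efin : E \is a fin_num by rewrite ge0_fin_numE// ltey.
pose S (z' z : 'rV[R]_n) := \1_Q z * (f z - f z') ^+ 2.
have mS : meas2 S.
  apply: meas2M; first exact: meas2_snd.
  by apply: meas2M; apply: meas2B; (exact: meas2_snd || exact: meas2_fst).
have S0 z' z : 0 <= S z' z by rewrite mulr_ge0 ?sqr_ge0.
pose S' (z u : 'rV[R]_n) := \1_Q z * \1_Q (z + u) * (f (z + u) - f z) ^+ 2.
have mS' : meas2 S'.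
  apply: meas2M; first by apply: meas2M; [exact: meas2_fst|exact: meas2_add].
  by apply: meas2M; apply: meas2B; (exact: meas2_add || exact: meas2_fst).
have S'0 z' z : 0 <= S' z' z by rewrite mulr_ge0 ?sqr_ge0 ?mulr_ge0.
have T1 : (\int[leb n]_(z' in Q) lebI (S z') = \int[leb n]_z' lebI (S' z'))%E.
  rewrite integral_mkcond; apply: eq_integral => z' _; rewrite patchE.
  transitivity ((\1_Q z')%:E * lebI (S z'))%E.
    by rewrite indicE; case: ifP => _; rewrite ?mul1e ?mul0e.
  rewrite -lebIZ//; last exact: meas2_sec.
  rewrite -(@lebI_shift _ _ _ z'); last 2 first.
  - by apply: measM; [exact: meas_cst|exact: meas2_sec].
  - by move=> z; rewrite mulr_ge0.
  by apply: eq_lebI => u; rewrite /S /S' mulrA (addrC u).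
have T2 : (\int[leb n]_z' lebI (S' z') <= ((4 * a) ^+ n * (n%:R * (2 * a) ^+ 2))%:E * E)%E.
  rewrite lebI_swap//.
  have -> : 4 * a = 2 * (2 * a) by ring.
  have a20 : 0 <= 2 * a by lra.
  rewrite EFinM -muleA -(@lebI_cube R n (2 * a))// -integral_leb_Zr//; last 2 first.
  - by apply: meas_indic; exact: measurable_cube.
  - by rewrite mule_ge0// lee_fin mulr_ge0 ?sqr_ge0.
  apply: integral_leb_le.
  - by apply: (@meas_lebI _ _ (fun u z => S' z u)) => //; exact: meas2_swap.
  - apply: emeasurable_funM => //; apply/measurable_EFinP.
    by apply: measurable_indic; exact: measurable_cube.
  - by move=> u; apply: lebI_ge0.
  - move=> u; have [Qu|Qu] := pselect (cube (2 * a) u); last first.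
      (* Two points of [Q] differ by a vector of the cube of half-side [2 a], so no other [u]
         contributes. *)
      rewrite (_ : lebI _ = 0%E); first by rewrite mule_ge0// mule_ge0// lee_fin mulr_ge0 ?sqr_ge0.
      rewrite -[RHS](@integral0 _ _ _ (leb n) setT); apply: eq_integral => z _.
      rewrite /S' !indicE.
      have [/set_mem Qz|_] := boolP (z \in Q); last by rewrite !mul0r.
      have [/set_mem Qzu|_] := boolP (z + u \in Q); last by rewrite mulr0 mul0r.
      exfalso; apply: Qu => i; have := Qz i; have := Qzu i; rewrite mxE !ler_norml.
      by move: (z 0 i) (u 0 i) => x y /andP[h1 h2] /andP[h3 h4]; apply/andP; split; lra.
    rewrite indicE mem_set// mul1e.
    apply: (@le_trans _ _ ((sqnorm u)%:E * E)%E); last first.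
      by rewrite lee_wpmul2r// lee_fin; exact: cube_sqnorm.
    apply: integral_increment_le => //; first exact: measurable_cube.
    exact: cube_convex.
have QE : leb n Q = ((2 * a) ^+ n)%:E by rewrite leb_cube// ltW.
have [z' Qz' Sz'] : exists2 z', Q z' & (lebI (S z') <= (K * fine E)%:E)%E.
  apply: (@exists_le_average _ (V n) (leb n) Q).
  - exact: measurable_cube.
  - have H : (0 < leb n Q < +oo)%E by rewrite QE ltry andbT lte_fin exprn_gt0//; lra.
    exact: H.
  - by rewrite mulr_ge0// fine_ge0.
  - exact: meas_lebI.
  - by move=> z; apply: lebI_ge0.
  - rewrite T1; apply: le_trans T2 _.
    suff H : (((4 * a) ^+ n * (n%:R * (2 * a) ^+ 2))%:E * E <= (K * fine E)%:E * leb n Q)%E.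
      exact: H.
    rewrite QE -{1}(fineK Efin) -!EFinM lee_fin.
    rewrite /K (_ : 4 * a = 2 * (2 * a)); last by ring.
    by rewrite [(2 * (2 * a)) ^+ n]exprMn le_eqVlt; apply/predU1P; left; ring.
exists (f z'); apply: le_trans Sz' _.
rewrite EFinM fineK// lee_wpmul2r// lee_fin; lra.
Qed.

End poincare.

(** * Calculus of C1 functions *)

Section C1_calculus.
Variable R : realType.

Lemma smooth_C1 n (f : 'rV[R]_n -> R) : smooth f -> C1 f.
Proof.
move=> sf; split => [z|i z]; first exact: (sf [::]).
exact/differentiable_continuous/(sf [:: i]).
Qed.

Lemma smooth_partial n (f : 'rV[R]_n -> R) i : smooth f -> smooth (partial i f).
Proof.
move=> sf s z; have := sf (rcons s i) z.
suff -> : iter_partial (rcons s i) f = iter_partial s (partial i f) by [].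
by elim: s {sf} => //= j s ->.
Qed.

Section ops.
Variable n : nat.
Implicit Types f g : 'rV[R]_n -> R.

Lemma C1_derivable f z v : C1 f -> derivable f z v.
Proof. by move=> [df _]; exact: diff_derivable. Qed.

Lemma partial_cst (c : R) i (z : 'rV[R]_n) : partial i (fun=> c) z = 0.
Proof. exact: derive_cst. Qed.

Lemma C1_cst (c : R) : C1 (fun _ : 'rV[R]_n => c).
Proof.
split => [z|i]; first exact: differentiable_cst.
by rewrite (_ : partial i _ = cst 0);
  [move=> z; exact: cst_continuous|apply/funext => z; exact: partial_cst].
Qed.

Lemma partialD f g i z : C1 f -> C1 g ->
  partial i (fun z => f z + g z) z = partial i f z + partial i g z.
Proof. by move=> Cf Cg; apply: deriveD; exact: C1_derivable. Qed.

Lemma C1D f g : C1 f -> C1 g -> C1 (fun z => f z + g z).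
Proof.
move=> Cf Cg; split => [z|i].
  by apply: differentiableD; [have [] := Cf|have [] := Cg].
rewrite (_ : partial i _ = (fun z => partial i f z + partial i g z)).
  by move=> z; exact: (cvgD (Cf.2 i z) (Cg.2 i z)).
by apply/funext => z; exact: partialD.
Qed.

Lemma partialM f g i z : C1 f -> C1 g ->
  partial i (fun z => f z * g z) z = f z * partial i g z + g z * partial i f z.
Proof. by move=> Cf Cg; apply: deriveM; exact: C1_derivable. Qed.

Lemma C1M f g : C1 f -> C1 g -> C1 (fun z => f z * g z).
Proof.
move=> Cf Cg; have cf := C1_continuous Cf; have cg := C1_continuous Cg.
split => [z|i].
  by apply: differentiableM; [have [] := Cf|have [] := Cg].
rewrite (_ : partial i _ = (fun z => f z * partial i g z + g z * partial i f z)).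
  by move=> z; exact: (cvgD (cvgM (cf z) (Cg.2 i z)) (cvgM (cg z) (Cf.2 i z))).
by apply/funext => z; exact: partialM.
Qed.

Lemma partial_comp (phi : R -> R) (dphi : R) f i z :
  is_derive (f z) 1 phi dphi -> differentiable f z ->
  partial i (fun z => phi (f z)) z = dphi * partial i f z.
Proof.
move=> dp df; have dphiz : differentiable phi (f z) by apply/derivable1_diffP; have [] := dp.
rewrite /partial deriveE; last exact: differentiable_comp.
rewrite (@diff_comp _ _ _ _ f phi)//= deriv1E; last by have [] := dp.
by rewrite deriveE//= derive1E; have [_ ->] := dp; rewrite /GRing.scale/= mulrC.
Qed.

Lemma C1_comp (phi dphi : R -> R) f :
  (forall z, is_derive (f z) 1 phi (dphi (f z))) ->
  (forall z, {for f z, continuous dphi}) -> C1 f ->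
  C1 (fun z => phi (f z)).
Proof.
move=> dp cp Cf; have cf := C1_continuous Cf; have [df cpf] := Cf; split => [z|i].
  apply: (@differentiable_comp _ _ _ _ f phi) => //.
  by apply/derivable1_diffP; have [] := dp z.
rewrite (_ : partial i _ = (fun z => dphi (f z) * partial i f z)).
  move=> z; have cc : {for z, continuous (fun z => dphi (f z))}.
    exact: (@continuous_comp _ _ _ f dphi z (cf z) (cp z)).
  exact: (cvgM cc (cpf i z)).
by apply/funext => z; exact: partial_comp.
Qed.

End ops.

(** Squaring makes the positive part C1, with derivative [2 max(t, 0)], which is all that the
    cutoffs need. *)
Definition sqpos (t : R) : R := Num.max t 0 ^+ 2.

Lemma sqpos_expansion (t h : R) :
  `|sqpos (h + t) - sqpos t - 2 * Num.max t 0 * h| <= h ^+ 2.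
Proof.
rewrite /sqpos ler_norml; apply/andP.
by case: (leP t 0) => t0; case: (leP (h + t) 0) => th; split; nra.
Qed.

Lemma is_derive_sqpos (t : R) : is_derive t 1 sqpos (2 * Num.max t 0).
Proof.
have E (h : R) : h != 0 ->
    `|2 * Num.max t 0 - h^-1 *: (sqpos (h *: 1 + t) - sqpos t)| <= `|h|.
  move=> h0; have -> : h *: (1 : R) = h by rewrite /GRing.scale/= mulr1.
  rewrite /GRing.scale/=.
  have -> : 2 * Num.max t 0 - h^-1 * (sqpos (h + t) - sqpos t) =
      - (h^-1 * (sqpos (h + t) - sqpos t - 2 * Num.max t 0 * h)).
    by rewrite !mulrBr (mulrC _ h) mulKf//; ring.
  rewrite normrN normrM normfV ler_pdivrMl ?normr_gt0//.
  apply: le_trans (sqpos_expansion t h) _.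
  by rewrite -[X in X <= _]ger0_norm ?sqr_ge0// normrX expr2.
have C : h^-1 *: (sqpos (h *: 1 + t) - sqpos t) @[h --> (0:R)^'] --> 2 * Num.max t 0.
  apply/cvgrPdist_lt => e e0; near=> h.
  have h0 : h != 0 by near: h; exact: nbhs_dnbhs_neq.
  apply: le_lt_trans (E h h0) _; near: h.
  apply: nbhs_dnbhs; apply: filterS (nbhsx_ballx (0 : R) e e0) => h.
  by rewrite /ball/= sub0r normrN.
split; first by apply/cvg_ex; exists (2 * Num.max t 0).
exact: cvg_lim C.
Unshelve. all: by end_near.
Qed.

Lemma continuous_maxr0 : continuous (fun t : R => Num.max t 0).
Proof.
move=> t; apply/cvgrPdist_lt => e e0; near=> s.
apply: (@le_lt_trans _ _ `|t - s|); last by near: s; exact: cvgr_dist_lt.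
rewrite ler_norml; have := ler_norm (t - s); have := lerNnormlW (lexx `|t - s|).
by case: (leP t 0) => t0; case: (leP s 0) => s0 h1 h2; apply/andP; split; lra.
Unshelve. all: by end_near.
Qed.

Lemma C1_sqpos n (f : 'rV[R]_n -> R) : C1 f -> C1 (fun z => sqpos (f z)).
Proof.
apply: (@C1_comp _ _ (fun t => 2 * Num.max t 0)) => z.
  exact: is_derive_sqpos.
by apply: cvgM; [exact: cvg_cst|exact: continuous_maxr0].
Qed.

Lemma partial_sqpos n (f : 'rV[R]_n -> R) i z : C1 f ->
  partial i (fun z => sqpos (f z)) z = 2 * Num.max (f z) 0 * partial i f z.
Proof.
move=> [df _]; apply: partial_comp => //; exact: is_derive_sqpos.
Qed.

End C1_calculus.

(** * Integration by parts for compactly supported functions *)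

Section integration_by_parts.
Variable R : realType.
Notation leb := (@leb R).
Notation V := (borel_rV R).

Lemma compact_cube n (a : R) : compact (@cube R n a).
Proof.
rewrite (_ : cube a = [set v : 'rV[R]_n | forall i, `[- a, a]%classic (v ord0 i)]).
  by apply: (@rV_compact _ _ (fun=> `[- a, a]%classic)) => _; exact: segment_compact.
by apply/seteqP; split => z za i; have := za i; rewrite /= in_itv/= ler_norml.
Qed.

Lemma continuous_cube_bounded n (f : 'rV[R]_n -> R) (a : R) : continuous f ->
  exists M : R, 0 <= M /\ forall z, cube a z -> `|f z| <= M.
Proof.
move=> cf; have [->|Q0] := eqVneq (@cube R n a) set0; first by exists 0.
have [c cQ cmax] : exists2 c, c \in @cube R n a & forall t, t \in @cube R n a -> `|f t| <= `|f c|.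
  apply: (@EVT_max_rV R n (fun z => `|f z|)).
  - exact/set0P.
  - exact: compact_cube.
  - apply: continuous_subspaceT => z.
    by apply: (@continuous_comp _ _ _ f (@Num.norm R R)); [exact: cf|exact: norm_continuous].
by exists `|f c|; split => // z Qz; apply: cmax; rewrite inE.
Qed.

Lemma integrable_cube_indic n (a M : R) : 0 <= a ->
  (leb n).-integrable setT (fun z => (M * \1_(@cube R n a) z)%:E).
Proof.
move=> a0; under eq_fun do rewrite EFinM.
apply: integrableZl => //; apply/integrableP; split.
  by apply/measurable_EFinP; apply: measurable_indic; exact: measurable_cube.
rewrite (_ : integral _ _ _ = lebI (\1_(@cube R n a))).
  by rewrite lebI_cube// ltry.
by apply: eq_integral => z _; rewrite gee0_abs// lee_fin.
Qed.

Lemma integrable_cube_support n (f : 'rV[R]_n -> R) (a : R) : 0 <= a -> continuous f ->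
  (forall z, ~ cube a z -> f z = 0) -> (leb n).-integrable setT (fun z => (f z)%:E).
Proof.
move=> a0 cf f0; have [M [M0 fM]] := continuous_cube_bounded a cf.
apply: (@le_integrable _ _ _ _ setT measurableT _ _ _ _ (integrable_cube_indic n M a0)).
  by apply/measurable_EFinP; exact: measurable_continuous_rV.
move=> z _; rewrite !abse_EFin lee_fin [leRHS]ger0_norm ?mulr_ge0// indicE.
have [/set_mem Qz|/negP Qz] := boolP (z \in _); first by rewrite mulr1; exact: fM.
by rewrite f0 ?normr0 ?mulr0// => ?; apply: Qz; rewrite inE.
Qed.

Lemma integral_leb_shift_sign n (f : 'rV[R]_n -> R) a : continuous f ->
  (\int[leb n]_z (f (z + a)%R)%:E = \int[leb n]_z (f z)%:E)%E.
Proof.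
move=> cf; have mf : measurable_fun [set: V n] (fun z => (f z)%:E).
  by apply/measurable_EFinP; exact: measurable_continuous_rV.
rewrite integralE [RHS]integralE; congr (_ - _)%E.
  have E := @integral_leb_shift R n a (fun z => (f z)%:E)^\+%E
    (measurable_funepos mf) (fun z => funepos_ge0 _ z).
  by apply: etrans E; apply: eq_integral => z _; rewrite !funeposE.
have E := @integral_leb_shift R n a (fun z => (f z)%:E)^\-%E
  (measurable_funeneg mf) (fun z => funeneg_ge0 _ z).
by apply: etrans E; apply: eq_integral => z _; rewrite !funenegE.
Qed.

Lemma cubeD n (a b : R) (z u : 'rV[R]_n) : cube a z -> cube b u -> cube (a + b) (z + u).
Proof.
by move=> za ub i; rewrite mxE (le_trans (ler_normD _ _))// lerD.
Qed.

Lemma cube_basis n (h : R) i : 0 <= h -> @cube R n h (h *: basis_vec R i).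
Proof.
move=> h0 j; rewrite !mxE; case: (_ && _); last by rewrite mulr0 normr0.
by rewrite mulr1 ger0_norm.
Qed.

Lemma continuous_comp_shift n (f : 'rV[R]_n -> R) (v : 'rV[R]_n) :
  continuous f -> continuous (fun z : 'rV[R]_n => f (z + v)).
Proof.
move=> cf z; have cs : {for z, continuous (fun z : 'rV[R]_n => z + v)}.
  by apply: (@continuousD _ _ _ id (cst v)); [exact: cvg_id|exact: cst_continuous].
exact: (@continuous_comp _ _ _ _ f z cs (cf _)).
Qed.

(** Translation invariance gives every difference quotient of [f] a zero integral; dominated
    convergence passes this to the partial derivative. *)
Lemma integral_partial n (f : 'rV[R]_n -> R) (a : R) i : 0 <= a -> C1 f ->
  (forall z, ~ cube a z -> f z = 0) ->
  (leb n).-integrable setT (fun z => (partial i f z)%:E) /\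
  (\int[leb n]_z (partial i f z)%:E = 0)%E.
Proof.
move=> a0 C1f f0; have cf := C1_continuous C1f; have cdf := C1f.2 i.
pose h k : R := k.+1%:R^-1.
have h0 k : 0 < h k by rewrite invr_gt0.
have h1 k : h k <= 1 by rewrite invf_le1// ler1n.
pose e : 'rV[R]_n := basis_vec R i.
pose q k (z : 'rV[R]_n) := (h k)^-1 * (f (z + h k *: e) - f z).
(* Steps are at most [1], so the quotients live on the cube of half-side [a + 1], and the points
   given by the mean value theorem on that of half-side [a + 1 + 1]. *)
have [M [M0 dM]] := continuous_cube_bounded (a + 1 + 1) cdf.
have cq k : continuous (q k).
  have cs := @continuous_comp_shift n f (h k *: e) cf.
  by move=> z; exact: (cvgM (cvg_cst _) (cvgB (cs z) (cf z))).
have iq k : (\int[leb n]_z (q k z)%:E = 0)%E.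
  have if0 : (leb n).-integrable setT (fun z => (f z)%:E).
    exact: integrable_cube_support f0.
  have cfs := @continuous_comp_shift n f (h k *: e) cf.
  have ifs : (leb n).-integrable setT (fun z => (f (z + h k *: e))%:E).
    apply: (@integrable_cube_support n _ (a + h k)) => //; first by rewrite addr_ge0// ltW.
    move=> z Qz; apply: f0 => Qz'; apply: Qz.
    rewrite -[z](addrK (h k *: e)); apply: cubeD => // j.
    by rewrite mxE normrN; apply: cube_basis; exact: ltW.
  under eq_integral do rewrite /q EFinM EFinB.
  rewrite integralZl//; last exact: integrableB.
  rewrite integralB//.
  rewrite integral_leb_shift_sign// subee ?mule0//.
  exact: integrable_fin_num.
have absq k z : `|q k z| <= M * \1_(cube (a + 1)) z.
  rewrite indicE; have [/set_mem Qz|/negP Qz] := boolP (z \in _); last first.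
    have Qz' : ~ cube (a + 1) z by move=> Qz'; apply: Qz; rewrite inE.
    rewrite /q !f0 ?subrr ?mulr0 ?normr0//.
    - move=> za; apply: Qz' => j; apply: le_trans (za j) _; lra.
    - move=> za; apply: Qz'; rewrite -[z](addrK (h k *: e)); apply: cubeD => // j.
      rewrite mxE normrN; apply: le_trans (h1 k).
      by apply: cube_basis; exact: ltW.
  rewrite mulr1 /q.
  have [c c01] : exists2 c, c \in `[0, h k] &
      f (z + h k *: e) - f (z + 0 *: e) = partial i f (z + c *: e) * (h k - 0).
    apply: (@MVT_segment R (fun s => f (z + s *: e)) (fun s => partial i f (z + s *: e))) => //.
    - exact: ltW.
    - by move=> s _; apply: is_derive_segment; exact: C1f.1.
    - apply: continuous_subspaceT => s.
      apply: (@continuous_comp _ _ _ (fun s : R => z + s *: e) f).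
        exact: continuous_segment.
      exact: cf.
  rewrite scale0r addr0 subr0 => ->; rewrite mulrC mulfK ?gt_eqF//.
  apply: dM; apply: cubeD => // j; move: c01; rewrite in_itv/= => /andP[c0 ch].
  by apply: le_trans (le_trans ch (h1 k)); exact: cube_basis.
have qcvg z : q ^~ z @ \oo --> partial i f z.
  have df : derivable f z e by exact: C1_derivable.
  have : h^-1 *: ((f \o shift z) (h *: e) - f z) @[h --> (0:R)^'] --> partial i f z by exact: df.
  move=> /cvgr_dnbhsP/(_ h) qh.
  have -> : q ^~ z = (fun k => (h k)^-1 *: ((f \o shift z) (h k *: e) - f z)).
    by apply/funext => k; rewrite /q /= [z + _]addrC.
  apply: qh; split; first by move=> k; rewrite gt_eqF.
  exact: cvg_harmonic.
have [id _ ic] := @dominated_convergence _ (V n) R (leb n) setT measurableT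
  (fun k z => (q k z)%:E) (fun z => (partial i f z)%:E)
  (fun z => (M * \1_(cube (a + 1)) z)%:E)
  (fun k => ltac:(by apply/measurable_EFinP; exact: measurable_continuous_rV))
  ltac:(by apply/measurable_EFinP; exact: measurable_continuous_rV)
  ltac:(by apply: aeW => z _; apply: cvg_EFin => //; [exact: nearW|exact: qcvg])
  (@integrable_cube_indic n (a + 1) M ltac:(by rewrite addr_ge0))
  ltac:(by apply: aeW => z k _; rewrite abse_EFin lee_fin).
split => //; apply/esym.
move: ic; under eq_fun do rewrite iq.
by move/(cvg_lim (@ereal_hausdorff R)) => <-; rewrite lim_cst.
Qed.

End integration_by_parts.

(** * Smoothness of the Hamiltonian *)

Section smooth_functions.
Variable R : realType.

Lemma partial_cst_fun n (c : R) (i : 'I_n) : partial i (fun _ => c) = (fun _ => 0).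
Proof. by apply/funext => z; exact: partial_cst. Qed.

Lemma smooth_cst n (c : R) : smooth (fun _ : 'rV[R]_n => c).
Proof.
have E s : exists c', iter_partial s (fun _ : 'rV[R]_n => c) = (fun _ => c').
  elim: s => [|i s [c' IH]]; first by exists c.
  by exists 0; rewrite /= IH partial_cst_fun.
by move=> s z; have [c' ->] := E s; exact: differentiable_cst.
Qed.

(** The last index of the list is the first derivative taken, hence the decomposition by [rcons]. *)
Lemma smoothP n (f : 'rV[R]_n -> R) : (forall z, differentiable f z) ->
  (forall i, smooth (partial i f)) -> smooth f.
Proof.
move=> df sf s; have [->|[s' [i ->]]] : s = [::] \/ exists s' i, s = rcons s' i.
- by case/lastP: s => [|s' i]; [left|right; exists s', i].
- exact: df.
- move=> z; have := sf i s' z.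
  suff -> : iter_partial (rcons s' i) f = iter_partial s' (partial i f) by [].
  by elim: s' => //= j s'' ->.
Qed.

Lemma smoothD n (f g : 'rV[R]_n -> R) : smooth f -> smooth g ->
  smooth (fun z => f z + g z).
Proof.
move=> sf sg.
have E s : iter_partial s (fun z => f z + g z) =
    (fun z => iter_partial s f z + iter_partial s g z).
  elim: s => //= i s ->; apply/funext => z; apply: deriveD; exact: diff_derivable.
by move=> s z; rewrite E; exact: differentiableD.
Qed.

Lemma partial_comp_lin m n (g : {linear 'rV[R]_m -> 'rV[R]_n}) (u : 'rV[R]_n -> R) i z :
  partial i (fun z => u (g z)) z = 'D_(g (basis_vec R i)) u (g z).
Proof.
rewrite /partial /derive.
have -> // : (fun h : R => h^-1 *: (((fun z => u (g z)) \o shift z) (h *: basis_vec R i)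
      - u (g z))) =
    (fun h : R => h^-1 *: ((u \o shift (g z)) (h *: g (basis_vec R i)) - u (g z))).
by apply/funext => h /=; rewrite [g (_ + _)]linearD [g (_ *: _)]linearZ.
Qed.

(** Functions of the form [v (lsubmx z)] with [v] smooth are stable under partial derivatives: an
    x-derivative falls on [v], a y-derivative gives zero. *)
Lemma smooth_lsubmx (d1 d2 : nat) (u : 'rV[R]_d1 -> R) : smooth u ->
  smooth (fun z : 'rV[R]_(d1 + d2) => u (lsubmx z)).
Proof.
move=> su s.
suff [v sv ->] : exists2 v : 'rV[R]_d1 -> R, smooth v &
    iter_partial s (fun z : 'rV[R]_(d1 + d2) => u (lsubmx z)) = (fun z => v (lsubmx z)).
  move=> z; apply: (@differentiable_comp _ _ _ _ _ v); first exact: differentiable_lsubmx.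
  exact: (sv [::]).
elim: s => [|i s [v sv /= ->]]; first by exists u.
have E z : partial i (fun z : 'rV[R]_(d1 + d2) => v (lsubmx z)) z =
    'D_(lsubmx (basis_vec R i)) v (lsubmx z) by exact: partial_comp_lin.
case: (split_ordP i) E => j -> E.
  exists (partial j v); first exact: smooth_partial.
  apply/funext => z; rewrite E /partial; congr ('D_ _ _ _).
  by apply/rowP => k; rewrite !mxE/= eq_lshift.
exists (fun=> 0); first exact: smooth_cst.
have L0 : lsubmx (basis_vec R (rshift d1 j)) = 0 :> 'rV[R]_d1.
  by apply/rowP => k; rewrite !mxE/= eq_lrshift.
by apply/funext => z; rewrite E L0 derive0.
Qed.

Lemma smooth_rsubmx (d1 d2 : nat) (u : 'rV[R]_d2 -> R) : smooth u ->
  smooth (fun z : 'rV[R]_(d1 + d2) => u (rsubmx z)).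
Proof.
move=> su s.
suff [v sv ->] : exists2 v : 'rV[R]_d2 -> R, smooth v &
    iter_partial s (fun z : 'rV[R]_(d1 + d2) => u (rsubmx z)) = (fun z => v (rsubmx z)).
  move=> z; apply: (@differentiable_comp _ _ _ _ _ v); first exact: differentiable_rsubmx.
  exact: (sv [::]).
elim: s => [|i s [v sv /= ->]]; first by exists u.
have E z : partial i (fun z : 'rV[R]_(d1 + d2) => v (rsubmx z)) z =
    'D_(rsubmx (basis_vec R i)) v (rsubmx z) by exact: partial_comp_lin.
case: (split_ordP i) E => j -> E.
  exists (fun=> 0); first exact: smooth_cst.
  have L0 : rsubmx (basis_vec R (lshift d2 j)) = 0 :> 'rV[R]_d2.
    by apply/rowP => k; rewrite !mxE/= eq_rlshift.
  by apply/funext => z; rewrite E L0 derive0.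
exists (partial j v); first exact: smooth_partial.
apply/funext => z; rewrite E /partial; congr ('D_ _ _ _).
by apply/rowP => k; rewrite !mxE/= eq_rshift.
Qed.

Lemma coord_differentiable n (j : 'I_n) (z : 'rV[R]_n) :
  differentiable (fun z : 'rV[R]_n => z 0 j) z.
Proof. exact: differentiable_coord. Qed.

Lemma partial_coord n (i j : 'I_n) (z : 'rV[R]_n) :
  partial i (fun z : 'rV[R]_n => z 0 j) z = (j == i)%:R.
Proof.
rewrite /partial /derive.
have E : (h^-1 *: (((fun z : 'rV[R]_n => z 0 j) \o shift z) (h *: basis_vec R i) - z 0 j)
    @[h --> (0 : R)^']) --> ((j == i)%:R : R).
  apply: cvg_near_cst; near=> h.
  have h0 : h != 0 by near: h; exact: nbhs_dnbhs_neq.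
  by rewrite /= !mxE addrK /= /GRing.scale/= mulKf.
exact: cvg_lim E.
Unshelve. all: by end_near.
Qed.

Lemma C1_coord n (j : 'I_n) : C1 (fun z : 'rV[R]_n => z 0 j).
Proof.
split => [z|i]; first exact: coord_differentiable.
rewrite (_ : partial i _ = fun=> (j == i)%:R); first by move=> z; exact: cst_continuous.
by apply/funext => z; exact: partial_coord.
Qed.

Lemma C1_sum n m (F : 'I_m -> 'rV[R]_n -> R) : (forall j, C1 (F j)) ->
  C1 (fun z => \sum_j F j z).
Proof.
elim: m F => [F _|m IH F CF].
  by under eq_fun do rewrite big_ord0; exact: C1_cst.
under eq_fun do rewrite big_ord_recl.
by apply: (C1D (CF _)); exact: IH.
Qed.

Lemma partial_sum n m (F : 'I_m -> 'rV[R]_n -> R) i z : (forall j, C1 (F j)) ->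
  partial i (fun z => \sum_j F j z) z = \sum_j partial i (F j) z.
Proof.
elim: m F => [F _|m IH F CF].
  by under eq_fun do rewrite big_ord0; rewrite big_ord0 partial_cst.
under eq_fun do rewrite big_ord_recl.
rewrite partialD//; last exact: C1_sum.
by rewrite big_ord_recl IH.
Qed.

Lemma C1_sqnorm n : C1 (@sqnorm R n).
Proof. by apply: C1_sum => j; apply: C1M; exact: C1_coord. Qed.

Lemma partial_sqnorm n i (z : 'rV[R]_n) : partial i (@sqnorm R n) z = 2 * z 0 i.
Proof.
rewrite partial_sum; last by move=> j; apply: C1M; exact: C1_coord.
rewrite (bigD1 i)//= big1 ?addr0; last first.
  move=> j ji; rewrite partialM; try exact: C1_coord.
  by rewrite partial_coord (negbTE ji) mulr0 addr0.
rewrite partialM; try exact: C1_coord.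
by rewrite partial_coord eqxx mulr1 mulr_natl mulr2n.
Qed.

Lemma smooth_half_sqnorm n : smooth (fun z : 'rV[R]_n => 2^-1 * sqnorm z).
Proof.
have C1s := @C1_sqnorm n.
have C1h : C1 (fun z : 'rV[R]_n => 2^-1 * sqnorm z) by apply: C1M => //; exact: C1_cst.
apply: smoothP => [z|i]; first by have [] := C1h.
rewrite (_ : partial i _ = (fun z : 'rV[R]_n => z 0 i)); last first.
  apply/funext => z; rewrite partialM//; last exact: C1_cst.
  by rewrite partial_cst mulr0 addr0 partial_sqnorm mulKf.
apply: smoothP => [z|j]; first exact: coord_differentiable.
rewrite (_ : partial j _ = (fun=> (i == j)%:R)); first exact: smooth_cst.
by apply/funext => z; exact: partial_coord.
Qed.

Lemma smooth_Ham d (U : 'rV[R]_d -> R) : smooth U -> smooth (Ham U).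
Proof.
move=> sU; apply: smoothD; first exact: smooth_lsubmx.
exact: (smooth_rsubmx (@smooth_half_sqnorm d)).
Qed.

End smooth_functions.

(** * The Lyapunov inequality *)

Lemma is_derive_inv (R : realType) (t : R) : t != 0 ->
  is_derive t 1 (fun t : R => t^-1) (- (t^-1) ^+ 2).
Proof.
move=> t0; apply: DeriveDef; first exact: (@derivableV _ _ id).
by rewrite (@deriveV _ _ id)// derive_id /GRing.scale/= mulr1 exprVn.
Qed.

Lemma continuous_oppsqinv (R : realType) (t : R) : t != 0 ->
  {for t, continuous (fun t : R => - (t^-1) ^+ 2)}.
Proof.
move=> t0; have ci := inv_continuous t0.
exact: (cvgN (cvgM ci ci)).
Qed.

Section generator.
Variables (R : realType) (d : nat) (U : 'rV[R]_d -> R) (eta : R).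
Hypotheses (sU : smooth U) (U1 : forall x, 1 <= U x) (eta0 : 0 <= eta).

Notation H := (Ham U).

Definition gibbs (z : 'rV[R]_(d + d)) : R := expR (- H z).

(** The diagonal diffusion coefficient: indices below [d] are the x-coordinates. It lets the x and y
    parts of [L_op] and of the energy be handled by one sum. *)
Definition wgt (i : 'I_(d + d)) (z : 'rV[R]_(d + d)) : R :=
  if (i < d)%N then H z `^ (- (2 * eta)) else 1.

Definition dens i z := wgt i z * gibbs z.

Lemma Ham_ge1 z : 1 <= H z.
Proof. by rewrite /Ham (le_trans (U1 (lsubmx z)))// lerDl mulr_ge0// sqnorm_ge0. Qed.

Lemma Ham_gt0 z : 0 < H z.
Proof. exact: lt_le_trans (Ham_ge1 z). Qed.

Lemma C1_Ham : C1 H.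
Proof. exact/smooth_C1/smooth_Ham. Qed.

Lemma gibbs_gt0 z : 0 < gibbs z.
Proof. exact: expR_gt0. Qed.

Lemma gibbs_le1 z : gibbs z <= 1.
Proof. by rewrite /gibbs -expR0 ler_expR oppr_le0 ltW// Ham_gt0. Qed.

Lemma is_derive_expRN (t : R) : is_derive t 1 (fun t => expR (- t)) (- expR (- t)).
Proof. by apply: is_derive_eq; rewrite /GRing.scale/= ?mulr1 ?mulrN1 ?mulN1r. Qed.

Lemma C1_gibbs : C1 gibbs.
Proof.
apply: (@C1_comp R (d + d) (fun t => expR (- t)) (fun t => - expR (- t)) H) => [z|z|].
- exact: is_derive_expRN.
- apply: (@continuousN _ _ _ (fun t => expR (- t))).
  apply: differentiable_continuous; apply/derivable1_diffP.
  by have [] := is_derive_expRN (H z).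
- exact: C1_Ham.
Qed.

Lemma partial_gibbs i z : partial i gibbs z = - gibbs z * partial i H z.
Proof.
apply: (@partial_comp R (d + d) (fun t => expR (- t)) _ H).
  exact: is_derive_expRN.
by have [] := C1_Ham.
Qed.

Lemma wgt_gt0 i z : 0 < wgt i z.
Proof. by rewrite /wgt; case: ifP => // _; rewrite powR_gt0// Ham_gt0. Qed.

Lemma wgt_le1 i z : wgt i z <= 1.
Proof.
rewrite /wgt; case: ifP => // _; rewrite powRN invf_le1 ?powR_gt0 ?Ham_gt0//.
rewrite -[X in X <= _](powRr0 (H z)) ler_powR ?Ham_ge1//.
by rewrite mulr_ge0.
Qed.

Lemma dens_gt0 i z : 0 < dens i z.
Proof. by rewrite mulr_gt0 ?wgt_gt0 ?gibbs_gt0. Qed.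

Lemma C1_wgt i : C1 (wgt i).
Proof.
rewrite /wgt; case: (i < d)%N; last exact: C1_cst.
apply: (@C1_comp R (d + d) (fun t => t `^ (- (2 * eta)))
   (fun t => - (2 * eta) * t `^ (- (2 * eta) - 1)) H) => [z|z|].
- by apply: is_derive1_powR; exact: Ham_gt0.
- apply: (@continuousM _ _ (cst _)); first exact: cst_continuous.
  apply: differentiable_continuous; apply/derivable1_diffP.
  by have [] := is_derive1_powR (- (2 * eta) - 1) (Ham_gt0 z).
- exact: C1_Ham.
Qed.

Lemma partial_wgt i z : partial i (wgt i) z =
  if (i < d)%N then - (2 * eta) * wgt i z / H z * partial i H z else 0.
Proof.
rewrite /wgt; case: (i < d)%N; last exact: partial_cst.
rewrite (@partial_comp R (d + d) (fun t => t `^ (- (2 * eta))) _ H i z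
  (is_derive1_powR _ (Ham_gt0 z))); last by have [] := C1_Ham.
rewrite powRD ?powRN ?powRr1 ?mulrA//; first by rewrite ltW// Ham_gt0.
by rewrite (gt_eqF (Ham_gt0 z)) implybT.
Qed.

Lemma C1_dens i : C1 (dens i).
Proof. by apply: C1M; [exact: C1_wgt|exact: C1_gibbs]. Qed.

Lemma energy_densityE g z :
  energy_density U eta g z = \sum_i wgt i z * partial i g z ^+ 2.
Proof.
rewrite /energy_density big_split_ord/= mulr_sumr; congr (_ + _).
  by apply: eq_bigr => i _; rewrite /wgt /= ltn_ord.
by apply: eq_bigr => i _; rewrite /wgt /= ltnNge leq_addr mul1r.
Qed.

(** The drift of [L_op] is what the product rule produces: [2 eta dH / H] comes from differentiating
    [H^(-2 eta)], and [dH] from differentiating [gibbs]. *)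
Lemma gibbs_L_op f z : smooth f ->
  gibbs z * L_op U eta f z = \sum_i partial i (fun z => dens i z * partial i f z) z.
Proof.
move=> sf.
have C1f i : C1 (partial i f) by exact/smooth_C1/smooth_partial.
have E i : partial i (fun z => dens i z * partial i f z) z =
    dens i z * partial i (partial i f) z +
    (wgt i z * (- gibbs z * partial i H z) + gibbs z * partial i (wgt i) z) * partial i f z.
  rewrite partialM//; last exact: C1_dens.
  rewrite partialM; [|exact: C1_wgt|exact: C1_gibbs].
  by rewrite partial_gibbs; ring.
under eq_bigr do rewrite E partial_wgt.
rewrite big_split_ord/= /L_op /dx /dy.
have -> : forall a b c e : R, a + b - c - e = (a - c) + (b - e) by move=> *; ring.
rewrite mulrDr; congr (_ + _).
  rewrite !mulr_sumr -sumrB mulr_sumr; apply: eq_bigr => i _.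
  rewrite /dens /wgt /= ltn_ord; field.
  by rewrite gt_eqF// Ham_gt0.
rewrite -sumrB mulr_sumr; apply: eq_bigr => i _.
by rewrite /dens /wgt /= ltnNge leq_addr/=; ring.
Qed.

Section lyapunov_compact.
Variables (W : 'rV[R]_(d + d) -> R) (w lam b : R).
Hypotheses (sW : smooth W) (w0 : 0 < w) (Ww : forall z, w <= W z) (lam0 : 0 < lam) (b0 : 0 < b).
Hypothesis LW : forall z, L_op U eta W z <= - lam * H z * W z + b.
Variables (G : 'rV[R]_(d + d) -> R) (a : R).
Hypotheses (a0 : 0 <= a) (CG : C1 G) (suppG : forall z, ~ cube a z -> G z = 0).

Let W0 z : 0 < W z. Proof. exact: lt_le_trans (Ww z). Qed.

Let flux i z := dens i z * partial i W z * (G z ^+ 2 * (W z)^-1).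

Let C1W : C1 W. Proof. exact: smooth_C1. Qed.

Let C1Winv : C1 (fun z => (W z)^-1).
Proof.
apply: (@C1_comp R (d + d) (fun t => t^-1) (fun t => - (t^-1) ^+ 2) W) => // z.
  by apply: is_derive_inv; rewrite gt_eqF.
exact: continuous_oppsqinv (lt0r_neq0 (W0 z)).
Qed.

Let partialWinv i z : partial i (fun z => (W z)^-1) z = - (W z)^-1 ^+ 2 * partial i W z.
Proof.
apply: (@partial_comp R (d + d) (fun t => t^-1) _ W); last by have [] := C1W.
by apply: is_derive_inv; rewrite gt_eqF.
Qed.

Lemma C1_flux i : C1 (fun z => dens i z * partial i W z * (G z ^+ 2 * (W z)^-1)).
Proof.
apply: C1M.
  by apply: C1M; [exact: C1_dens|exact/smooth_C1/smooth_partial].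
by apply: C1M => //; apply: C1M.
Qed.

(** The divergence of the flux is [p (L_eta W) G^2 / W] plus, for each [i], [dens i] times
    [2 a b - a^2] with [a = G d_i W / W] and [b = d_i G]. The square [b^2] absorbs the latter, and
    the drift condition with [W >= w] bounds the former. *)
Lemma lyapunov_pointwise z :
  lam * (H z * G z ^+ 2 * gibbs z) + \sum_i partial i (flux i) z <=
  (\sum_i wgt i z * partial i G z ^+ 2) * gibbs z + b / w * (G z ^+ 2 * gibbs z).
Proof.
have E i : partial i (flux i) z =
    partial i (fun z => dens i z * partial i W z) z * (G z ^+ 2 / W z) +
    dens i z * (2 * (partial i W z / W z) * G z * partial i G z
               - (G z * (partial i W z / W z)) ^+ 2).
  rewrite (@partialM _ _ (fun z => dens i z * partial i W z)
    (fun z => G z ^+ 2 * (W z)^-1)); last 2 first.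
  - by apply: C1M; [exact: C1_dens|exact/smooth_C1/smooth_partial].
  - by apply: C1M => //; apply: C1M.
  rewrite (partialM _ _ (C1M CG CG) C1Winv) (partialM _ _ CG CG) partialWinv.
  by rewrite -!expr2; field; rewrite gt_eqF.
under eq_bigr do rewrite E.
rewrite big_split/= -mulr_suml -gibbs_L_op//.
have GW : 0 <= G z ^+ 2 / W z by rewrite divr_ge0 ?sqr_ge0// ltW.
have h1 : gibbs z * L_op U eta W z * (G z ^+ 2 / W z) <=
    - lam * (H z * G z ^+ 2 * gibbs z) + b / w * (G z ^+ 2 * gibbs z).
  apply: (@le_trans _ _ (gibbs z * (- lam * H z * W z + b) * (G z ^+ 2 / W z))).
    by rewrite ler_wpM2r// ler_wpM2l// ltW// gibbs_gt0.
  have -> : gibbs z * (- lam * H z * W z + b) * (G z ^+ 2 / W z) =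
     - lam * (H z * G z ^+ 2 * gibbs z) + b / W z * (G z ^+ 2 * gibbs z).
    by field; rewrite gt_eqF.
  rewrite lerD2l ler_wpM2r//; first by rewrite mulr_ge0 ?sqr_ge0// ltW// gibbs_gt0.
  by rewrite ler_pM2l// lef_pV2 ?posrE.
have h2 : \sum_i dens i z * (2 * (partial i W z / W z) * G z * partial i G z
               - (G z * (partial i W z / W z)) ^+ 2) <=
    (\sum_i wgt i z * partial i G z ^+ 2) * gibbs z.
  rewrite mulr_suml; apply: ler_sum => i _.
  rewrite [leRHS]mulrAC -/(dens i z) ler_pM2l ?dens_gt0//.
  by have := sqr_ge0 (G z * (partial i W z / W z) - partial i G z); nra.
lra.
Qed.

End lyapunov_compact.
End generator.

(** * Exhaustion by cubes and cutoff functions *)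

Section exhaustion.
Variables (R : realType) (n : nat).
Notation V := (borel_rV R).

Lemma rV_in_cube (z : 'rV[R]_n) : exists m : nat, cube m%:R z.
Proof.
have S0 : 0 <= \sum_i `|z 0 i| by exact: sumr_ge0.
exists (Num.truncn (\sum_i `|z 0 i|)).+1 => i.
apply: le_trans (ltW (truncnS_gt _)).
by rewrite (bigD1 i)//= lerDl sumr_ge0.
Qed.

Lemma cube_subset (a b : R) : a <= b -> @cube R n a `<=` @cube R n b.
Proof. by move=> ab z za i; exact: le_trans (za i) ab. Qed.

Lemma lebI_exhaust (f : 'rV[R]_n -> R) (B : \bar R) : meas f -> (forall z, 0 <= f z) ->
  (forall m : nat, lebI (fun z => \1_(cube m%:R) z * f z)%R <= B)%E -> (lebI f <= B)%E.
Proof.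
move=> mf f0 fB.
pose F m (z : V n) := (\1_(@cube R n m%:R) z * f z)%:E.
have FE z m : cube m%:R z -> forall k, (m <= k)%N -> F k z = (f z)%:E.
  move=> mz k mk; rewrite /F indicE mem_set ?mul1r//.
  by apply: cube_subset mz; rewrite ler_nat.
have Fcvg z : F ^~ z @ \oo --> (f z)%:E.
  have [m mz] := rV_in_cube z; apply: cvg_near_cst.
  by exists m => // k /= mk; exact: FE mz _ mk.
have mF m : measurable_fun setT (F m).
  apply/measurable_EFinP; apply: measurable_funM => //.
  by apply: measurable_indic; exact: measurable_cube.
have F0 m z : setT z -> (0 <= F m z)%E by rewrite lee_fin mulr_ge0.
have Fnd z : setT z -> {homo F ^~ z : k l / (k <= l)%N >-> (k <= l)%E}.
  move=> _ k l kl; rewrite lee_fin ler_wpM2r// !indicE.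
  have [/set_mem kz|_] := boolP (z \in cube k%:R); last by rewrite ler0n.
  by rewrite mem_set//; apply: cube_subset kz; rewrite ler_nat.
rewrite /lebI (_ : (fun z => (f z)%:E) = (fun z => limn (F ^~ z))); last first.
  by apply/funext => z; apply/esym/cvg_lim => //; exact: Fcvg.
rewrite (monotone_convergence _ measurableT mF F0 Fnd).
apply: lime_le; last by apply: nearW => m; exact: fB.
apply: ereal_nondecreasing_is_cvgn => k l kl.
by apply: ge0_le_integral => // z _; [exact: F0|exact: Fnd].
Qed.

End exhaustion.

Section cutoff.
Variables (R : realType) (n : nat).

(** It vanishes outside the ball of radius [r] but is not [1] on a smaller ball; being at least
    [1/4] where [2 |z|^2 <= r^2] suffices and only costs constants. A gradient bound uniform in [r]
    also suffices, since the target inequality already has an [h^2] term. *)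
Definition cutoff (r : R) (z : 'rV[R]_n) : R := sqpos (1 - sqnorm z / r ^+ 2).

Let C1arg r : C1 (fun z : 'rV[R]_n => 1 - sqnorm z / r ^+ 2).
Proof.
have -> : (fun z : 'rV[R]_n => 1 - sqnorm z / r ^+ 2) =
    (fun z => 1 + sqnorm z * (- (r ^+ 2)^-1)) by apply/funext => z; rewrite mulrN.
by apply: C1D; [exact: C1_cst|apply: C1M; [exact: C1_sqnorm|exact: C1_cst]].
Qed.

Lemma C1_cutoff r : C1 (cutoff r).
Proof. by apply: C1_sqpos; exact: C1arg. Qed.

Lemma partial_cutoff r i z :
  partial i (cutoff r) z = 2 * Num.max (1 - sqnorm z / r ^+ 2) 0 * (- (2 * z 0 i) / r ^+ 2).
Proof.
rewrite partial_sqpos; last exact: C1arg.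
congr (_ * _).
have -> : (fun z : 'rV[R]_n => 1 - sqnorm z / r ^+ 2) =
    (fun z => 1 + sqnorm z * (- (r ^+ 2)^-1)) by apply/funext => y; rewrite mulrN.
rewrite partialD; [|exact: C1_cst|by apply: C1M; [exact: C1_sqnorm|exact: C1_cst]].
rewrite partialM; [|exact: C1_sqnorm|exact: C1_cst].
by rewrite !partial_cst partial_sqnorm mulr0 !add0r mulrC mulrN mulNr.
Qed.

Let s_ge0 (r : R) (z : 'rV[R]_n) : 0 <= sqnorm z / r ^+ 2.
Proof. by rewrite divr_ge0 ?sqnorm_ge0 ?sqr_ge0. Qed.

Lemma cutoff_ge0 r z : 0 <= cutoff r z.
Proof. exact: sqr_ge0. Qed.

Lemma cutoff_le1 r z : cutoff r z <= 1.
Proof.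
rewrite /cutoff /sqpos; have := s_ge0 r z; move: (_ / _) => s s0.
by case: (leP (1 - s) 0) => h; nra.
Qed.

Lemma cutoff_gradsq r z : 1 <= r -> gradsq (cutoff r) z <= 16.
Proof.
move=> r1; have r0 : 0 < r by lra.
have r2 : 1 <= r ^+ 2 by rewrite expr_ge1//; lra.
set M := Num.max (1 - sqnorm z / r ^+ 2) 0.
have -> : gradsq (cutoff r) z = 16 * (M ^+ 2 * (sqnorm z / r ^+ 2)) / r ^+ 2.
  rewrite /gradsq; under eq_bigr do rewrite partial_cutoff -/M.
  rewrite /sqnorm; transitivity (\sum_i (16 * M ^+ 2 / r ^+ 2 / r ^+ 2) * z 0 i ^+ 2).
    by apply: eq_bigr => i _; field; rewrite gt_eqF.
  by rewrite -mulr_sumr; field; rewrite gt_eqF.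
have h : M ^+ 2 * (sqnorm z / r ^+ 2) <= 1.
  rewrite /M; have := s_ge0 r z; move: (_ / _) => s s0.
  by case: (leP (1 - s) 0) => h; nra.
rewrite ler_pdivrMr; nra.
Qed.

Lemma cutoff_support r z : 0 < r -> ~ cube r z -> cutoff r z = 0.
Proof.
move=> r0 zr; have [i] : exists i, r < `|z 0 i|.
  by apply: contrapT => h; apply: zr => i; rewrite leNgt; apply/negP => ri; apply: h; exists i.
move=> ri; rewrite /cutoff /sqpos max_r ?expr0n//.
rewrite subr_le0 ler_pdivlMr ?exprn_gt0// mul1r.
apply: (@le_trans _ _ (z 0 i ^+ 2)).
  by rewrite -[leRHS]real_normK ?num_real// lerXn2r ?nnegrE// ltW.
by rewrite /sqnorm (bigD1 i)//= lerDl sumr_ge0// => j _; exact: sqr_ge0.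
Qed.

Lemma cutoff_ge r z : 0 < r -> 2 * sqnorm z <= r ^+ 2 -> 4^-1 <= cutoff r z.
Proof.
move=> r0 zr; rewrite /cutoff /sqpos.
have : sqnorm z / r ^+ 2 <= 2^-1 by rewrite ler_pdivrMr ?exprn_gt0//; lra.
move: (_ / _) => s s2; rewrite max_l; last lra.
nra.
Qed.

End cutoff.

Section lyapunov.
Variables (R : realType) (d : nat) (U : 'rV[R]_d -> R) (eta : R).
Hypotheses (sU : smooth U) (U1 : forall x, 1 <= U x) (eta0 : 0 <= eta).
Notation H := (Ham U).
Notation p := (gibbs U).
Notation Gam := (energy_density U eta).
Notation leb := (@leb R).

Variables (W : 'rV[R]_(d + d) -> R) (w lam b : R).
Hypotheses (sW : smooth W) (w0 : 0 < w) (Ww : forall z, w <= W z) (lam0 : 0 < lam) (b0 : 0 < b).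
Hypothesis LW : forall z, L_op U eta W z <= - lam * H z * W z + b.

Lemma continuous_energy h : C1 h -> continuous (Gam h).
Proof.
move=> Ch; rewrite (_ : Gam h = fun z => \sum_i wgt U eta i z * partial i h z ^+ 2).
  apply: continuous_sum_ord => i z.
  have cw := C1_continuous (C1_wgt eta sU U1 i).
  exact: (cvgM (cw z) (cvgM (Ch.2 i z) (Ch.2 i z))).
by apply/funext => z; exact: energy_densityE.
Qed.

Lemma energy_ge0 h z : 0 <= Gam h z.
Proof.
rewrite energy_densityE; apply: sumr_ge0 => i _.
by rewrite mulr_ge0 ?sqr_ge0// ltW// wgt_gt0.
Qed.

Lemma continuous_gibbs : continuous p.
Proof. exact/C1_continuous/C1_gibbs. Qed.

Lemma continuous_Ham : continuous H.
Proof. exact/C1_continuous/C1_Ham. Qed.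

Lemma lyapunov_support G a : 0 <= a -> C1 G -> (forall z, ~ cube a z -> G z = 0) ->
  (lam%:E * lebI (fun z => H z * G z ^+ 2 * p z)%R <=
   lebI (fun z => Gam G z * p z)%R + (b / w)%:E * lebI (fun z => G z ^+ 2 * p z)%R)%E.
Proof.
move=> a0 CG G0.
have cG := C1_continuous CG; have cp := continuous_gibbs; have cH := continuous_Ham.
have p0 z : 0 <= p z by exact/ltW/gibbs_gt0.
have H0 z : 0 <= H z by exact/ltW/Ham_gt0.
have cG2p : continuous (fun z => G z ^+ 2 * p z).
  by move=> z; exact: (cvgM (cvgM (cG z) (cG z)) (cp z)).
have cHG : continuous (fun z => H z * G z ^+ 2 * p z).
  by move=> z; exact: (cvgM (cvgM (cH z) (cvgM (cG z) (cG z))) (cp z)).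
have cGam : continuous (fun z => Gam G z * p z).
  have cE : continuous (Gam G) by exact: continuous_energy.
  by move=> z; exact: (cvgM (cE z) (cp z)).
have bw : 0 <= b / w by rewrite divr_ge0// ltW.
(* With infinite energy the right side is infinite. Otherwise [Gam G * p] is integrable at once,
   with no need to discuss the support of the derivatives of [G]. *)
have [Goo|Gfin] := eqVneq (lebI (fun z => Gam G z * p z)) +oo%E.
  rewrite Goo addye ?leey// gt_eqF// (lt_le_trans (ltNy0))//.
  by rewrite mule_ge0 ?lee_fin// lebI_ge0// => z; rewrite mulr_ge0 ?sqr_ge0.
pose fl i z := dens U eta i z * partial i W z * (G z ^+ 2 * (W z)^-1).
have Cfl i : C1 (fl i) by exact: (C1_flux eta sU U1 sW w0 Ww CG).
have fl0 i z : ~ cube a z -> fl i z = 0.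
  by move=> /G0 Gz; rewrite /fl Gz expr0n/= mul0r mulr0.
have ifl i := integral_partial i a0 (Cfl i) (@fl0 i).
have iH : (leb (d + d)).-integrable setT (fun z => (lam * (H z * G z ^+ 2 * p z))%:E).
  apply: (integrable_cube_support a0).
    by move=> z; exact: (cvgM (cvg_cst _) (cHG z)).
  by move=> z /G0 ->; rewrite expr0n/= mulr0 mul0r mulr0.
have iG : (leb (d + d)).-integrable setT (fun z => (b / w * (G z ^+ 2 * p z))%:E).
  apply: (integrable_cube_support a0).
    by move=> z; exact: (cvgM (cvg_cst _) (cG2p z)).
  by move=> z /G0 ->; rewrite expr0n/= mul0r mulr0.
have iGam : (leb (d + d)).-integrable setT (fun z => (Gam G z * p z)%:E).
  apply/integrableP; split.
    by apply/measurable_EFinP; exact: measurable_continuous_rV.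
  rewrite (_ : integral _ _ _ = lebI (fun z => Gam G z * p z)) ?ltey//.
  by apply: eq_integral => z _; rewrite gee0_abs// lee_fin mulr_ge0// energy_ge0.
have isum : (leb (d + d)).-integrable setT (fun z => \sum_i (partial i (fl i) z)%:E)%E.
  by apply: integrable_sum => // i _; have [] := ifl i.
rewrite -lebIZ; [|exact: cont_meas|by move=> z; rewrite mulr_ge0// mulr_ge0 ?sqr_ge0|exact: ltW].
rewrite -lebIZ//; [|exact: cont_meas|by move=> z; rewrite mulr_ge0 ?sqr_ge0].
(* The divergence, whose integral is zero, is added so that the two sides can be compared
   pointwise. *)
have -> : lebI (fun z => lam * (H z * G z ^+ 2 * p z)) =
   (\int[leb (d + d)]_z ((lam * (H z * G z ^+ 2 * p z))%:E + \sum_i (partial i (fl i) z)%:E))%E.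
  rewrite integralD// integral_sum//; last by move=> i; have [] := ifl i.
  by rewrite big1 ?adde0// => i _; have [] := ifl i.
rewrite /lebI -integralD//; apply: le_integral => //.
- exact: integrableD.
- exact: integrableD.
- move=> z _; rewrite sumEFin -!EFinD lee_fin energy_densityE.
  exact: (lyapunov_pointwise sU U1 sW w0 Ww b0 LW CG).
Qed.
End lyapunov.

Section lyapunov_global.
Variables (R : realType) (d : nat) (U : 'rV[R]_d -> R) (eta : R).
Hypotheses (sU : smooth U) (U1 : forall x, 1 <= U x) (eta0 : 0 <= eta).
Notation H := (Ham U).
Notation p := (gibbs U).
Notation Gam := (energy_density U eta).
Notation leb := (@leb R).

Lemma energy_cutoff h r z : C1 h -> 1 <= r ->
  Gam (fun z => h z * cutoff r z) z <= 2 * Gam h z + 32 * h z ^+ 2.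
Proof.
move=> Ch r1; rewrite !energy_densityE.
have gr := cutoff_gradsq z r1.
have g0 := gradsq_ge0 (@cutoff R (d + d) r) z.
apply: (@le_trans _ _ (\sum_i (2 * (wgt U eta i z * partial i h z ^+ 2) +
    2 * h z ^+ 2 * partial i (cutoff r) z ^+ 2))); last first.
  rewrite big_split/= -!mulr_sumr lerD2l -/(gradsq (cutoff r) z).
  have := sqr_ge0 (h z); nra.
apply: ler_sum => i _; rewrite partialM//; last exact: C1_cutoff.
have c0 := cutoff_ge0 r z; have c1 := cutoff_le1 r z.
have w0 := wgt_gt0 eta U1 i z; have w1 := wgt_le1 U1 eta0 i z.
move: (wgt _ _ _ _) (cutoff r z) (partial i h z) (partial i (cutoff r) z) (h z)
  c0 c1 w0 w1 => w c a x y c0 c1 w0 w1.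
have h1 : (y * x + c * a) ^+ 2 <= 2 * (y * x) ^+ 2 + 2 * (c * a) ^+ 2.
  by have := sqr_ge0 (y * x - c * a); nra.
have h2 : (c * a) ^+ 2 <= a ^+ 2.
  by rewrite exprMn ler_piMl ?sqr_ge0// expr_le1.
have h3 : 0 <= (y * x) ^+ 2 by exact: sqr_ge0.
have h4 : w * (y * x) ^+ 2 <= (y * x) ^+ 2 by rewrite ler_piMl.
have h5 : w * (y * x + c * a) ^+ 2 <= w * (2 * (y * x) ^+ 2 + 2 * a ^+ 2).
  by rewrite ler_pM2l//; lra.
by move: h4 h5; rewrite exprMn; lra.
Qed.

Variables (W : 'rV[R]_(d + d) -> R) (w lam b : R).
Hypotheses (sW : smooth W) (w0 : 0 < w) (Ww : forall z, w <= W z) (lam0 : 0 < lam) (b0 : 0 < b).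
Hypothesis LW : forall z, L_op U eta W z <= - lam * H z * W z + b.

(** Apply the compactly supported case to [h * cutoff r] and let the cubes grow. The factor [16]
    undoes [cutoff^2 >= 1/16]; the energy of the product is at most [2 Gam h + 32 h^2]. No bound
    depends on [r]. *)
Lemma lyapunov_ineq h : C1 h ->
  (lebI (fun z => H z * h z ^+ 2 * p z)%R <=
   (32 / lam)%:E * lebI (fun z => Gam h z * p z)%R +
   (16 * (32 + b / w) / lam)%:E * lebI (fun z => h z ^+ 2 * p z)%R)%E.
Proof.
move=> Ch.
have ch := C1_continuous Ch; have cp := continuous_gibbs sU; have cH := continuous_Ham sU.
have p0 z : 0 <= p z by exact/ltW/gibbs_gt0.
have H0 z : 0 <= H z by exact/ltW/Ham_gt0.
have cGam f : C1 f -> continuous (fun z => Gam f z * p z).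
  move=> Cf; have cE : continuous (Gam f) by exact: continuous_energy.
  by move=> z; exact: (cvgM (cE z) (cp z)).
have cf2p f : C1 f -> continuous (fun z => f z ^+ 2 * p z).
  move=> Cf; have cf := C1_continuous Cf.
  by move=> z; exact: (cvgM (cvgM (cf z) (cf z)) (cp z)).
have cHf f : C1 f -> continuous (fun z => H z * f z ^+ 2 * p z).
  move=> Cf; have cf := C1_continuous Cf.
  by move=> z; exact: (cvgM (cvgM (cH z) (cvgM (cf z) (cf z))) (cp z)).
have Hf0 f z : 0 <= H z * f z ^+ 2 * p z by rewrite mulr_ge0// mulr_ge0 ?sqr_ge0.
have Gp0 f z : 0 <= Gam f z * p z by rewrite mulr_ge0// energy_ge0.
have f2p0 (f : 'rV[R]_(d + d) -> R) z : 0 <= f z ^+ 2 * p z by rewrite mulr_ge0 ?sqr_ge0.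
have bw : 0 <= b / w by rewrite divr_ge0// ltW.
apply: lebI_exhaust => [|//|m]; first by apply: cont_meas; exact: cHf.
pose n : R := (d + d)%:R.
(* On the cube of half-side [m] one has [2 |z|^2 <= 2 n m^2 <= r^2]; the added ones ensure [1 <= r]
   in all cases. *)
pose r : R := (2 * n + 1) * (m%:R + 1).
have n0 : 0 <= n by rewrite ler0n.
have m0 : 0 <= m%:R :> R by rewrite ler0n.
have r1 : 1 <= r by rewrite /r; nra.
have r0 : 0 < r by lra.
pose G z := h z * cutoff r z.
have CG : C1 G by apply: C1M => //; exact: C1_cutoff.
have G0 z : ~ cube r z -> G z = 0.
  by move=> zr; rewrite /G cutoff_support ?mulr0.
have lyap := lyapunov_support sU U1 sW w0 Ww lam0 b0 LW (ltW r0) CG G0.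
have step1 : (lebI (fun z => \1_(cube m%:R) z * (H z * h z ^+ 2 * p z))%R <=
    16%:E * lebI (fun z => H z * G z ^+ 2 * p z)%R)%E.
  rewrite -lebIZ//; last by apply: cont_meas; exact: cHf.
  apply: le_lebI.
  - by apply: measM; [apply: meas_indic; exact: measurable_cube|apply: cont_meas; exact: cHf].
  - by apply: measM; [exact: meas_cst|apply: cont_meas; exact: cHf].
  - by move=> z; rewrite mulr_ge0.
  - move=> z; rewrite indicE; have [/set_mem mz|_] := boolP (z \in _); last first.
      by rewrite mul0r mulr_ge0.
    have cz : 4^-1 <= cutoff r z.
      apply: cutoff_ge => //; have := cube_sqnorm m0 mz; rewrite -/n => zn.
      apply: (@le_trans _ _ (2 * (n * m%:R ^+ 2))); first by lra.
      have : 0 <= n * m%:R by rewrite mulr_ge0.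
      have : 0 <= n * m%:R ^+ 2 by rewrite mulr_ge0// sqr_ge0.
      by rewrite /r exprMn; nra.
    rewrite mul1r /G exprMn.
    have c2 : 1 <= 16 * cutoff r z ^+ 2 by nra.
    have -> : 16 * (H z * (h z ^+ 2 * cutoff r z ^+ 2) * p z) =
      (H z * h z ^+ 2 * p z) * (16 * cutoff r z ^+ 2) by ring.
    by rewrite ler_peMr.
have step2 : (lebI (fun z => Gam G z * p z)%R <= 2%:E * lebI (fun z => Gam h z * p z)%R +
    32%:E * lebI (fun z => h z ^+ 2 * p z)%R)%E.
  rewrite -!lebIZ//; [|by apply: cont_meas; exact: cf2p|by apply: cont_meas; exact: cGam].
  rewrite -lebID; [|by apply: measM; [exact: meas_cst|apply: cont_meas; exact: cGam]
    |by apply: measM; [exact: meas_cst|apply: cont_meas; exact: cf2p]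
    |by move=> z; rewrite mulr_ge0|by move=> z; rewrite mulr_ge0].
  apply: le_lebI => //; first by apply: cont_meas; exact: cGam.
    by apply: measD; apply: measM; try exact: meas_cst; apply: cont_meas; [exact: cGam|exact: cf2p].
  move=> z; rewrite (mulrA 2) (mulrA 32) -mulrDl ler_wpM2r//; exact: energy_cutoff.
have step3 : (lebI (fun z => G z ^+ 2 * p z)%R <= lebI (fun z => h z ^+ 2 * p z)%R)%E.
  apply: le_lebI => //; [by apply: cont_meas; exact: cf2p|by apply: cont_meas; exact: cf2p|].
  move=> z; rewrite ler_wpM2r// /G exprMn ler_piMr ?sqr_ge0// expr_le1 ?cutoff_ge0//.
  exact: cutoff_le1.
apply: (le_trans step1).
set A := lebI (fun z => Gam h z * p z)%R in step2 *.
set B := lebI (fun z => h z ^+ 2 * p z)%R in step2 step3 *.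
have A0 : (0 <= A)%E by exact: lebI_ge0.
have B0 : (0 <= B)%E by exact: lebI_ge0.
set X := lebI (fun z => H z * G z ^+ 2 * p z)%R in lyap *.
have lyap2 : (lam%:E * X <= 2%:E * A + (32 + b / w)%:E * B)%E.
  apply: (le_trans lyap).
  have -> : ((32 + b / w)%:E * B = 32%:E * B + (b / w)%:E * B)%E.
    by rewrite EFinD ge0_muleDl ?lee_fin.
  rewrite addeA; apply: leeD => //.
  by rewrite lee_wpmul2l.
have -> : (16%:E * X = (16 / lam)%:E * (lam%:E * X))%E.
  by rewrite muleA -EFinM divfK// gt_eqF.
have l16 : (0 <= (16 / lam)%:E)%E by rewrite lee_fin divr_ge0// ltW.
apply: (le_trans (lee_wpmul2l l16 lyap2)).
rewrite ge0_muleDr ?mule_ge0 ?lee_fin ?addr_ge0// !muleA -!EFinM.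
have -> : 16 / lam * 2 = 32 / lam by ring.
have -> : 16 / lam * (32 + b / w) = 16 * (32 + b / w) / lam by rewrite mulrAC.
by [].
Qed.

End lyapunov_global.

(** * The Poincaré inequality for the Gibbs measure *)

Section poincare_global.
Variables (R : realType) (d : nat) (U : 'rV[R]_d -> R) (eta : R).
Hypotheses (sU : smooth U) (U1 : forall x, 1 <= U x) (eta0 : 0 <= eta).
Hypothesis U_coercive : forall M : R, exists r0 : R, forall x : 'rV[R]_d,
      r0 < enorm x -> M < U x.
Notation H := (Ham U).
Notation p := (gibbs U).
Notation Gam := (energy_density U eta).

(** A crude bound from [ln H <= H]: only exponential control in [H] matters later. *)
Lemma wgt_ge i z : expR (- (2 * eta * H z)) <= wgt U eta i z.
Proof.
have H0 := Ham_gt0 U1 z.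
rewrite /wgt; case: ifP => _.
  rewrite /powR gt_eqF// ler_expR mulNr lerN2 ler_wpM2l ?mulr_ge0//.
  exact/ltW/ln_sublinear.
by rewrite -expR0 ler_expR oppr_le0 mulr_ge0 ?mulr_ge0// ltW.
Qed.

Lemma gradsq_le_energy h z : gradsq h z <= expR (2 * eta * H z) * Gam h z.
Proof.
rewrite energy_densityE mulr_sumr; apply: ler_sum => i _.
rewrite mulrA ler_peMl ?sqr_ge0// -(expRK (2 * eta * H z)) expRK.
rewrite -[X in X <= _](mulfV (x := expR (2 * eta * H z))) ?gt_eqF ?expR_gt0//.
by rewrite ler_pM2l ?expR_gt0// -expRN wgt_ge.
Qed.

Lemma gradsq_le_energy_gibbs h z :
  gradsq h z <= expR ((2 * eta + 1) * H z) * (Gam h z * p z).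
Proof.
apply: le_trans (gradsq_le_energy h z) _.
rewrite le_eqVlt; apply/predU1P; left.
have -> : (2 * eta + 1) * H z = 2 * eta * H z + H z by ring.
rewrite expRD /gibbs expRN; field.
by rewrite gt_eqF ?expR_gt0.
Qed.

Lemma sublevel_cube (M : R) : exists2 a : R, 0 < a & forall z, H z <= M -> cube a z.
Proof.
have [r0 hr] := U_coercive M.
(* The term [|r0|] takes care of [x]; for [y], each squared coordinate is at most
   [2 M < (|M| + 1)^2]. *)
exists (`|r0| + `|M| + `|M| + 1).
  by rewrite ltr_wpDl// !addr_ge0.
move=> z zM.
have q0 := sqnorm_ge0 (rsubmx z); have u1 := U1 (lsubmx z).
have coordle n (v : 'rV[R]_n) i : `|v 0 i| ^+ 2 <= sqnorm v.
  by rewrite real_normK ?num_real// /sqnorm (bigD1 i)//= lerDl sumr_ge0// => j _; exact: sqr_ge0.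
have xle : enorm (lsubmx z) <= r0.
  rewrite leNgt; apply/negP => /hr; rewrite ltNge => /negP; apply.
  by apply: le_trans zM; rewrite /Ham lerDl mulr_ge0.
have yle : sqnorm (rsubmx z) <= 2 * M.
  by move: zM; rewrite /Ham; lra.
move=> i; rewrite -(hsubmxK z); case: (split_ordP i) => j ->.
  rewrite row_mxEl; apply: (@le_trans _ _ r0); last first.
    by have := ler_norm r0; have := normr_ge0 M; lra.
  apply: le_trans xle; rewrite /enorm -[leLHS]sqrtr_sqr ler_sqrt ?sqnorm_ge0//.
  by have := coordle _ (lsubmx z) j; rewrite real_normK ?num_real.
rewrite row_mxEr; have := coordle _ (rsubmx z) j.
have := normr_ge0 (rsubmx z 0 j); have := normr_ge0 r0; have := ler_norm M.
move: `|_ 0 j| `|r0| `|M| => y r m h1 h2 h3 h4.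
rewrite leNgt; apply/negP => h5.
have : (m + 1) ^+ 2 < y ^+ 2 by rewrite ltrXn2r ?nnegrE//; lra.
nra.
Qed.

Lemma C1B_cst n (h : 'rV[R]_n -> R) (c : R) : C1 h -> C1 (fun z => h z - c).
Proof. by move=> Ch; apply: (C1D Ch); exact: C1_cst. Qed.

Lemma energyB_cst h c z : C1 h -> Gam (fun z => h z - c) z = Gam h z.
Proof.
move=> Ch; rewrite !energy_densityE; apply: eq_bigr => i _; congr (_ * _ ^+ 2).
rewrite partialD//; last exact: C1_cst.
by rewrite partial_cst addr0.
Qed.

Variables (A1 B1 : R).
Hypotheses (A10 : 0 <= A1) (B10 : 0 < B1).
Hypothesis lyap : forall h, C1 h ->
  (lebI (fun z => H z * h z ^+ 2 * p z)%R <=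
   A1%:E * lebI (fun z => Gam h z * p z)%R + B1%:E * lebI (fun z => h z ^+ 2 * p z)%R)%E.
Hypothesis p_int : (lebI p < +oo)%E.

(** The cube inequality handles the sublevel [H <= 2 B1], where weights are bounded above and below.
    Outside it, [(2 B1)^-1 H >= 1], and the Lyapunov inequality applied to [h - c] returns half of
    the variance, which is absorbed on the left. *)
Lemma poincare_gibbs : exists2 C : R, 0 < C & forall h, C1 h ->
  (lebI (fun z => h z ^+ 2 * p z)%R < +oo)%E ->
  exists c, (lebI (fun z => (h z - c) ^+ 2 * p z)%R <=
    C%:E * lebI (fun z => Gam h z * p z)%R)%E.
Proof.
have cp := continuous_gibbs sU; have cH := continuous_Ham sU.
have p0 z : 0 <= p z by exact/ltW/gibbs_gt0.
have H0 z : 0 <= H z by exact/ltW/Ham_gt0.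
(* The level [2 B1] turns the coefficient [B1] of the Lyapunov inequality into [1/2]. *)
have [a a0 Ha] := sublevel_cube (2 * B1).
have [Hm [Hm0 HHm]] := continuous_cube_bounded a cH.
pose n := (d + d)%N.
pose K : R := 2 ^+ n * (n%:R * (2 * a) ^+ 2) + 1.
have K0 : 0 < K by rewrite /K ltr_wpDl// mulr_ge0 ?exprn_ge0// mulr_ge0 ?sqr_ge0.
pose kap := expR ((2 * eta + 1) * Hm).
have kap0 : 0 < kap by exact: expR_gt0.
exists (A1 / B1 + 2 * (K * kap)).
  by rewrite ltr_wpDl ?mulr_gt0// divr_ge0// ltW.
move=> h Ch hfin.
have [c hc] := poincare_cube a0 Ch.
exists c.
have CG := C1B_cst c Ch.
have cG := C1_continuous CG; have ch := C1_continuous Ch.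
have cE : continuous (Gam h) by exact: continuous_energy.
have cEp : continuous (fun z => Gam h z * p z) by move=> z; exact: (cvgM (cE z) (cp z)).
have cG2p : continuous (fun z => (h z - c) ^+ 2 * p z).
  by move=> z; exact: (cvgM (cvgM (cG z) (cG z)) (cp z)).
have cHG : continuous (fun z => H z * (h z - c) ^+ 2 * p z).
  by move=> z; exact: (cvgM (cvgM (cH z) (cvgM (cG z) (cG z))) (cp z)).
have ch2p : continuous (fun z => h z ^+ 2 * p z).
  by move=> z; exact: (cvgM (cvgM (ch z) (ch z)) (cp z)).
have mQ : meas \1_(@cube R n a) by apply: meas_indic; exact: measurable_cube.
have cG2 : continuous (fun z => (h z - c) ^+ 2) by move=> z; exact: (cvgM (cG z) (cG z)).
have Ep0 z : 0 <= Gam h z * p z by rewrite mulr_ge0// energy_ge0.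
have G2p0 z : 0 <= (h z - c) ^+ 2 * p z by rewrite mulr_ge0 ?sqr_ge0.
have HG0 z : 0 <= H z * (h z - c) ^+ 2 * p z by rewrite mulr_ge0// mulr_ge0 ?sqr_ge0.
set E := lebI (fun z => Gam h z * p z)%R.
have E0 : (0 <= E)%E by exact: lebI_ge0.
have [Eoo|Efin] := eqVneq E +oo%E.
  rewrite Eoo gt0_muley ?leey// lte_fin ltr_wpDl ?mulr_gt0// divr_ge0// ltW//.
have {}Efin : E \is a fin_num by rewrite ge0_fin_numE// ltey.
set v := lebI (fun z => (h z - c) ^+ 2 * p z)%R.
have v0 : (0 <= v)%E by exact: lebI_ge0.
(* Absorbing half of [v] requires [v] to be finite: [(h - c)^2 <= 2 h^2 + 2 c^2]. *)
have vfin : v \is a fin_num.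
  rewrite ge0_fin_numE//.
  apply: (@le_lt_trans _ _ (2%:E * lebI (fun z => h z ^+ 2 * p z)%R + (2 * c ^+ 2)%:E * lebI p)%E).
    rewrite -!lebIZ//; [|exact: cont_meas|by rewrite mulr_ge0 ?sqr_ge0
      |exact: cont_meas|by move=> z; rewrite mulr_ge0 ?sqr_ge0].
    rewrite -lebID; [|by apply: measM; [exact: meas_cst|exact: cont_meas]
      |by apply: measM; [exact: meas_cst|exact: cont_meas]
      |by move=> z; rewrite mulr_ge0// mulr_ge0 ?sqr_ge0
      |by move=> z; rewrite mulr_ge0// mulr_ge0 ?sqr_ge0].
    apply: le_lebI => //; first exact: cont_meas.
      by apply: measD; apply: measM; try exact: meas_cst; exact: cont_meas.
    move=> z; rewrite (mulrA 2) -mulrDl ler_wpM2r//.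
    by have := sqr_ge0 (h z + c); nra.
  by rewrite lte_add_pinfty// lte_mul_pinfty// lee_fin mulr_ge0 ?sqr_ge0.
have vle : (v <= (2 * B1)^-1%:E * lebI (fun z => H z * (h z - c) ^+ 2 * p z)%R +
    lebI (fun z => \1_(cube a) z * (h z - c) ^+ 2)%R)%E.
  rewrite -lebIZ//; [|exact: cont_meas|by rewrite invr_ge0 mulr_ge0// ltW].
  have m2 : meas (fun z => \1_(cube a) z * (h z - c) ^+ 2).
    by apply: measM => //; exact: cont_meas.
  rewrite -lebID//; last 3 first.
  - by apply: measM; [exact: meas_cst|exact: cont_meas].
  - by move=> z; rewrite mulr_ge0// invr_ge0 mulr_ge0// ltW.
  - by move=> z; rewrite mulr_ge0 ?sqr_ge0.
  apply: le_lebI => //; first exact: cont_meas.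
    by apply: measD => //; apply: measM; [exact: meas_cst|exact: cont_meas].
  move=> z; have [Hz|Hz] := leP (H z) (2 * B1).
    rewrite indicE mem_set ?mul1r; last exact: Ha.
    rewrite ler_wpDl//; first by rewrite mulr_ge0// invr_ge0 mulr_ge0// ltW.
    by rewrite ler_piMr ?sqr_ge0// gibbs_le1.
  rewrite ler_wpDr//; first by rewrite mulr_ge0 ?sqr_ge0.
  rewrite ler_pdivlMl ?mulr_gt0// -[leRHS]mulrA.
  by rewrite ler_wpM2r// ltW.
have Ql : (lebI (fun z => \1_(cube a) z * gradsq h z)%R <= kap%:E * E)%E.
  rewrite /E -lebIZ//; [|exact: cont_meas|exact: ltW].
  have mg : meas (gradsq h) by apply: cont_meas; exact: gradsq_continuous.
  apply: le_lebI.
  - exact: measM.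
  - by apply: measM; [exact: meas_cst|exact: cont_meas].
  - by move=> z; rewrite mulr_ge0// gradsq_ge0.
  - move=> z; rewrite indicE; have [/set_mem az|_] := boolP (z \in _); last first.
      by rewrite mul0r mulr_ge0// ltW.
    rewrite mul1r; apply: le_trans (gradsq_le_energy_gibbs h z) _.
    rewrite ler_wpM2r// ler_expR ler_wpM2l ?addr_ge0 ?mulr_ge0//.
    exact: le_trans (ler_norm _) (HHm z az).
have lyG := lyap CG; rewrite -/v in lyG.
have EE : lebI (fun z => Gam (fun z => h z - c) z * p z) = E.
  by apply: eq_lebI => z; rewrite energyB_cst.
rewrite EE in lyG.
have Bi : (0 <= (2 * B1)^-1%:E)%E
  by rewrite lee_fin invr_ge0; exact: mulr_ge0 (ler0n R 2) (ltW B10).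
have Ke : (0 <= K%:E)%E by rewrite lee_fin ltW.
have := le_trans vle (leeD (lee_wpmul2l Bi lyG) (le_trans hc (lee_wpmul2l Ke Ql))).
rewrite -(fineK Efin) -(fineK vfin) -!(EFinM, EFinD) !lee_fin.
move: (fine E) (fine v) => e x hx.
have : (2 * B1)^-1 * (A1 * e + B1 * x) = 2^-1 * (A1 / B1 * e) + 2^-1 * x.
  by field; rewrite gt_eqF.
by move=> hb; move: hx; rewrite hb; move: (A1 / B1) => q; nra.
Qed.

End poincare_global.

(** * Exponential bound on the gradient of the Hamiltonian *)

Section gradient_bound_1d.
Variable R : realType.

(** An energy argument: [E = dphi^2 - (2 c / C) exp (C phi)] does not increase while [dphi > 0]. If
    [E 0 > 0], then going backwards in time [E] and [dphi] stay positive, so [dphi >= k] and [phi]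
    would fall below zero. Only an upper bound on the second derivative is used. *)
Lemma sqr_derive_le_pos (phi dphi ddphi : R -> R) (c C : R) : 0 < c -> 0 < C ->
  (forall t : R, is_derive t 1 phi (dphi t)) ->
  (forall t : R, is_derive t 1 dphi (ddphi t)) ->
  (forall t, 0 <= phi t) -> (forall t, ddphi t <= c * expR (C * phi t)) ->
  0 < dphi 0 -> dphi 0 ^+ 2 <= 2 * c / C * expR (C * phi 0).
Proof.
move=> c0 C0 d1 d2 phi0 ddle dphi0.
have cphi : continuous phi.
  by move=> t; apply/differentiable_continuous/derivable1_diffP; have [] := d1 t.
have cdphi : continuous dphi.
  by move=> t; apply/differentiable_continuous/derivable1_diffP; have [] := d2 t.
pose k2 := 2 * c / C.
have k20 : 0 < k2 by rewrite divr_gt0// mulr_gt0.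
pose E t := dphi t ^+ 2 - k2 * expR (C * phi t).
pose dE t := 2 * dphi t * (ddphi t - c * expR (C * phi t)).
have EE (t : R) : is_derive t 1 E (dE t).
  have h1 := d1 t; have h2 := d2 t.
  rewrite /E /dE; apply: is_derive_eq.
  rewrite /GRing.scale/= /k2; field; exact: lt0r_neq0.
have cE : continuous E.
  by move=> t; apply/differentiable_continuous/derivable1_diffP; have [] := EE t.
rewrite leNgt -subr_gt0; apply/negP; rewrite -/(E 0) => E0.
pose k := Num.sqrt k2.
have k0 : 0 < k by rewrite sqrtr_gt0.
have kk : k ^+ 2 = k2 by rewrite sqr_sqrtr// ltW.
(* Over a time [L] at speed at least [k], [phi] drops by at least [phi 0 + 1]. *)
pose L := (phi 0 + 1) / k.
have L0 : 0 < L by rewrite divr_gt0// ltr_wpDl.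
have Edphi t : dphi t = 0 -> E t <= 0.
  by move=> dt; rewrite /E dt expr0n/= sub0r oppr_le0 mulr_ge0 ?expR_ge0// ltW.
(* As long as [E > 0], [dphi] has no zero, so it keeps the sign it has at time [0]. *)
have pos_left t : t <= 0 -> (forall s, t <= s <= 0 -> 0 < E s) -> 0 < dphi t.
  move=> t0 Epos; rewrite ltNge; apply/negP => dt.
  have [s] := @IVT R dphi t 0 0 t0 (continuous_subspaceT cdphi) ltac:(by
    rewrite ge_min dt/= le_max (ltW dphi0) orbT).
  rewrite in_itv/= => /andP[ts s0] /Edphi; rewrite leNgt => /negP; apply.
  by apply: Epos; rewrite ts s0.
pose S := [set t | `[- L, 0]%classic t /\ E t <= 0].
have [S0|/set0P Sne] := eqVneq S set0.
  have Epos s : - L <= s <= 0 -> 0 < E s.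
    move=> sL; rewrite ltNge; apply/negP => Es.
    by have : S s by [split => //=; rewrite in_itv]; rewrite S0.
  have [s] := @MVT R phi dphi (- L) 0 ltac:(lra) (fun t _ => d1 t) (continuous_subspaceT cphi).
  rewrite in_itv/= => /andP[Ls s0]; rewrite sub0r opprK => hs.
  have Es : 0 < E s by apply: Epos; rewrite !ltW.
  have ds : 0 < dphi s.
    apply: pos_left; first exact: ltW.
    by move=> t /andP[st t0]; apply: Epos; rewrite t0 andbT; lra.
  have kds : k <= dphi s.
    rewrite -(@ler_sqr R) ?nnegrE ?ltW// kk.
    have : 1 <= expR (C * phi s) by rewrite -expR0 ler_expR mulr_ge0// ltW.
    by move: Es; rewrite /E; move: (expR _) => x; nra.
  have : k * L = phi 0 + 1 by rewrite /L mulrC divfK// gt_eqF.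
  have := phi0 (- L); nra.
have cS : compact S.
  apply: (@subclosed_compact _ _ `[- L, 0]%classic); [|exact: segment_compact|by move=> t []].
  have cl : closed (E @^-1` [set x | x <= 0]).
    by apply: closed_comp; [move=> t _; exact: cE|exact: closed_le].
  by apply: closedI; [exact: itv_closed|exact: cl].
have cid : {within S, continuous (@id R)}.
  by apply: continuous_subspaceT => t; exact: cvg_id.
(* [T] is the last time at which [E <= 0]. On the interval from [T] to [0] the derivative of [E] is
   nonpositive, against [E T <= 0 < E 0]. *)
have [T] := @compact_EVT_max R R id S Sne cS cid.
rewrite inE => -[/=]; rewrite in_itv/= => /andP[LT T0] ET Tmax.
have T0' : T < 0.
  by rewrite lt_neqAle T0 andbT; apply/eqP => T00; move: ET; rewrite T00 leNgt E0.
have Epos s : T < s <= 0 -> 0 < E s.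
  move=> /andP[Ts s0]; rewrite ltNge; apply/negP => Es.
  have : s \in S by rewrite inE; split => //=; rewrite in_itv/= s0 andbT; lra.
  by move=> /Tmax; rewrite leNgt Ts.
have [s] := @MVT R E dE T 0 T0' (fun t _ => EE t) (continuous_subspaceT cE).
rewrite in_itv/= => /andP[Ts s0]; rewrite sub0r => hs.
have ds : 0 < dphi s.
  apply: pos_left; first exact: ltW.
  by move=> t /andP[st t0]; apply: Epos; rewrite t0 andbT; lra.
have : dE s <= 0 by rewrite /dE pmulr_rle0 ?mulr_gt0// subr_le0.
nra.
Qed.

Lemma sqr_derive_le (phi dphi ddphi : R -> R) (c C : R) : 0 < c -> 0 < C ->
  (forall t : R, is_derive t 1 phi (dphi t)) ->
  (forall t : R, is_derive t 1 dphi (ddphi t)) ->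
  (forall t, 0 <= phi t) -> (forall t, ddphi t <= c * expR (C * phi t)) ->
  dphi 0 ^+ 2 <= 2 * c / C * expR (C * phi 0).
Proof.
move=> c0 C0 d1 d2 phi0 ddle.
have [d0|d0|d0] := ltgtP (dphi 0) 0.
- have N (f df : R -> R) : (forall t : R, is_derive t 1 f (df t)) ->
      forall t : R, is_derive t 1 (fun s => f (- s)) (- df (- t)).
    move=> df1 t; have h := df1 (- t).
    by apply: is_derive_eq; rewrite /GRing.scale/= ?mulr1 ?mulrN1 ?mulN1r.
  rewrite -[dphi 0]opprK sqrrN -{2}oppr0.
  have := @sqr_derive_le_pos (fun s => phi (- s)) (fun s => - dphi (- s))
    (fun s => ddphi (- s)) c C c0 C0 (N _ _ d1).
  rewrite !oppr0; apply.
  + move=> t; have h := N _ _ d2 t.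
    by apply: is_derive_eq; rewrite opprK.
  + by move=> t.
  + by move=> t.
  + by rewrite oppr_gt0.
- exact: (sqr_derive_le_pos _ _ d1 d2).
- by rewrite d0 expr0n/= mulr_ge0 ?expR_ge0// divr_ge0// ?mulr_ge0// ltW.
Qed.

End gradient_bound_1d.

Section gradient_bound.
Variables (R : realType) (d : nat) (U : 'rV[R]_d -> R).
Hypotheses (sU : smooth U) (U1 : forall x, 1 <= U x).
Hypothesis U_coercive : forall M : R, exists r0 : R, forall x : 'rV[R]_d,
      r0 < enorm x -> M < U x.
Hypothesis grad_H_bound : exists h : R, 0 < h /\ exists r0 : R,
      forall z : 'rV[R]_(d + d), r0 < enorm z -> h <= grad_norm (Ham U) z.
Hypothesis theta_bound : exists c C0 : R, 0 < c /\ 0 < C0 /\ exists r1 : R,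
      forall r : R, r1 <= r -> (theta U r <= (c * expR (C0 * r))%:E)%E.
Notation H := (Ham U).

Lemma local_max_partial0 n (f : 'rV[R]_n -> R) z i : (forall y, differentiable f y) ->
  nbhs z [set y | f y <= f z] -> partial i f z = 0.
Proof.
move=> df /nbhs_ballP[eps /= e0 fz].
pose phi (t : R) := f (z + t *: basis_vec R i).
have inball t : t \in `]- eps, eps[ -> phi t <= phi 0.
  rewrite in_itv/= -ltr_norml => te; rewrite {2}/phi scale0r addr0; apply: fz.
  split => // j k; rewrite /ball/= !mxE opprD addNKr normrN normrM.
  case: (_ && _); first by rewrite normr1 mulr1.
  by rewrite normr0 mulr0.
have d0 : is_derive (0 : R) 1 phi (partial i f z).
  have := @is_derive_segment R n f z (basis_vec R i) 0 (df _).
  by rewrite scale0r addr0.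
have dm : is_derive (0 : R) 1 phi 0.
  apply: (@derive1_at_max R phi (- eps) eps 0) => //; first lra.
    by move=> t _; have [] := @is_derive_segment R n f z (basis_vec R i) t (df _).
  by rewrite in_itv/=; apply/andP; split; lra.
by have [_ <-] := d0; have [_ ->] := dm.
Qed.

(** An interior point of its own sublevel set is a local maximum, hence critical. The lower bound on
    [grad_norm] thus ensures that [theta] sees every point far away. *)
Lemma boundary_sublevel z i : partial i H z != 0 -> boundary (sublevel U (H z)) z.
Proof.
move=> dz; split; first by apply: subset_closure; rewrite /sublevel/=.
move=> iz; move/eqP: dz; apply; apply: local_max_partial0 => //.
by have [] := C1_Ham sU.
Qed.

(** High values of [H] are covered by [theta], low ones by compactness. Upper bounds on the pure
    second derivatives suffice, since the gradient will be bounded one axis at a time. *)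
Lemma hessian_bound : exists c C : R, 0 < c /\ 0 < C /\
  forall i z, partial i (partial i H) z <= c * expR (C * H z).
Proof.
have [h [h0 [r0 hr0]]] := grad_H_bound.
have [c [C [c0 [C0 [r1 hr1]]]]] := theta_bound.
have cH : continuous H by exact: continuous_Ham.
have [Hm [Hm0 HHm]] := continuous_cube_bounded r0 cH.
(* [Hm] bounds [H] on the cube that contains the ball of radius [r0], so [Hm + 1 <= H z] forces [z]
   out of that ball. *)
pose R0 := Num.max r1 (Hm + 1).
have [a a0 Ha] := sublevel_cube U1 U_coercive R0.
have /choice[M hM] : forall i : 'I_(d + d), exists M : R, 0 <= M /\
    forall z, cube a z -> `|partial i (partial i H) z| <= M.
  move=> i; apply: continuous_cube_bounded.
  by have [_] := smooth_C1 (smooth_partial i (smooth_Ham sU)); exact.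
have M0 : 0 <= \sum_i M i by apply: sumr_ge0 => i _; have [] := hM i.
exists (c + \sum_i M i), C; split; first by rewrite ltr_wpDr.
split => // i z.
have eH : 1 <= expR (C * H z).
  by rewrite -expR0 ler_expR mulr_ge0 ?ltW// Ham_gt0.
rewrite mulrDl.
have [zR|zR] := leP R0 (H z).
- apply: ler_wpDr; first by rewrite mulr_ge0 ?expR_ge0.
  have [r1z Hmz] : r1 <= H z /\ Hm + 1 <= H z by move: zR; rewrite ge_max => /andP[].
  have ez : r0 < enorm z.
    rewrite ltNge; apply/negP => ez.
    suff /HHm : cube r0 z by move=> /(le_trans (ler_norm _)); lra.
    move=> k; apply: le_trans ez; rewrite /enorm -[leLHS]sqrtr_sqr ler_sqrt ?sqnorm_ge0//.
    by rewrite /sqnorm (bigD1 k)//= lerDl sumr_ge0// => j _; exact: sqr_ge0.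
  have gz := hr0 _ ez.
  have [j dj] : exists j, partial j H z != 0.
    apply: contrapT => nz; have {nz} nz j : partial j H z = 0.
      by apply: contrapT => nj; apply: nz; exists j; exact/eqP.
    have : grad_norm H z = 0.
      rewrite /grad_norm /enorm /sqnorm big1 ?sqrtr0// => k _.
      by rewrite mxE nz expr0n.
    by move=> g0; move: gz; rewrite g0; lra.
  have := hr1 _ r1z; apply: contraTT; rewrite -!ltNge => hlt.
  apply: (@lt_le_trans _ _ (`|partial i (partial i H) z|)%:E).
    by rewrite lte_fin (lt_le_trans hlt)// ler_norm.
  apply: ereal_sup_ubound; exists z, i, i; split => //.
  exact: boundary_sublevel dj.
- have az := Ha _ (ltW zR).
  have := (hM i).2 z az => Mz.
  apply: (le_trans (ler_norm _)); apply: (le_trans Mz).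
  apply: ler_wpDl; first by rewrite mulr_ge0 ?expR_ge0// ltW.
  apply: (@le_trans _ _ (\sum_i M i)); last by rewrite ler_peMr.
  by rewrite (bigD1 i)//= lerDl sumr_ge0// => j _; have [] := hM j.
Qed.

(** The one-dimensional estimate is applied to [H] along each coordinate line through [z]; the
    successor in the constant keeps it positive for [d = 0]. *)
Lemma gradient_bound : exists c C : R, 0 < c /\ 0 < C /\
  forall z, gradsq H z <= c * expR (C * H z).
Proof.
have [c [C [c0 [C0 hc]]]] := hessian_bound.
exists ((d + d).+1%:R * (2 * c / C)), C; split; first by rewrite mulr_gt0// divr_gt0// mulr_gt0.
split => // z; rewrite -mulrA.
apply: (@le_trans _ _ (\sum_(i < d + d) (2 * c / C * expR (C * H z)))); last first.
  rewrite sumr_const card_ord -[X in X <= _]mulr_natl ler_wpM2r ?ler_nat//.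
  by rewrite mulr_ge0 ?expR_ge0// divr_ge0 ?mulr_ge0// ltW.
apply: ler_sum => i _; pose e := basis_vec R i : 'rV[R]_(d + d).
have sdH := smooth_partial i (smooth_Ham sU).
have := @sqr_derive_le R (fun t => H (z + t *: e)) (fun t => partial i H (z + t *: e))
  (fun t => partial i (partial i H) (z + t *: e)) c C c0 C0.
rewrite !scale0r !addr0; apply.
- by move=> t; apply: is_derive_segment; exact: (smooth_Ham sU [::]).
- by move=> t; apply: is_derive_segment; exact: (sdH [::]).
- by move=> t; exact/ltW/Ham_gt0.
- by move=> t; exact: hc.
Qed.

End gradient_bound.

(** * The defective logarithmic Sobolev inequality *)

Section trunc.
Variables (R : realType) (s : R).
Hypothesis s0 : 0 < s.

(** A C1 truncation below height [s]: comparable to [t] once [|t| >= s], Lipschitz uniformly in [s],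
    and at most [t^2 / s] in absolute value. The last bound controls an [L^1] norm by an [L^2] norm
    with a gain [1/s]. *)
Definition soft (t : R) : R := t ^+ 3 / (s ^+ 2 + t ^+ 2).
Definition dsoft (t : R) : R :=
  (3 * s ^+ 2 * t ^+ 2 + t ^+ 4) * (((s ^+ 2 + t ^+ 2)^-1) ^+ 2).

Let den0 t : 0 < s ^+ 2 + t ^+ 2.
Proof. by rewrite ltr_pwDl ?exprn_gt0// sqr_ge0. Qed.

Lemma is_derive_soft (t : R) : is_derive t 1 soft (dsoft t).
Proof.
have dV : is_derive t 1 (fun t : R => (s ^+ 2 + t ^+ 2)^-1)
    (- (s ^+ 2 + t ^+ 2)^-1 ^+ 2 * (2 * t)).
  have dd : is_derive t 1 (fun t : R => s ^+ 2 + t ^+ 2) (2 * t).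
    by apply: is_derive_eq; rewrite /GRing.scale/=; ring.
  have := @is_derive1_comp R (fun x => x^-1) (fun t : R => s ^+ 2 + t ^+ 2) t _ _
    (is_derive_inv (lt0r_neq0 (den0 t))) dd.
  by [].
rewrite /soft /dsoft; apply: is_derive_eq.
rewrite /GRing.scale/=; field.
exact: lt0r_neq0.
Qed.

Lemma continuous_dsoft : continuous dsoft.
Proof.
move=> t; rewrite /dsoft.
have c2 : (fun t : R => t ^+ 2) x @[x --> t] --> t ^+ 2 by exact: exprn_continuous.
have c4 : (fun t : R => t ^+ 4) x @[x --> t] --> t ^+ 4 by exact: exprn_continuous.
have cd : (fun t : R => s ^+ 2 + t ^+ 2) x @[x --> t] --> s ^+ 2 + t ^+ 2.
  exact: (cvgD (cvg_cst _) c2).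
have ci : (fun t : R => (s ^+ 2 + t ^+ 2)^-1) x @[x --> t] --> (s ^+ 2 + t ^+ 2)^-1.
  by apply: cvgV => //; exact: lt0r_neq0.
exact: (cvgM (cvgD (cvgM (cvg_cst _) c2) c4) (cvgM ci ci)).
Qed.

Lemma dsoft_sq_le (t : R) : dsoft t ^+ 2 <= 4.
Proof.
have d0 := den0 t.
have h1 : 0 <= dsoft t.
  rewrite /dsoft mulr_ge0 ?sqr_ge0// addr_ge0 ?exprn_even_ge0//.
  by rewrite mulr_ge0 ?sqr_ge0// mulr_ge0 ?sqr_ge0.
have h2 : dsoft t <= 2.
  rewrite /dsoft exprVn ler_pdivrMr ?exprn_gt0//.
  have : 0 <= s ^+ 2 * t ^+ 2 by rewrite mulr_ge0 ?sqr_ge0.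
  have := sqr_ge0 (s ^+ 2); have := sqr_ge0 (t ^+ 2).
  by rewrite -!exprM/=; nra.
nra.
Qed.

Lemma soft_sq_le (t : R) : soft t ^+ 2 <= t ^+ 2.
Proof.
rewrite /soft (exprSr t 2) mulrAC exprMn ler_piMl ?sqr_ge0//.
have q0 : 0 <= t ^+ 2 / (s ^+ 2 + t ^+ 2) by rewrite divr_ge0 ?sqr_ge0// ltW.
by rewrite expr_le1// ler_pdivrMr// mul1r lerDr sqr_ge0.
Qed.

Lemma soft_abs_le (t : R) : `|soft t| <= t ^+ 2 / s.
Proof.
rewrite /soft normrM normfV (gtr0_norm (den0 t)) ler_pdivrMr// mulrAC ler_pdivlMr//.
rewrite normrX -(real_normK (num_real t)).
have := normr_ge0 t; move: `|t| => u u0.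
have h : u * s <= s ^+ 2 + u ^+ 2 by have := sqr_ge0 (u - s); nra.
by rewrite exprSr -mulrA ler_wpM2l ?sqr_ge0.
Qed.

Lemma soft_ge (t : R) : s ^+ 2 <= t ^+ 2 -> t ^+ 2 <= 4 * soft t ^+ 2.
Proof.
move=> st; rewrite /soft (exprSr t 2) mulrAC exprMn mulrA ler_peMl ?sqr_ge0//.
have d0 := den0 t.
have h : 2^-1 <= t ^+ 2 / (s ^+ 2 + t ^+ 2) by rewrite ler_pdivlMr//; lra.
nra.
Qed.

End trunc.

Section layer.
Variables (R : realType) (d : nat) (U : 'rV[R]_d -> R) (eta : R).
Hypotheses (sU : smooth U) (U1 : forall x, 1 <= U x) (eta0 : 0 <= eta).
Notation H := (Ham U).
Notation p := (gibbs U).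
Notation Gam := (energy_density U eta).
Variables (cg Cg : R).
Hypotheses (cg0 : 0 < cg) (Cg0 : 0 < Cg).
Hypothesis gradH : forall z, gradsq H z <= cg * expR (Cg * H z).

Variables (s T : R) (h : 'rV[R]_(d + d) -> R).
Hypotheses (s0 : 0 < s) (T1 : 1 <= T) (Ch : C1 h).

Definition layer z := soft s (h z) * sqpos (T - H z).

Let C1soft : C1 (fun z => soft s (h z)).
Proof.
apply: (@C1_comp R (d + d) (soft s) (dsoft s) h) => // z.
  exact: is_derive_soft.
exact: continuous_dsoft.
Qed.

Let C1arg : C1 (fun z => T - H z).
Proof.
have -> : (fun z => T - H z) = (fun z => T + H z * (-1)).
  by apply/funext => z; rewrite mulrN1.
apply: C1D; first exact: C1_cst.
by apply: C1M; [exact: C1_Ham|exact: C1_cst].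
Qed.

Lemma C1_layer : C1 layer.
Proof. by apply: C1M => //; apply: C1_sqpos. Qed.

Lemma partial_layer i z : partial i layer z =
  soft s (h z) * (- (2 * Num.max (T - H z) 0 * partial i H z)) +
  sqpos (T - H z) * (dsoft s (h z) * partial i h z).
Proof.
rewrite partialM//; last exact: C1_sqpos.
rewrite partial_sqpos//.
rewrite (@partial_comp R (d + d) (soft s) _ h i z (is_derive_soft s0 _)); last by have [] := Ch.
have -> : partial i (fun z => T - H z) z = - partial i H z.
  have -> : (fun z => T - H z) = (fun z => T + H z * (-1)).
    by apply/funext => y; rewrite mulrN1.
  rewrite partialD; [|exact: C1_cst|by apply: C1M; [exact: C1_Ham|exact: C1_cst]].
  rewrite partialM; [|exact: C1_Ham|exact: C1_cst].
  by rewrite !partial_cst mulr0 !add0r mulN1r.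
by rewrite mulrN.
Qed.

Let T_le_exp : T <= expR T.
Proof. by apply: le_trans (expR_ge1Dx T); rewrite lerDr. Qed.

Let max_bound z : H z <= T -> 0 <= Num.max (T - H z) 0 <= expR T.
Proof.
move=> zT; rewrite max_l ?subr_ge0// zT/=; apply: le_trans T_le_exp.
by have := Ham_gt0 U1 z; lra.
Qed.

Let exp_gibbs z : H z <= T -> 1 <= expR T * p z.
Proof. by move=> zT; rewrite /gibbs -expRD -expR0 ler_expR subr_ge0. Qed.

(** Two of the three factors [exp T] bound the squared cutoff in [H]; the third restores the weight,
    as [1 <= exp T * p z] where [H z <= T]. *)
Lemma layer_abs_le z : `|layer z| <= expR (3 * T) / s * (h z ^+ 2 * p z).
Proof.
have p0 : 0 <= p z by exact/ltW/gibbs_gt0.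
have [zT|/ltW zT] := leP (H z) T; last first.
  rewrite /layer /sqpos max_r ?subr_le0// expr0n/= mulr0 normr0.
  apply: mulr_ge0; first by rewrite divr_ge0 ?expR_ge0// ltW.
  by rewrite mulr_ge0 ?sqr_ge0.
rewrite /layer normrM (ger0_norm (sqr_ge0 _)) /sqpos.
have /andP[m0 mT] := max_bound zT; have pT := exp_gibbs zT.
have a := soft_abs_le s0 (h z).
have -> : expR (3 * T) / s * (h z ^+ 2 * p z) =
    (h z ^+ 2 / s) * (expR T ^+ 2 * (expR T * p z)).
  by rewrite expRM_natl; ring.
apply: ler_pM => //; first exact: sqr_ge0.
apply: (@le_trans _ _ (expR T ^+ 2)); first by rewrite lerXn2r ?nnegrE ?expR_ge0.
by rewrite ler_peMr ?sqr_ge0.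
Qed.

(** Budget of exponents: [2 eta + 1] to pass from the gradient to the weighted energy, [4] for the
    fourth power of [T - H], and [Cg] for the gradient of [H]. *)
Definition kap : R := 2 * eta + 5 + Cg.

Lemma layer_gradsq_le z :
  gradsq layer z <= 8 * (1 + cg) * expR (kap * T) * (Gam h z * p z + h z ^+ 2 * p z).
Proof.
have p0 : 0 <= p z by exact/ltW/gibbs_gt0.
have G0 : 0 <= Gam h z * p z by rewrite mulr_ge0// energy_ge0.
have h20 : 0 <= h z ^+ 2 * p z by rewrite mulr_ge0 ?sqr_ge0.
have [zT|/ltW zT] := leP (H z) T; last first.
  rewrite /gradsq big1; first by rewrite !mulr_ge0 ?expR_ge0 ?addr_ge0// ltW.
  move=> i _; rewrite partial_layer /sqpos max_r ?subr_le0//.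
  by rewrite expr0n/= mulr0 !mul0r oppr0 mulr0 addr0 expr0n.
have /andP[m0 mT] := max_bound zT; have pT := exp_gibbs zT.
set m := Num.max (T - H z) 0 in m0 mT.
have T0 : 0 <= T by exact: le_trans ler01 T1.
have eT1 : 1 <= expR T by rewrite -[leLHS]expR0 ler_expR.
(* [(a + b)^2 <= 2 a^2 + 2 b^2], with [soft^2 <= h^2] and [dsoft^2 <= 4]. *)
have b1 : gradsq layer z <= 8 * (h z ^+ 2 * m ^+ 2 * gradsq H z) + 8 * (m ^+ 4 * gradsq h z).
  rewrite /gradsq !mulr_sumr -big_split/=; apply: ler_sum => i _.
  rewrite partial_layer /sqpos -/m.
  have a1 := soft_sq_le s0 (h z); have a2 := dsoft_sq_le s0 (h z).
  set A := soft s (h z) in a1 *; set B := dsoft s (h z) in a2 *.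
  move: (partial i H z) (partial i h z) => x y.
  have e1 : (A * - (2 * m * x) + m ^+ 2 * (B * y)) ^+ 2 <=
      8 * (A ^+ 2 * (m * x) ^+ 2) + 2 * (B ^+ 2 * (m ^+ 2 * y) ^+ 2).
    by have := sqr_ge0 (A * (2 * m * x) + m ^+ 2 * (B * y)); nra.
  apply: (le_trans e1).
  have e2 : A ^+ 2 * (m * x) ^+ 2 <= h z ^+ 2 * (m * x) ^+ 2 by rewrite ler_wpM2r ?sqr_ge0.
  have e3 : B ^+ 2 * (m ^+ 2 * y) ^+ 2 <= 4 * (m ^+ 2 * y) ^+ 2 by rewrite ler_wpM2r ?sqr_ge0.
  rewrite (_ : m ^+ 4 * y ^+ 2 = (m ^+ 2 * y) ^+ 2); last by ring.
  rewrite (_ : h z ^+ 2 * m ^+ 2 * x ^+ 2 = h z ^+ 2 * (m * x) ^+ 2); last by ring.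
  lra.
have m2 : m ^+ 2 <= expR T ^+ 2 by rewrite lerXn2r ?nnegrE ?expR_ge0.
have m4 : m ^+ 4 <= expR T ^+ 4 by rewrite lerXn2r ?nnegrE ?expR_ge0.
have b2 : h z ^+ 2 * m ^+ 2 * gradsq H z <= cg * expR (kap * T) * (h z ^+ 2 * p z).
  apply: (@le_trans _ _ (h z ^+ 2 * expR T ^+ 2 * (cg * expR (Cg * T)))).
    apply: ler_pM.
    - by rewrite mulr_ge0 ?sqr_ge0.
    - exact: gradsq_ge0.
    - by rewrite ler_wpM2l ?sqr_ge0.
    - by apply: (le_trans (gradH z)); rewrite ler_pM2l// ler_expR ler_pM2l.
  have -> : cg * expR (kap * T) * (h z ^+ 2 * p z) =
      h z ^+ 2 * cg * (expR ((kap - 1) * T) * (expR T * p z)).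
    have -> : kap * T = (kap - 1) * T + T by ring.
    by rewrite expRD; ring.
  have -> : h z ^+ 2 * expR T ^+ 2 * (cg * expR (Cg * T)) =
      h z ^+ 2 * cg * expR ((Cg + 2) * T).
    by rewrite mulrDl expRD expRM_natl; ring.
  apply: ler_wpM2l; first by rewrite mulr_ge0 ?sqr_ge0// ltW.
  apply: (@le_trans _ _ (expR ((kap - 1) * T))); last by rewrite ler_peMr ?expR_ge0.
  rewrite ler_expR; apply: ler_wpM2r => //.
  rewrite -subr_ge0 (_ : _ - _ = 2 * eta + 2); last by rewrite /kap; ring.
  by rewrite addr_ge0// mulr_ge0.
have b3 : m ^+ 4 * gradsq h z <= expR (kap * T) * (Gam h z * p z).
  apply: (@le_trans _ _ (expR T ^+ 4 * (expR ((2 * eta + 1) * T) * (Gam h z * p z)))).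
    apply: ler_pM => //; [exact: exprn_ge0|exact: gradsq_ge0|].
    apply: (le_trans (gradsq_le_energy_gibbs U1 eta0 h z)).
    by rewrite ler_wpM2r// ler_expR ler_wpM2l// addr_ge0// mulr_ge0.
  rewrite mulrA; apply: ler_wpM2r => //.
  rewrite -expRM_natl -expRD ler_expR -mulrDl; apply: ler_wpM2r => //.
  rewrite -subr_ge0 (_ : _ - _ = Cg); last by rewrite /kap; ring.
  exact: ltW.
have E0 : 0 < expR (kap * T) by exact: expR_gt0.
apply: (le_trans b1).
have c1 : 0 <= cg * (expR (kap * T) * (Gam h z * p z)).
  by rewrite !mulr_ge0 ?(ltW cg0) ?(ltW E0)// energy_ge0.
have c2 : 0 <= expR (kap * T) * (h z ^+ 2 * p z) by rewrite mulr_ge0 ?(ltW E0).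
set e := expR (kap * T) in b2 b3 c1 c2 *.
set g2 := Gam h z * p z in b3 c1 *; set h2 := h z ^+ 2 * p z in b2 c2 *.
have -> : 8 * (1 + cg) * e * (g2 + h2) =
    8 * (cg * e * h2) + 8 * (e * g2) + (8 * (cg * (e * g2)) + 8 * (e * h2)) by ring.
apply: (@le_trans _ _ (8 * (cg * e * h2) + 8 * (e * g2))).
  by rewrite lerD// ler_pM2l.
by rewrite lerDl addr_ge0// mulr_ge0.
Qed.

Lemma layer_ge z : H z <= T - 1 -> s ^+ 2 <= h z ^+ 2 -> h z ^+ 2 <= 4 * layer z ^+ 2.
Proof.
move=> zT sh; apply: (le_trans (soft_ge s0 sh)).
have t1 : 1 <= T - H z by move: zT; rewrite lerBrDr => zT; rewrite lerBrDr addrC.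
have P1 : 1 <= sqpos (T - H z) ^+ 2.
  rewrite /sqpos max_l; last exact: le_trans ler01 t1.
  by rewrite -exprM expr_ge1// (le_trans ler01 t1).
have S0 : 0 <= 4 * soft s (h z) ^+ 2 by rewrite mulr_ge0 ?sqr_ge0.
have -> : layer z ^+ 2 = soft s (h z) ^+ 2 * sqpos (T - H z) ^+ 2 by exact: exprMn.
by rewrite mulrA; apply: ler_peMr.
Qed.

End layer.

(** * Summation over the layers *)

Section defective.
Variables (R : realType) (d : nat) (U : 'rV[R]_d -> R) (eta : R).
Hypotheses (sU : smooth U) (U1 : forall x, 1 <= U x) (eta0 : 0 <= eta).
Notation H := (Ham U).
Notation p := (gibbs U).
Notation Gam := (energy_density U eta).
Notation leb := (@leb R).
Notation V := (borel_rV R).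
Variables (cg Cg : R).
Hypotheses (cg0 : 0 < cg) (Cg0 : 0 < Cg).
Hypothesis gradH : forall z, gradsq H z <= cg * expR (Cg * H z).
Variables (A1 B1 : R).
Hypotheses (A10 : 0 <= A1) (B10 : 0 < B1).
Hypothesis lyap : forall h, C1 h ->
  (lebI (fun z => H z * h z ^+ 2 * p z)%R <=
   A1%:E * lebI (fun z => Gam h z * p z)%R + B1%:E * lebI (fun z => h z ^+ 2 * p z)%R)%E.

Definition lnp (x : R) : R := Num.max (ln x) 0.

Lemma lnp_ge0 x : 0 <= lnp x.
Proof. by rewrite /lnp le_max lexx orbT. Qed.

Let n := (d + d)%N.
(** The successor of the dimension is nonzero even for [d = 0], and it keeps [n / n1 <= 1] in the
    Nash scale. *)
Let n1 : R := n.+1%:R.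
(** It dominates both exponents that occur: [kap] for the gradient and [6 = 2 * 3] for the squared
    [L^1] norm. [K] is then chosen so that [exp (kap2 * Tk k)] grows only like [e^(k / (4 n1))]. *)
Let kap2 : R := kap eta Cg + 6.
Let K : R := 4 * n1 * kap2.
Let Tk (k : nat) : R := 1 + k%:R / K.
Let sk (k : nat) : R := expR (k%:R / 2).
Let q : R := expR (- (4 * n1)^-1).

Let n10 : 1 <= n1. Proof. by rewrite ler1n. Qed.
Let n1p : 0 < n1. Proof. exact: lt_le_trans n10. Qed.
Let kap_ge : 5 <= kap eta Cg.
Proof. by have := ltW Cg0; have := eta0; rewrite /kap; lra. Qed.
Let kap20 : 0 < kap2.
Proof. by have := kap_ge; rewrite /kap2; lra. Qed.
Let K0 : 0 < K. Proof. by rewrite /K !mulr_gt0. Qed.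
Let Tk1 k : 1 <= Tk k.
Proof. by rewrite /Tk lerDl divr_ge0// ltW. Qed.
Let sk0 k : 0 < sk k. Proof. exact: expR_gt0. Qed.
Let q0 : 0 < q. Proof. exact: expR_gt0. Qed.
Let q1 : q < 1.
Proof. by rewrite /q -expR0 ltr_expR oppr_lt0 invr_gt0 mulr_gt0. Qed.

Let qk k : q ^+ k = expR (- (k%:R / (4 * n1))).
Proof. by rewrite /q -expRM_natl; congr expR; rewrite mulrN. Qed.

Let expT k a : a <= kap2 -> expR (a * Tk k) <= expR kap2 * expR (k%:R / (4 * n1)).
Proof.
move=> ak; rewrite -expRD ler_expR.
apply: (@le_trans _ _ (kap2 * Tk k)).
  by apply: ler_wpM2r => //; exact: le_trans (Tk1 k).
rewrite /Tk mulrDr mulr1 lerD2l /K le_eqVlt; apply/predU1P; left.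
by field; rewrite !gt_eqF.
Qed.

Section fixed_h.
Variables (M : R) (h : 'rV[R]_(d + d) -> R).
Hypotheses (M0 : 0 < M) (Ch : C1 h).
Hypothesis hM : (lebI (fun z => h z ^+ 2 * p z)%R <= M%:E)%E.

Let lay (k : nat) := layer U (sk k) (Tk k) h.
Let E := lebI (fun z => Gam h z * p z)%R.
Let v := lebI (fun z => h z ^+ 2 * p z)%R.
Definition layer_cst : R := expR kap2 * (8 * n1 * (1 + cg) + 2 * M).

Let p0 z : 0 <= p z. Proof. exact/ltW/gibbs_gt0. Qed.
Let H0 z : 0 <= H z. Proof. exact/ltW/Ham_gt0. Qed.
Let ch : continuous h. Proof. exact: C1_continuous. Qed.
Let cp : continuous p. Proof. exact: continuous_gibbs. Qed.
Let cH : continuous H. Proof. exact: continuous_Ham. Qed.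
Let mG : meas (fun z => Gam h z * p z).
Proof.
have cE : continuous (Gam h) by exact: continuous_energy.
by apply: cont_meas => z; exact: (cvgM (cE z) (@cp z)).
Qed.
Let mh2 : meas (fun z => h z ^+ 2 * p z).
Proof. by apply: cont_meas => z; exact: (cvgM (cvgM (@ch z) (@ch z)) (@cp z)). Qed.
Let mHh : meas (fun z => H z * h z ^+ 2 * p z).
Proof. by apply: cont_meas => z; exact: (cvgM (cvgM (@cH z) (cvgM (@ch z) (@ch z))) (@cp z)). Qed.
Let G0 z : 0 <= Gam h z * p z. Proof. by rewrite mulr_ge0// energy_ge0. Qed.
Let h20 z : 0 <= h z ^+ 2 * p z. Proof. by rewrite mulr_ge0 ?sqr_ge0. Qed.
Let E0 : (0 <= E)%E. Proof. exact: lebI_ge0. Qed.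
Let v0 : (0 <= v)%E. Proof. exact: lebI_ge0. Qed.

Lemma layer_integral k :
  (lebI (fun z => lay k z ^+ 2)%R <= (layer_cst * q ^+ k)%:E * (E + v))%E.
Proof.
have Cl : C1 (lay k) by exact: C1_layer.
pose sg : R := expR (- (k%:R / (2 * n1))).
have sg0 : 0 < sg by exact: expR_gt0.
have k0 : 0 <= k%:R :> R by exact: ler0n.
have x0 : 0 <= k%:R / n1 by rewrite divr_ge0// ltW.
have xk : k%:R / n1 <= k%:R by rewrite ler_pdivrMr// ler_peMr.
have e4 : k%:R / (4 * n1) = (k%:R / n1) / 4 by field; rewrite gt_eqF.
have e2 : k%:R / (2 * n1) = (k%:R / n1) / 2 by field; rewrite gt_eqF.
apply: (le_trans (nash sg0 Cl)).
have t1 : (lebI (gradsq (lay k)) <= (8 * (1 + cg) * expR (kap eta Cg * Tk k))%:E * (E + v))%E.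
  rewrite -lebID//.
  rewrite -lebIZ; [|exact: measD|by move=> z; rewrite addr_ge0
    |by rewrite mulr_ge0 ?expR_ge0// mulr_ge0// addr_ge0// ltW].
  apply: le_lebI.
  - by apply: cont_meas; exact: gradsq_continuous.
  - by apply: measM; [exact: meas_cst|exact: measD].
  - exact: gradsq_ge0.
  - by move=> z; exact: layer_gradsq_le.
have t2 : (lebI (fun z => `|lay k z|)%R <= (expR (3 * Tk k) / sk k)%:E * v)%E.
  rewrite -lebIZ//; last by rewrite divr_ge0 ?expR_ge0.
  apply: le_lebI => //.
  - have mC := cont_meas (C1_continuous Cl).
    exact: (measurableT_comp (@normr_measurable R setT) mC).
  - by apply: measM; [exact: meas_cst|].
  - by move=> z; exact: layer_abs_le.
have vfin : v \is a fin_num by rewrite ge0_fin_numE// (le_lt_trans hM)// ltry.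
(* In units of [k / n1], Nash gains [1] and the degeneracy costs [1/4], so more than the rate [1/4]
   of [q] is left. *)
have c1 : n%:R * sg ^+ 2 * (8 * (1 + cg) * expR (kap eta Cg * Tk k)) <=
    expR kap2 * (8 * n1 * (1 + cg)) * q ^+ k.
  have a1 := @expT k (kap eta Cg) ltac:(by rewrite /kap2; lra).
  have nn : n%:R <= n1 by rewrite ler_nat.
  have sgq : sg ^+ 2 * expR (k%:R / (4 * n1)) <= q ^+ k.
    rewrite qk /sg -expRM_natl -expRD ler_expR e4 e2.
    by move: x0; move: (k%:R / n1) => x; lra.
  have cg1 : 0 <= 8 * (1 + cg) by rewrite mulr_ge0// addr_ge0// ltW.
  apply: (@le_trans _ _ (n1 * sg ^+ 2 * (8 * (1 + cg) * (expR kap2 * expR (k%:R / (4 * n1)))))).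
    apply: ler_pM => //.
    - by rewrite mulr_ge0 ?sqr_ge0.
    - by rewrite mulr_ge0 ?expR_ge0.
    - by rewrite ler_wpM2r ?sqr_ge0.
    - by rewrite ler_wpM2l.
  have -> : n1 * sg ^+ 2 * (8 * (1 + cg) * (expR kap2 * expR (k%:R / (4 * n1)))) =
     expR kap2 * (8 * n1 * (1 + cg)) * (sg ^+ 2 * expR (k%:R / (4 * n1))) by ring.
  by rewrite ler_wpM2l// mulr_ge0 ?expR_ge0// mulr_ge0 ?mulr_ge0// ?addr_ge0// ltW.
(* The small volume costs at most [e^(k/2)], the truncation gains [e^(-k)], the degeneracy costs
   [e^(k / (4 n1))]; since [n1 >= 1], at most [q^k] remains. *)
have c2 : 2 / (2 * sg) ^+ n * ((expR (3 * Tk k) / sk k) ^+ 2 * M) <=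
    expR kap2 * (2 * M) * q ^+ k.
  have a1 := @expT k 6 ltac:(by have := kap_ge; rewrite /kap2; lra).
  have s2n : expR (- (k%:R / 2)) <= (2 * sg) ^+ n.
    apply: (@le_trans _ _ (sg ^+ n)); last first.
      by rewrite lerXn2r ?nnegrE ?mulr_ge0 ?(ltW sg0)//; have := ltW sg0; lra.
    rewrite /sg -expRM_natl ler_expR e2 mulrN lerN2.
    have : n%:R * (k%:R / n1) <= k%:R.
      by rewrite mulrA ler_pdivrMr// mulrC ler_wpM2l// ler_nat.
    by rewrite !mulrA; move: (n%:R * k%:R / n1) => x; lra.
  have s2n0 : 0 < (2 * sg) ^+ n by rewrite exprn_gt0// mulr_gt0.
  have i1 : ((2 * sg) ^+ n)^-1 <= expR (k%:R / 2).
    by rewrite -[leRHS]invrK -expRN lef_pV2 ?posrE ?expR_gt0.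
  have -> : (expR (3 * Tk k) / sk k) ^+ 2 = expR (6 * Tk k) * expR (- k%:R).
    by rewrite /sk -expRN -expRD -expRM_natl -expRD; congr expR; lra.
  apply: (@le_trans _ _ (2 * expR (k%:R / 2) *
      (expR kap2 * expR (k%:R / (4 * n1)) * expR (- k%:R) * M))).
    apply: ler_pM.
    - by rewrite divr_ge0// ltW.
    - by rewrite mulr_ge0 ?mulr_ge0 ?expR_ge0// ltW.
    - by rewrite ler_pM2l.
    - by rewrite ler_pM2r// ler_pM2r ?expR_gt0.
  have -> : 2 * expR (k%:R / 2) * (expR kap2 * expR (k%:R / (4 * n1)) * expR (- k%:R) * M) =
     expR kap2 * (2 * M) * (expR (k%:R / 2) * expR (k%:R / (4 * n1)) * expR (- k%:R)) by ring.
  rewrite ler_wpM2l ?mulr_ge0 ?expR_ge0// ?(ltW M0)//.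
  rewrite qk -!expRD ler_expR e4.
  by move: x0 xk; move: (k%:R / n1) => x; lra.
have ab0 : (0 <= lebI (fun z => `|lay k z|)%R)%E by exact: lebI_ge0.
(* The squared [L^1] norm is quadratic in [v]; one factor is replaced by [M] to keep the estimate
   linear. *)
have t3 : (lebI (fun z => `|lay k z|)%R * lebI (fun z => `|lay k z|)%R <=
    ((expR (3 * Tk k) / sk k) ^+ 2 * M)%:E * v)%E.
  apply: (le_trans (lee_pmul ab0 ab0 t2 t2)).
  move: hM; rewrite -/v -(fineK vfin) -!EFinM !lee_fin => vM.
  have fv0 : 0 <= fine v by exact: fine_ge0.
  have -> : expR (3 * Tk k) / sk k * fine v * (expR (3 * Tk k) / sk k * fine v) =
    (expR (3 * Tk k) / sk k) ^+ 2 * (fine v * fine v) by ring.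
  by rewrite -[leRHS]mulrA; apply: ler_wpM2l; [exact: sqr_ge0|exact: ler_wpM2r].
have n2 : (0 <= (n%:R * sg ^+ 2)%:E)%E by rewrite lee_fin mulr_ge0 ?sqr_ge0.
have s2 : (0 <= (2 / (2 * sg) ^+ n)%:E)%E.
  by rewrite lee_fin divr_ge0// exprn_ge0// mulr_ge0// ltW.
apply: (le_trans (leeD (lee_wpmul2l n2 t1) (lee_wpmul2l s2 t3))).
rewrite !muleA -!EFinM.
apply: (@le_trans _ _ ((expR kap2 * (8 * n1 * (1 + cg)) * q ^+ k)%:E * (E + v) +
   (expR kap2 * (2 * M) * q ^+ k)%:E * (E + v))%E).
  apply: leeD; first by rewrite lee_wpmul2r ?lee_fin// adde_ge0.
  apply: lee_pmul => //.
  - rewrite lee_fin; apply: mulr_ge0.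
      by rewrite divr_ge0// exprn_ge0// mulr_ge0// ltW.
    by apply: mulr_ge0; [exact: sqr_ge0|exact: ltW].
  - by rewrite leeDr.
rewrite -ge0_muleDl -?EFinD; last 2 first.
- rewrite lee_fin; apply: mulr_ge0; last exact/exprn_ge0/ltW.
  by rewrite mulr_ge0 ?expR_ge0// mulr_ge0 ?mulr_ge0// ?addr_ge0// ltW.
- rewrite lee_fin; apply: mulr_ge0; last exact/exprn_ge0/ltW.
  by rewrite mulr_ge0 ?expR_ge0// mulr_ge0// ltW.
by rewrite /layer_cst -!mulrDl -mulrDr.
Qed.

(** A counting argument: every integer [k] from about [K H] up to [ln h^2] satisfies
    [h^2 <= 4 lay k ^ 2], and at least [ln h^2 - K H - 1] such [k] exist. The stray [1] is absorbed
    through [1 <= H]. *)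
Lemma layers_pointwise z : exists N : nat,
  h z ^+ 2 * lnp (h z ^+ 2) <=
  (K + 1) * (H z * h z ^+ 2) + \sum_(k < N) 4 * lay k z ^+ 2.
Proof.
have Hz1 := Ham_ge1 U1 z; have h2 := sqr_ge0 (h z).
have S0 N : 0 <= \sum_(k < N) 4 * lay k z ^+ 2.
  by apply: sumr_ge0 => k _; rewrite mulr_ge0 ?sqr_ge0.
have KH0 : 0 <= K * H z by rewrite mulr_ge0// ltW.
have [l0|l0] := leP (ln (h z ^+ 2)) 0.
  exists 0%N; rewrite /lnp max_r// mulr0 addr_ge0// mulr_ge0 ?addr_ge0 ?(ltW K0)//.
  by rewrite mulr_ge0.
have hp : 0 < h z ^+ 2.
  by rewrite lt_neqAle h2 andbT; apply/eqP => hz; move: l0; rewrite -hz ln0// ltxx.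
set l := ln (h z ^+ 2) in l0 *.
rewrite /lnp max_l ?(ltW l0)//.
(* [k < N] means [k <= l], and [m] is the first integer above [K H]. *)
pose N := (Num.truncn l).+1; pose m := (Num.truncn (K * H z)).+1.
exists N.
have lN : l < N%:R by exact: truncnS_gt.
have mK : m%:R <= K * H z + 1.
  by rewrite /m -natr1 lerD2r truncn_le.
have big : (N - m)%:R * h z ^+ 2 <= \sum_(k < N) 4 * lay k z ^+ 2.
  have -> : (N - m)%:R * h z ^+ 2 = \sum_(m <= k < N) h z ^+ 2.
    by rewrite sumr_const_nat mulr_natl.
  rewrite -(big_mkord xpredT (fun k => 4 * lay k z ^+ 2)).
  have [mN|Nm] := leqP m N; last first.
    have -> : \sum_(m <= k < N) h z ^+ 2 = 0 by apply: big_geq; exact: ltnW.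
    by apply: sumr_ge0 => k _; rewrite mulr_ge0 ?sqr_ge0.
  rewrite [leRHS](big_cat_nat (n := m))//=.
  apply: ler_wpDl; first by apply: sumr_ge0 => k _; rewrite mulr_ge0 ?sqr_ge0.
  apply: ler_sum_nat => k /andP[mk kN].
  apply: layer_ge => //.
    rewrite /Tk addrAC subrr add0r ler_pdivlMr// mulrC.
    by apply: (le_trans (ltW (truncnS_gt _))); rewrite ler_nat.
  rewrite /sk -expRM_natl mulrC divfK// -[leRHS](lnK (x := h z ^+ 2)) ?posrE// ler_expR.
  apply: (@le_trans _ _ (Num.truncn l)%:R); first by rewrite ler_nat -ltnS.
  by rewrite truncn_le ltW.
(* Subtraction of naturals is truncated at zero, which only helps here. *)
have Nm : N%:R - m%:R <= (N - m)%:R :> R.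
  have [mN|/ltnW Nm] := leqP m N; first by rewrite natrB.
  by rewrite (eqP Nm : (N - m = 0)%N) subr_le0 ler_nat.
apply: (@le_trans _ _ ((K * H z + 1 + (N - m)%:R) * h z ^+ 2)).
  rewrite mulrC ler_wpM2r//; apply: (le_trans (ltW lN)).
  by rewrite -[N%:R](subrK m%:R) addrC lerD.
rewrite mulrDl; apply: lerD => //.
rewrite mulrA ler_wpM2r// mulrDl mul1r lerD2l//.
Qed.

Lemma geometric_le N : \sum_(k < N) q ^+ k <= (1 - q)^-1.
Proof.
have q1' : 0 < 1 - q by rewrite subr_gt0.
rewrite -[leRHS]mul1r ler_pdivlMr//.
have -> : (\sum_(k < N) q ^+ k) * (1 - q) = 1 - q ^+ N.
  elim: N => [|N IH]; first by rewrite big_ord0 mul0r expr0 subrr.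
  by rewrite big_ord_recr/= mulrDl IH exprSr; ring.
by rewrite lerBlDr lerDl exprn_ge0// ltW.
Qed.

Definition def_cst : R := 4 * (layer_cst * (1 - q)^-1).

Lemma layer_cst_gt0 : 0 < layer_cst.
Proof.
by rewrite mulr_gt0 ?expR_gt0// addr_gt0 ?mulr_gt0// addr_gt0.
Qed.

Lemma def_cst_gt0 : 0 < def_cst.
Proof.
apply: mulr_gt0 => //; apply: mulr_gt0; first exact: layer_cst_gt0.
by rewrite invr_gt0 subr_gt0.
Qed.

Lemma defective_fixed :
  (lebI (fun z => h z ^+ 2 * lnp (h z ^+ 2) * p z)%R <=
   ((K + 1) * A1 + def_cst)%:E * E + ((K + 1) * B1 + def_cst)%:E * v)%E.
Proof.
have K1 : 0 <= K + 1 by rewrite addr_ge0// ltW.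
have ml k : meas (fun z => 4 * lay k z ^+ 2).
  have cl : continuous (lay k) by apply: C1_continuous; exact: C1_layer.
  by apply: cont_meas => z; exact: (cvgM (cvg_cst _) (cvgM (cl z) (cl z))).
have l0 k z : 0 <= 4 * lay k z ^+ 2 by rewrite mulr_ge0 ?sqr_ge0.
have Hh0 z : 0 <= H z * h z ^+ 2 * p z by rewrite mulr_ge0// mulr_ge0 ?sqr_ge0.
have mlnp : meas (fun z => h z ^+ 2 * lnp (h z ^+ 2) * p z).
  have mh : meas h by exact: cont_meas.
  have mp : meas p by exact: cont_meas.
  have mh2' : meas (fun z => h z ^+ 2) by exact: measM.
  apply: measM => //; apply: measM => //.
  apply: measurable_maxr; last exact: measurable_cst.
  exact: (measurableT_comp (@measurable_ln R) mh2').
(* The number of layers needed depends on [z], so the whole series is integrated, with extended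
   values. *)
pose S (z : V n) : \bar R := (\sum_(k <oo) (4 * lay k z ^+ 2)%:E)%E.
have mS : measurable_fun setT S.
  apply: ge0_emeasurable_sum => //= k; first by move=> z _ _; rewrite lee_fin.
  by move=> _; apply/measurable_EFinP; exact: ml.
have S0 z : (0 <= S z)%E by apply: nneseries_ge0 => k _ _; rewrite lee_fin.
have mK : meas (fun z => (K + 1) * (H z * h z ^+ 2 * p z)).
  by apply: measM; [exact: meas_cst|].
apply: (@le_trans _ _ (\int[leb n]_z (((K + 1) * (H z * h z ^+ 2 * p z))%:E + S z))%E).
  apply: integral_leb_le.
  - exact/measurable_EFinP.
  - by apply: emeasurable_funD => //; exact/measurable_EFinP.
  - by move=> z; rewrite lee_fin mulr_ge0// mulr_ge0 ?sqr_ge0// lnp_ge0.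
  - move=> z; have [N hN] := layers_pointwise z.
    apply: (@le_trans _ _ (((K + 1) * (H z * h z ^+ 2 * p z))%:E +
        \sum_(0 <= k < N) (4 * lay k z ^+ 2)%:E)%E); last first.
      rewrite leeD2l//.
      by apply: nneseries_lim_ge => k _ _; rewrite lee_fin.
    rewrite big_mkord sumEFin -EFinD lee_fin.
    apply: (le_trans (ler_wpM2r (p0 z) hN)).
    have SN0 : 0 <= \sum_(k < N) 4 * lay k z ^+ 2 by exact: sumr_ge0.
    rewrite mulrDl; apply: lerD; first by rewrite -!mulrA.
    (* The layers are integrated against Lebesgue measure itself, so the weight [p <= 1] is
       dropped. *)
    by rewrite ler_piMr// gibbs_le1.
rewrite ge0_integralD//; last 2 first.
- by move=> z _; rewrite lee_fin mulr_ge0.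
- exact/measurable_EFinP.
have -> : (\int[leb n]_z ((K + 1) * (H z * h z ^+ 2 * p z))%:E =
    (K + 1)%:E * lebI (fun z => H z * h z ^+ 2 * p z)%R)%E by exact: lebIZ.
have SE : (\int[leb n]_z S z <= def_cst%:E * (E + v))%E.
  rewrite integral_nneseries//; last 2 first.
  - by move=> k; apply/measurable_EFinP; exact: ml.
  - by move=> k z _; rewrite lee_fin.
  apply: lime_le.
    by apply: is_cvg_nneseries => k _ _; apply: integral_ge0 => z _; rewrite lee_fin.
  apply: nearW => N; rewrite big_mkord.
  apply: (@le_trans _ _ (\sum_(k < N) (4 * layer_cst * q ^+ k)%:E * (E + v))%E).
    apply: lee_sum => k _.
    have -> : (\int[leb n]_z (4 * lay k z ^+ 2)%:E = 4%:E * lebI (fun z => lay k z ^+ 2)%R)%E.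
      apply: lebIZ => //; last by move=> z; exact: sqr_ge0.
      have cl : continuous (lay k) by apply: C1_continuous; exact: C1_layer.
      by apply: cont_meas => z; exact: (cvgM (cl z) (cl z)).
    by rewrite -mulrA EFinM -muleA lee_wpmul2l// layer_integral.
  rewrite -ge0_sume_distrl; last first.
    by move=> k _; rewrite lee_fin mulr_ge0 ?exprn_ge0 ?(ltW q0)// mulr_ge0// ltW// layer_cst_gt0.
  apply: lee_wpmul2r; first exact: adde_ge0.
  rewrite sumEFin lee_fin -mulr_sumr /def_cst [leRHS]mulrA; apply: ler_wpM2l.
    by rewrite mulr_ge0// ltW// layer_cst_gt0.
  exact: geometric_le.
have K1e : (0 <= (K + 1)%:E)%E by rewrite lee_fin.
apply: (le_trans (leeD (lee_wpmul2l K1e (lyap Ch)) SE)).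
rewrite -/E -/v.
have A1e : (0 <= ((K + 1) * A1)%:E)%E by rewrite lee_fin mulr_ge0.
have B1e : (0 <= ((K + 1) * B1)%:E)%E by rewrite lee_fin mulr_ge0// ltW.
have De : (0 <= def_cst%:E)%E by rewrite lee_fin ltW// def_cst_gt0.
have -> : (((K + 1) * A1 + def_cst)%:E * E = ((K + 1) * A1)%:E * E + def_cst%:E * E)%E.
  by rewrite EFinD ge0_muleDl.
have -> : (((K + 1) * B1 + def_cst)%:E * v = ((K + 1) * B1)%:E * v + def_cst%:E * v)%E.
  by rewrite EFinD ge0_muleDl.
have A1E : (0 <= A1%:E * E)%E by rewrite mule_ge0// lee_fin.
have B1v : (0 <= B1%:E * v)%E by rewrite mule_ge0// lee_fin ltW.
by rewrite (ge0_muleDr _ A1E B1v) (ge0_muleDr _ E0 v0) !muleA -!EFinM addeACA.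
Qed.

End fixed_h.

(** The inequality is not homogeneous, so [M] fixes the scale, and the constants depend on [h] only
    through it. It will be used with [M = Z] for both [g] and [g - c]. *)
Lemma defective_log_sobolev (M : R) : 0 < M -> exists A B : R, 0 < A /\ 0 < B /\
  forall h, C1 h -> (lebI (fun z => h z ^+ 2 * p z)%R <= M%:E)%E ->
  (lebI (fun z => h z ^+ 2 * lnp (h z ^+ 2) * p z)%R <=
   A%:E * lebI (fun z => Gam h z * p z)%R + B%:E * lebI (fun z => h z ^+ 2 * p z)%R)%E.
Proof.
move=> M0; exists ((K + 1) * A1 + def_cst M), ((K + 1) * B1 + def_cst M).
have D0 := def_cst_gt0 M0.
have K1 : 0 <= K + 1 by rewrite addr_ge0// ltW.
split; first by rewrite ltr_wpDl// mulr_ge0.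
split; first by rewrite ltr_wpDl// mulr_ge0// ltW.
by move=> h Ch hM; exact: defective_fixed.
Qed.
End defective.

(** * Tightening *)

Section pointwise_log.
Variable R : realType.

Lemma lnp_mono (x y : R) : 0 < x -> x <= y -> lnp x <= lnp y.
Proof.
move=> x0 xy; rewrite /lnp ge_max; apply/andP; split; last exact: lnp_ge0.
by rewrite le_max ler_ln ?posrE ?xy// (lt_le_trans x0).
Qed.

Lemma ln_le_lnp (x : R) : ln x <= lnp x.
Proof. by rewrite /lnp le_max lexx. Qed.

Lemma ln_le_sub1 (x : R) : 0 < x -> ln x <= x - 1.
Proof.
move=> x0; rewrite -{1}(subrK 1 x) addrC; apply: le_ln1Dx; lra.
Qed.

Lemma ln4_le3 : ln (4 : R) <= 3.
Proof. by apply: le_trans (ln_le_sub1 _) _ => //; lra. Qed.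

Lemma lnp4_le (x : R) : 0 < x -> lnp (4 * x) <= 3 + lnp x.
Proof.
move=> x0; rewrite {1}/lnp ge_max; apply/andP; split; last by rewrite addr_ge0// lnp_ge0.
by rewrite lnM ?posrE// lerD ?ln4_le3 ?ln_le_lnp.
Qed.

(** The left side vanishes to second order at [x = 1] and grows like [u^2 ln u^2]. For small [u],
    [ln (x^2) <= 2 u] leaves [u^2 (3 + 2 u)]; for large [u], [x^2 <= 4 u^2]. *)
Lemma entropy_quadratic_le (x : R) : x ^+ 2 * ln (x ^+ 2) - x ^+ 2 + 1 <=
  12 * ((x - 1) ^+ 2 + (x - 1) ^+ 2 * lnp ((x - 1) ^+ 2)).
Proof.
set u := x - 1; have xu : x = 1 + u by rewrite /u addrC subrK.
have u2 := sqr_ge0 u; have x2 := sqr_ge0 x.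
have L0 : 0 <= u ^+ 2 * lnp (u ^+ 2) by rewrite mulr_ge0// lnp_ge0.
have [u1|u1] := leP (u ^+ 2) 1.
  have [x0|x0] := ltP 0 x; last first.
    (* A nonpositive [x] within distance [1] of [1] can only be [0], where [0 * ln 0 = 0]. *)
    have {}x0 : x = 0 by nra.
    have {}xu : u = -1 by lra.
    by rewrite x0 xu expr0n/= mul0r sqrrN expr1n; move: L0; rewrite xu sqrrN expr1n; lra.
  have lx : ln (x ^+ 2) <= 2 * u.
    by rewrite lnXn// mulr2n; have := ln_le_sub1 x0; rewrite -/u; lra.
  have : x ^+ 2 * ln (x ^+ 2) <= x ^+ 2 * (2 * u) by rewrite ler_wpM2l.
  have u1' : u <= 1 by nra.
  have : u ^+ 2 * (3 + 2 * u) <= 5 * u ^+ 2 by nra.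
  by rewrite {2 4}xu; nra.
have [x1|x1] := leP (x ^+ 2) 1.
  have : x ^+ 2 * ln (x ^+ 2) <= 0 by rewrite mulr_ge0_le0// ln_le0.
  by lra.
have xle : x ^+ 2 <= 4 * u ^+ 2.
  by rewrite xu; have := sqr_ge0 (u - 1); have := sqr_ge0 (3 * u + 1); nra.
have up : 0 < u ^+ 2 by apply: lt_trans u1.
have xp : 0 < x ^+ 2 by apply: lt_trans x1.
have l1 : ln (x ^+ 2) <= 3 + lnp (u ^+ 2).
  by apply: le_trans (lnp4_le up); apply: (le_trans (ln_le_lnp _)); exact: lnp_mono.
have l0 : 0 <= ln (x ^+ 2) by rewrite ln_ge0// ltW.
have : x ^+ 2 * ln (x ^+ 2) <= 4 * u ^+ 2 * (3 + lnp (u ^+ 2)).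
  by apply: ler_pM.
have Lp := lnp_ge0 (u ^+ 2).
by move: L0; move: (lnp _) Lp (ln _) => L Lp l; nra.
Qed.

(** The previous bound rescaled by [g = c x]. The lower bound on [c^2] gives
    [(x - 1)^2 <= 4 (g - c)^2], whose logarithm costs at most [3], whence [48 = 12 * 4]. Since
    [g^2 p] and [p] have the same mass [Z], the last bracket integrates to
    [(1 + ln c^2 - c^2) Z <= 0]. *)
Lemma entropy_shift_le (g c : R) : 4^-1 <= c ^+ 2 ->
  g ^+ 2 * ln (g ^+ 2) <=
  48 * ((g - c) ^+ 2 + (g - c) ^+ 2 * lnp ((g - c) ^+ 2)) +
  ((1 + ln (c ^+ 2)) * g ^+ 2 - c ^+ 2).
Proof.
move=> c4; have cp : 0 < c ^+ 2 by apply: lt_le_trans c4.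
have c0 : c != 0 by apply: contraTneq cp => ->; rewrite expr0n/= ltxx.
pose x := g / c; have gE : g = c * x by rewrite /x mulrC divfK.
have hE : (g - c) ^+ 2 = c ^+ 2 * (x - 1) ^+ 2 by rewrite gE; ring.
have main := entropy_quadratic_le x.
have E : g ^+ 2 * ln (g ^+ 2) - ((1 + ln (c ^+ 2)) * g ^+ 2 - c ^+ 2) =
    c ^+ 2 * (x ^+ 2 * ln (x ^+ 2) - x ^+ 2 + 1).
  have [x0|x0] := eqVneq x 0; first by rewrite gE x0 mulr0 expr0n/=; ring.
  have xp : 0 < x ^+ 2 by rewrite lt_neqAle sqr_ge0 eq_sym sqrf_eq0 x0.
  by rewrite gE exprMn lnM ?posrE//; ring.
rewrite -lerBlDr E; apply: (le_trans (ler_wpM2l (ltW cp) main)).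
have u2 := sqr_ge0 (x - 1).
have [u0|u0] := eqVneq ((x - 1) ^+ 2) 0.
  by rewrite hE u0 !(mulr0, mul0r, addr0).
have up : 0 < (x - 1) ^+ 2 by rewrite lt_neqAle u2 eq_sym u0.
have l : lnp ((x - 1) ^+ 2) <= 3 + lnp ((g - c) ^+ 2).
  apply: (@le_trans _ _ (lnp (4 * (g - c) ^+ 2))); last first.
    by apply: lnp4_le; rewrite hE mulr_gt0.
  apply: lnp_mono => //; rewrite hE mulrA ler_peMl//; lra.
have h20 := sqr_ge0 (g - c); have L0 := lnp_ge0 ((g - c) ^+ 2).
have -> : c ^+ 2 * (12 * ((x - 1) ^+ 2 + (x - 1) ^+ 2 * lnp ((x - 1) ^+ 2))) =
   12 * ((g - c) ^+ 2 + (g - c) ^+ 2 * lnp ((x - 1) ^+ 2)) by rewrite hE; ring.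
have : (g - c) ^+ 2 * lnp ((x - 1) ^+ 2) <= (g - c) ^+ 2 * (3 + lnp ((g - c) ^+ 2)).
  by rewrite ler_wpM2l.
by move: (lnp ((x - 1) ^+ 2)) (lnp ((g - c) ^+ 2)) L0 => a b b0; nra.
Qed.

Lemma abs_xlnx_le (x : R) : 0 <= x -> `|x * ln x| <= x * lnp x + 1.
Proof.
rewrite le_eqVlt => /predU1P[<-|x0]; first by rewrite !mul0r normr0 add0r.
have L0 : 0 <= x * lnp x by rewrite mulr_ge0 ?lnp_ge0// ltW.
rewrite ler_norml; apply/andP; split; last first.
  have := ler_wpM2l (ltW x0) (ln_le_lnp x); lra.
have : - ln x <= x^-1 - 1 by rewrite -lnV ?posrE//; apply: ln_le_sub1; rewrite invr_gt0.
move=> /(ler_wpM2l (ltW x0)); rewrite mulrBr mulfV ?gt_eqF// mulrN mulr1; lra.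
Qed.

End pointwise_log.

(** Here [e] is the energy, [x] the variance around [c], [y] the logarithmic integral of [g - c],
    and [k], [l] stand for [c^2] and [ln (c^2)]. *)
Lemma combine_constants (R : realType) (A B C e x y Z l k : R) :
  0 < Z -> 0 < A -> 0 < B -> 0 < C -> 0 <= e ->
  y <= A * e + B * x -> x <= C * e -> l <= k - 1 ->
  48 * (x + y) + ((1 + l) * Z - k * Z) <=
  (A + 4 * (B * C) + 48 * (C + (A + B * C))) * e.
Proof.
move=> Z0 A0 B0 C0 e0 yle xle lk.
have h1 : (1 + l) * Z - k * Z <= 0 by rewrite -mulrBl pmulr_lle0//; lra.
have h2 : B * x <= B * C * e by rewrite -mulrA ler_pM2l.
have h3 : 0 <= A * e by rewrite mulr_ge0// ltW.
have h4 : 0 <= B * C * e by rewrite mulr_ge0// mulr_ge0// ltW.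
have -> : (A + 4 * (B * C) + 48 * (C + (A + B * C))) * e =
    A * e + 4 * (B * C * e) + 48 * (C * e + (A * e + B * C * e)) by ring.
move: (A * e) (C * e) (B * C * e) (B * x) ((1 + l) * Z - k * Z) xle yle h1 h2 h3 h4.
by move=> *; lra.
Qed.

Section integral_comparison.
Variables (R : realType) (n : nat).
Notation leb := (@leb R).

Lemma lebI_integrable (f : 'rV[R]_n -> R) : meas f -> (forall z, 0 <= f z) ->
  (lebI f < +oo)%E -> (leb n).-integrable setT (fun z => (f z)%:E).
Proof.
move=> mf f0 fi; apply/integrableP; split; first exact/measurable_EFinP.
rewrite (_ : integral _ _ _ = lebI f)//.
by apply: eq_integral => z _; rewrite gee0_abs// lee_fin.
Qed.

Lemma lebI_le_comb (f a q u p : 'rV[R]_n -> R) (k k1 k2 : R) :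
  (leb n).-integrable setT (fun z => (f z)%:E) ->
  (leb n).-integrable setT (fun z => (a z)%:E) ->
  (leb n).-integrable setT (fun z => (q z)%:E) ->
  (leb n).-integrable setT (fun z => (u z)%:E) ->
  (leb n).-integrable setT (fun z => (p z)%:E) ->
  (forall z, f z <= k * (a z + q z) + (k1 * u z - k2 * p z)) ->
  (lebI f <= k%:E * (lebI a + lebI q) + (k1%:E * lebI u - k2%:E * lebI p))%E.
Proof.
move=> intf inta intq intu intp fle.
have i1 := integrableZl measurableT k (integrableD measurableT inta intq).
have i3 := integrableZl measurableT k1 intu.
have i4 := integrableZl measurableT k2 intp.
have i2 := integrableB measurableT i3 i4.
rewrite /lebI -(integralD measurableT inta intq).
rewrite -(integralZl measurableT (integrableD measurableT inta intq)).
rewrite -(integralZl measurableT intu) -(integralZl measurableT intp).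
rewrite -(integralB measurableT i3 i4) -(integralD measurableT i1 i2).
apply: (le_integral measurableT intf (integrableD measurableT i1 i2)) => z _.
by rewrite -!(EFinM, EFinD, EFinB) lee_fin.
Qed.

End integral_comparison.

Theorem theorem2 (R : realType) (d : nat) (U : 'rV[R]_d -> R) (eta : R)
  (* standing assumptions on U *)
  (U_smooth : smooth U)
  (U_ge1 : forall x, 1 <= U x)
  (U_int : (leb_int (fun x => expR (- U x)) < +oo)%E)
  (eta_ge0 : 0 <= eta)
  (* U goes to infinity at infinity *)
  (U_coercive : forall M : R, exists r0 : R, forall x : 'rV[R]_d,
      r0 < enorm x -> M < U x)
  (* |grad H| >= h > 0 outside a large ball of R^{2d} *)
  (grad_H_bound : exists h : R, 0 < h /\ exists r0 : R,
      forall z : 'rV[R]_(d + d), r0 < enorm z -> h <= grad_norm (Ham U) z)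
  (* theta(r) <= c e^{C0 r} for r large *)
  (theta_bound : exists c C0 : R, 0 < c /\ 0 < C0 /\ exists r1 : R,
      forall r : R, r1 <= r -> (theta U r <= (c * expR (C0 * r))%:E)%E)
  (* Lyapunov function W *)
  (Lyapunov : exists (W : 'rV[R]_(d + d) -> R) (w lam b : R),
      smooth W /\ 0 < w /\ (forall z, w <= W z) /\ 0 < lam /\ 0 < b /\
      forall z, L_op U eta W z <= - lam * Ham U z * W z + b) :
  exists rho : R, 0 < rho /\
    forall g : 'rV[R]_(d + d) -> R, smooth g ->
      mu_int U (fun z => (g z ^+ 2)%R) = 1%:E ->
      (Ent U (fun z => (g z ^+ 2)%R)
        <= rho%:E * mu_int U (energy_density U eta g))%E.
Proof.
have [W [w [lam [b [sW [w0 [Ww [lam0 [b0 LW]]]]]]]]] := Lyapunov.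
have lyap h Ch :=
  @lyapunov_ineq R d U eta U_smooth U_ge1 eta_ge0 W w lam b sW w0 Ww lam0 b0 LW h Ch.
have A10 : 0 <= 32 / lam by rewrite divr_ge0// ltW.
have B10 : 0 < 16 * (32 + b / w) / lam by rewrite !mulr_gt0 ?invr_gt0// addr_gt0// divr_gt0.
have [cg [Cg [cg0 [Cg0 gradH]]]] :=
  gradient_bound U_smooth U_ge1 U_coercive grad_H_bound theta_bound.
pose p := gibbs U.
have cp : continuous p by exact: continuous_gibbs.
have mp : meas p by exact: cont_meas.
have p0 z : 0 <= p z by exact/ltW/gibbs_gt0.
have ZE : Zconst U = fine (lebI p) by rewrite /Zconst leb_intE.
have Z0 : 0 <= Zconst U by rewrite ZE fine_ge0// lebI_ge0.
(* [fine] sends an infinite integral to [0], so this case includes a divergent partition function.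
   Then every [mu_int] is [0] and the normalisation of [g] is contradictory. *)
have [Zz|Znz] := eqVneq (Zconst U) 0.
  exists 1; split => // g sg; rewrite /mu_int Zz invr0 mul0e => /eqP.
  by rewrite eqe eq_sym oner_eq0.
set Z := Zconst U in Z0 Znz ZE *.
have Zp : 0 < Z by rewrite lt_neqAle eq_sym Znz.
have pfin : lebI p \is a fin_num.
  by move: Znz; rewrite ZE; case: (lebI p) => [r||]//=; rewrite eqxx.
have pE : lebI p = Z%:E by rewrite ZE fineK.
have poo : (lebI p < +oo)%E by rewrite pE ltry.
have [C C0 poin] := poincare_gibbs U_smooth U_ge1 eta_ge0 U_coercive A10 B10 lyap poo.
have [A [B [A0 [B0 def]]]] :=
  defective_log_sobolev U_smooth U_ge1 eta_ge0 cg0 Cg0 gradH A10 B10 lyap Zp.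
have BC : 0 < B * C by exact: mulr_gt0.
(* The part [A + 4 B C] serves the case of large variance, the part multiplied by [48] the case of
   small variance; the sum covers both. *)
exists (A + 4 * (B * C) + 48 * (C + (A + B * C))); split.
  by rewrite !addr_gt0// mulr_gt0// !addr_gt0.
move=> g sg gint.
have Cg1 := smooth_C1 sg; have cg' := C1_continuous Cg1.
have mg : meas g by exact: cont_meas.
pose g2p z := g z ^+ 2 * p z.
have mg2p : meas g2p by apply: measM => //; exact: measM.
have g2p0 z : 0 <= g2p z by rewrite mulr_ge0 ?sqr_ge0.
pose E := lebI (fun z => energy_density U eta g z * p z)%R.
have cE : continuous (energy_density U eta g) by exact: continuous_energy.
have mE : meas (fun z => energy_density U eta g z * p z).
  by apply: measM => //; exact: cont_meas.
have E0 : (0 <= E)%E by apply: lebI_ge0 => z; rewrite mulr_ge0// energy_ge0.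
have Zi : 0 < Z^-1 by rewrite invr_gt0.
have muE : mu_int U (energy_density U eta g) = (Z^-1%:E * E)%E.
  by rewrite /mu_int leb_intE.
have g2E : lebI g2p = Z%:E.
  move: gint; rewrite /mu_int leb_intE// -/(lebI g2p) -/Z => gint.
  have := congr1 (fun x => Z%:E * x)%E gint.
  by rewrite muleA -EFinM mulfV// mul1e mule1.
pose f z := g z ^+ 2 * ln (g z ^+ 2) * p z.
have mg2 : meas (fun z => g z ^+ 2) by exact: measM.
have mf : meas f.
  by apply: measM => //; apply: measM => //; exact: (measurableT_comp (@measurable_ln R) mg2).
pose X := (\int[@leb R (d + d)]_z (f z)%:E)%E.
have EntE : Ent U (fun z => g z ^+ 2) = (Z^-1%:E * X)%E.
  by rewrite /Ent gint /= ln1 ?mulr0 sube0 /mu_int leb_intE.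
rewrite EntE muE muleCA lee_pmul2l ?lte_fin//.
have [Eoo|Efin] := eqVneq E +oo%E.
  by rewrite Eoo gt0_muley ?leey// lte_fin !addr_gt0// mulr_gt0// !addr_gt0.
have {}Efin : E \is a fin_num by rewrite ge0_fin_numE// ltey.
have lnpmeas (h : 'rV[R]_(d + d) -> R) : C1 h -> meas (fun z => h z ^+ 2 * lnp (h z ^+ 2) * p z).
  move=> Ch; have mh : meas h by apply: cont_meas; exact: C1_continuous.
  have mh2 : meas (fun z => h z ^+ 2) by exact: measM.
  apply: measM => //; apply: measM => //.
  apply: measurable_maxr; last exact: measurable_cst.
  exact: (measurableT_comp (@measurable_ln R) mh2).
have lnp0 (h : 'rV[R]_(d + d) -> R) z : 0 <= h z ^+ 2 * lnp (h z ^+ 2) * p z.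
  by rewrite mulr_ge0// mulr_ge0 ?sqr_ge0// lnp_ge0.
pose P := lebI (fun z => g z ^+ 2 * lnp (g z ^+ 2) * p z)%R.
have Pdef : (P <= A%:E * E + B%:E * Z%:E)%E.
  have gZ : (lebI g2p <= Z%:E)%E by rewrite g2E.
  by rewrite -g2E; exact: (def g Cg1 gZ).
have Pfin : (P < +oo)%E.
  by apply: (le_lt_trans Pdef); rewrite -(fineK Efin) -!EFinM -EFinD ltry.
have iP := lebI_integrable (lnpmeas g Cg1) (lnp0 g) Pfin.
have ip : (leb R (d + d)).-integrable setT (fun z => (p z)%:E).
  by apply: lebI_integrable => //; rewrite pE ltry.
(* The entropy integrand has no sign; its integrability comes from the finiteness of [P] and of the
   mass of [p]. *)
have ifX : (leb R (d + d)).-integrable setT (fun z => (f z)%:E).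
  apply: (le_integrable measurableT _ _ (integrableD measurableT iP ip)).
    exact/measurable_EFinP.
  move=> z _; rewrite -EFinD !abse_EFin lee_fin [leRHS]ger0_norm; last by rewrite addr_ge0.
  rewrite /f normrM (ger0_norm (p0 z)) -[X in _ + X]mul1r -mulrDl ler_wpM2r//.
  by apply: abs_xlnx_le; exact: sqr_ge0.
have XP : (X <= P)%E.
  apply: le_integral => // z _; rewrite lee_fin ler_wpM2r// ler_wpM2l ?sqr_ge0//.
  exact: ln_le_lnp.
have gfin : (lebI g2p < +oo)%E by rewrite g2E ltry.
have [c vC] := poin g Cg1 gfin.
have Ch := C1B_cst c Cg1.
pose v := lebI (fun z => (g z - c) ^+ 2 * p z)%R.
have {}vC : (v <= C%:E * E)%E := vC.
have v0 : (0 <= v)%E by apply: lebI_ge0 => z; rewrite mulr_ge0 ?sqr_ge0.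
have vfin : v \is a fin_num.
  by rewrite ge0_fin_numE//; apply: (le_lt_trans vC); rewrite -(fineK Efin) -EFinM ltry.
have e0 : 0 <= fine E by exact: fine_ge0.
have fv0 : 0 <= fine v by exact: fine_ge0.
have vC' : fine v <= C * fine E by rewrite -lee_fin EFinM !fineK.
rewrite -(fineK Efin) -EFinM.
have rhoE : (A + 4 * (B * C) + 48 * (C + (A + B * C))) * fine E =
    A * fine E + 4 * (B * C * fine E) + 48 * (C * fine E + (A * fine E + B * C * fine E)).
  by ring.
(* Large variance: the defect [B Z] is at most [4 B v], and Poincaré turns it into energy. *)
have [vZ|vZ] := leP (Z / 4) (fine v).
  apply: (le_trans XP); apply: (le_trans Pdef).
  rewrite -(fineK Efin) -!EFinM -EFinD lee_fin.
  have BZ : B * Z <= 4 * (B * C * fine E).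
    have -> : 4 * (B * C * fine E) = B * (4 * (C * fine E)) by ring.
    by rewrite ler_pM2l//; lra.
  have Ce : 0 <= C * fine E by rewrite mulr_ge0// ltW.
  have Ae : 0 <= A * fine E by rewrite mulr_ge0// ltW.
  have BCe : 0 <= B * C * fine E by rewrite mulr_ge0// ltW.
  rewrite rhoE; move: (B * Z) (A * fine E) (C * fine E) (B * C * fine E) BZ Ae Ce BCe.
  by move=> *; lra.
have EE : lebI (fun z => energy_density U eta (fun z => g z - c) z * p z) = E.
  by apply: eq_lebI => z; rewrite energyB_cst.
pose Q := lebI (fun z => (g z - c) ^+ 2 * lnp ((g z - c) ^+ 2) * p z)%R.
have Qdef : (Q <= A%:E * E + B%:E * v)%E.
  have vZ' : (v <= Z%:E)%E by rewrite -(fineK vfin) lee_fin; lra.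
  by rewrite -EE; exact: (def _ Ch vZ').
have Qfin : (Q < +oo)%E.
  by apply: (le_lt_trans Qdef); rewrite -(fineK Efin) -(fineK vfin) -!EFinM -EFinD ltry.
have Q0 : (0 <= Q)%E by apply: lebI_ge0 => z; exact: (lnp0 (fun z => g z - c)).
have Qf : Q \is a fin_num by rewrite ge0_fin_numE.
have iQ := lebI_integrable (lnpmeas _ Ch) (lnp0 (fun z => g z - c)) Qfin.
have mh2 : meas (fun z => (g z - c) ^+ 2 * p z).
  have mh : meas (fun z => g z - c) by apply: cont_meas; exact: C1_continuous.
  exact: (measM (measM mh mh) mp).
have h20 z : 0 <= (g z - c) ^+ 2 * p z by rewrite mulr_ge0 ?sqr_ge0.
have voo : (v < +oo)%E by rewrite -(fineK vfin) ltry.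
have iv : (leb R (d + d)).-integrable setT (fun z => ((g z - c) ^+ 2 * p z)%:E).
  exact: (lebI_integrable mh2 h20 voo).
have ig2 : (leb R (d + d)).-integrable setT (fun z => (g2p z)%:E).
  have g2oo : (lebI g2p < +oo)%E by rewrite g2E ltry.
  exact: (lebI_integrable mg2p g2p0 g2oo).
(* Integrating [g^2 <= 2 c^2 + 2 (g - c)^2] gives [Z <= 2 c^2 Z + 2 v], and [v < Z / 4]. *)
have c4 : 4^-1 <= c ^+ 2.
  have : (Z%:E <= (2 * c ^+ 2)%:E * Z%:E + 2%:E * v)%E.
    have c20 : 0 <= 2 * c ^+ 2 by rewrite mulr_ge0 ?sqr_ge0.
    have e1 : lebI (fun z => 2 * c ^+ 2 * p z) = ((2 * c ^+ 2)%:E * Z%:E)%E.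
      by rewrite (lebIZ mp p0 c20) pE.
    have e2 : lebI (fun z => 2 * ((g z - c) ^+ 2 * p z)) = (2%:E * v)%E.
      exact: (lebIZ mh2 h20 (ler0n R 2)).
    have m1 : meas (fun z => 2 * c ^+ 2 * p z).
      exact: (measM (@meas_cst R (d + d) (2 * c ^+ 2)) mp).
    have m2 : meas (fun z => 2 * ((g z - c) ^+ 2 * p z)).
      exact: (measM (@meas_cst R (d + d) 2) mh2).
    have p1 z : 0 <= 2 * c ^+ 2 * p z by exact: mulr_ge0 c20 (p0 z).
    have p2 z : 0 <= 2 * ((g z - c) ^+ 2 * p z) by exact: mulr_ge0 (ler0n R 2) (h20 z).
    rewrite -e1 -e2 -(lebID m1 m2 p1 p2) -g2E.
    apply: (le_lebI mg2p (measD m1 m2) g2p0).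
    move=> z; rewrite (mulrA 2 ((g z - c) ^+ 2)) -mulrDl; apply: (ler_wpM2r (p0 z)).
    by have := sqr_ge0 (g z - 2 * c); nra.
  rewrite -(fineK vfin) -!EFinM -EFinD lee_fin; nra.
have key : (X <= 48%:E * (v + Q) +
    ((1 + ln (c ^+ 2))%:E * lebI g2p - (c ^+ 2)%:E * lebI p))%E.
  apply: (lebI_le_comb ifX iv iQ ig2 ip) => z.
  apply: (le_trans (ler_wpM2r (p0 z) (entropy_shift_le (g z) c4))).
  by rewrite le_eqVlt; apply/predU1P; left; rewrite /g2p; ring.
apply: (le_trans key); rewrite g2E pE.
move: Qdef; rewrite -(fineK Efin) -(fineK vfin) -(fineK Qf)
  -!(EFinM, EFinD, EFinB) !lee_fin => Qdef.
have c2p : 0 < c ^+ 2 by apply: lt_le_trans c4; rewrite invr_gt0.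
exact: (combine_constants Zp A0 B0 C0 e0 Qdef vC' (ln_le_sub1 c2p)).
Qed.
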